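(* Let $\beta\mapsto g(\beta)$, $\beta\in[0,T)$, be a volume-normalized Ricci flow on $\Sigma$, and let $t\doteq\beta^{\ast}-\beta$ be the backward time. Let $f_t$ and $\tau(t)>0$ solve $$\frac{\partial}{\partial t}f_t=\Delta_{g(t)}f_t-|\nabla f_t|^2+R(t)-\tfrac32\tau(t)^{-1},\qquad \frac{d}{dt}\tau(t)=1-\tfrac23\langle R(t)\rangle_{\Sigma_t}\tau(t),$$ with $d\varpi(t)=(4\pi\tau(t))^{-3/2}e^{-f_t}d\mu_{g(t)}$ a probability measure. Define $$\mathcal{G}(t)\doteq S[d\varpi(t)\parallel d\Pi_t]+\ln\frac{(4\pi\tau(t))^{3/2}}{Vol(\Sigma)}+\frac32$$ and the shrinker entropy $$W(t)\doteq\int_\Sigma\left[\tau(t)\left(|\nabla f_t|^2+R(t)\right)+f_t-3\right]\frac{e^{-f_t}}{(4\pi\tau(t))^{3/2}}\,d\mu_{g(t)}.$$ Then $$\frac{d}{dt}\left(\tau(t)\,\mathcal{G}(t)\right)=-W(t)-\tfrac23\langle R(t)\rangle_{\Sigma_t}\,\tau(t)\,\mathcal{G}(t).$$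
   Context: $\Sigma$ is a smooth closed three-dimensional manifold. The volume-normalized Ricci flow is a smooth family of metrics with $\frac{\partial}{\partial\beta}g_{ab}=-2R_{ab}+\frac23\langle R(\beta)\rangle_{\Sigma_\beta}g_{ab}$, where $\langle R(\beta)\rangle_{\Sigma_\beta}$ is the average of the scalar curvature with respect to $Vol(\Sigma,g(\beta))^{-1}d\mu_{g(\beta)}$; the volume $Vol(\Sigma)$ is constant along the flow. For fixed $\beta^{\ast}\in[0,T)$, quantities labelled by $t$ are evaluated at $\beta=\beta^{\ast}-t$, e.g. $g(t)$ means $g(\beta^{\ast}-t)$. $d\Pi_t=Vol(\Sigma)^{-1}d\mu_{g(t)}$ is the normalized Riemannian measure, and $S[d\varpi\parallel d\Pi]=\int_\Sigma\ln\frac{d\varpi}{d\Pi}\,d\varpi$ is the relative entropy. *)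

(* Defs.v *)
From HB Require Import structures.
From mathcomp Require Import all_boot all_order all_algebra.
From mathcomp Require Import all_classical all_reals all_analysis.

Set Implicit Arguments.
Unset Strict Implicit.
Unset Printing Implicit Defensive.

Import Order.TTheory GRing.Theory Num.Theory.
Import numFieldNormedType.Exports.

Local Open Scope classical_set_scope.
Local Open Scope ring_scope.

Section Calculus.
Context {R : realType}.

Definition partial (i : 'I_3) (u : 'rV[R]_3 -> R) : 'rV[R]_3 -> R :=
  fun x => 'D_(delta_mx 0 i) u x.

(* h has derivative l at t relative to the time interval I, that is, the
   derivative is one-sided at an end point of I that belongs to I. *)
Definition derives_in (I : set R) (h : R -> R) (t l : R) : Prop :=
  (h s - h t) / (s - t) @[s --> within I t^'] --> l.

Definition derive_in (I : set R) (h : R -> R) (t : R) : R :=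
  lim ((h s - h t) / (s - t) @[s --> within I t^']).

(* F (s, x) is C^k on I x U: all iterated partial derivatives up to order k,
   in time (relative to I) and in space, exist and are jointly continuous on
   I x U. *)
Fixpoint Ck_family (k : nat) (I : set R) (U : set 'rV[R]_3)
    (F : R -> 'rV[R]_3 -> R) : Prop :=
  {within I `*` U, continuous (fun q : R * 'rV[R]_3 => F q.1 q.2)} /\
  (if k is k'.+1 then
     [/\ forall s x, I s -> U x -> derives_in I (F^~ x) s (derive_in I (F^~ x) s),
         Ck_family k' I U (fun s x => derive_in I (F^~ x) s),
         forall i s x, I s -> U x -> derivable (F s) x (delta_mx 0 i) &
         forall i, Ck_family k' I U (fun s => partial i (F s))]
   else True).

Definition smooth_family (I : set R) (U : set 'rV[R]_3)
    (F : R -> 'rV[R]_3 -> R) : Prop :=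
  forall k, Ck_family k I U F.

(* Smoothness of a function of x alone, seen as a family constant in time. *)
Definition smooth_on (U : set 'rV[R]_3) (u : 'rV[R]_3 -> R) : Prop :=
  smooth_family setT U (fun=> u).

End Calculus.

(* A smooth atlas of dimension 3 on the space M.  The chart c is the
   homeomorphism to_coord c from chart_dom c onto an open set of R^3, with inverse
   of_coord c; chart_at x is a chart around x. *)
Record smooth_atlas (R : realType) (M : ptopologicalType) := SmoothAtlas {
  chart : Type;
  chart_dom : chart -> set M;
  to_coord : chart -> M -> 'rV[R]_3;
  of_coord : chart -> 'rV[R]_3 -> M;
  chart_at : M -> chart;
  dom_open : forall c, open (chart_dom c);
  cod_open : forall c, open (to_coord c @` chart_dom c);
  to_coordK : forall c p, chart_dom c p -> of_coord c (to_coord c p) = p;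
  to_coord_continuous : forall c, {within chart_dom c, continuous (to_coord c)};
  of_coord_continuous : forall c,
    {within to_coord c @` chart_dom c, continuous (of_coord c)};
  dom_chart_at : forall p, chart_dom (chart_at p) p;
  transition_smooth : forall c c' i,
    smooth_on (to_coord c @` (chart_dom c `&` chart_dom c'))
      (fun x => to_coord c' (of_coord c x) 0 i) }.

Arguments chart_at {R M} s p.

Definition chart_cod (R : realType) (M : ptopologicalType) (A : smooth_atlas R M)
  (c : chart A) : set 'rV[R]_3 := to_coord c @` chart_dom c.

(* M with its Borel sigma-algebra *)
Definition borel (M : ptopologicalType) := g_sigma_algebraType (@open M).

(* In this section G is the matrix (g_ij) of a metric in one chart, as a
   function of the coordinates x, and u is a function of x. *)
Section Coordinates.
Context {R : realType}.
Implicit Types (G : 'rV[R]_3 -> 'M[R]_3) (u : 'rV[R]_3 -> R) (x : 'rV[R]_3).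

(* Gamma^k_ij *)
Definition christoffel G (k i j : 'I_3) x : R :=
  2^-1 * \sum_(l < 3) invmx (G x) k l *
    (partial i (fun y => G y j l) x + partial j (fun y => G y i l) x
     - partial l (fun y => G y i j) x).

(* R_ij = d_k Gamma^k_ij - d_j Gamma^k_ik
          + Gamma^k_kl Gamma^l_ij - Gamma^k_jl Gamma^l_ik,
   which is positive on round spheres *)
Definition ricci G (i j : 'I_3) x : R :=
  \sum_(k < 3) (partial k (christoffel G k i j) x
                - partial j (christoffel G k i k) x)
  + \sum_(k < 3) \sum_(l < 3)
      (christoffel G k k l x * christoffel G l i j x
       - christoffel G k j l x * christoffel G l i k x).

Definition scal G x : R :=
  \sum_(i < 3) \sum_(j < 3) invmx (G x) i j * ricci G i j x.

Definition grad_sq G u x : R :=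
  \sum_(i < 3) \sum_(j < 3) invmx (G x) i j * partial i u x * partial j u x.

Definition laplacian G u x : R :=
  \sum_(i < 3) \sum_(j < 3) invmx (G x) i j *
    (partial i (partial j u) x
     - \sum_(k < 3) christoffel G k i j x * partial k u x).

Definition vec3 (x : R * R * R) : 'rV[R]_3 :=
  \row_(i < 3) [:: x.1.1; x.1.2; x.2]`_i.

End Coordinates.

Section Manifold.
Context {R : realType} {M : ptopologicalType} (A : smooth_atlas R M).

(* Components of a covariant 2-tensor field in every chart, as functions of
   the coordinates; only the values on chart_cod c are meaningful. *)
Definition tensor2 := chart A -> 'rV[R]_3 -> 'M[R]_3.

(* With row vectors, the coordinates of a tangent vector change by
   v |-> v *m J, whence the transformation law of the components of g. *)
Definition riemannian (g : tensor2) : Prop :=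
  [/\ forall c x, chart_cod c x -> (g c x)^T = g c x,
      forall c x (v : 'rV[R]_3), chart_cod c x -> v != 0 ->
        0 < (v *m g c x *m v^T) 0 0 &
      forall c c' p, chart_dom c p -> chart_dom c' p ->
        let J := 'J (to_coord c' \o of_coord c) (to_coord c p) in
        g c (to_coord c p) = J *m g c' (to_coord c' p) *m J^T].

Definition smooth_metrics (I : set R) (g : R -> tensor2) : Prop :=
  (forall s, I s -> riemannian (g s)) /\
  (forall (c : chart A) i j,
     smooth_family I (chart_cod c) (fun s x => g s c x i j)).

Definition smooth_functions (I : set R) (f : R -> M -> R) : Prop :=
  forall c : chart A, smooth_family I (chart_cod c) (fun s => f s \o of_coord c).

(* mu is the Riemannian measure of g: d mu = sqrt (det g) dx in every chart.
   The charts cover M, so this determines mu. *)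
Definition riemannian_measure (g : tensor2)
    (mu : {measure set (borel M) -> \bar R}) : Prop :=
  forall (c : chart A) (B : set (borel M)), measurable B -> B `<=` chart_dom c ->
  (mu B = \int[(lebesgue_measure \x lebesgue_measure) \x lebesgue_measure]_(
            x in vec3 @^-1` (to_coord c @` B))
          (Num.sqrt (\det (g c (vec3 x))))%:E)%E.

(* Scalar invariants as functions on M; their values do not depend on the
   chart around p. *)
Definition scalar_curvature (g : tensor2) (p : M) : R :=
  let c := chart_at A p in scal (g c) (to_coord c p).

Definition gradient_sq (g : tensor2) (u : M -> R) (p : M) : R :=
  let c := chart_at A p in grad_sq (g c) (u \o of_coord c) (to_coord c p).

End Manifold.

Section Measures.
Context {R : realType} {M : ptopologicalType}.
Implicit Types mu : {measure set (borel M) -> \bar R}.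

Definition volume mu : R := fine (mu setT).

(* Vol^-1 mu; the second argument of mnormalize is only used if the volume
   is 0 or +oo, which does not happen on a closed manifold. *)
Definition normalized mu : probability (borel M) R :=
  mnormalize mu (\d_(point : borel M)).

Definition average mu (h : M -> R) : R :=
  (\int[normalized mu]_(p in [set: borel M]) h p)%R.

Definition has_density (P : probability (borel M) R) mu (w : M -> R) : Prop :=
  forall B : set (borel M), measurable B ->
  (P B = \int[mu]_(p in B) (w p)%:E)%E.

Local Open Scope charge_scope.

(* S[P || Q] = int ln (dP/dQ) dP, with the Radon-Nikodym derivative *)
Definition relative_entropy (P Q : probability (borel M) R) : R :=
  (\int[P]_(p in [set: borel M])
     ln (fine (('d (charge_of_finite_measure P) '/d Q) p)))%R.

End Measures.

Section Flow.
Context {R : realType} {M : ptopologicalType} (A : smooth_atlas R M).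

Definition flow_times (T : \bar R) : set R :=
  [set b | 0 <= b /\ (b%:E < T)%E].

Definition mean_scalar_curvature (g : tensor2 A)
    (mu : {measure set (borel M) -> \bar R}) : R :=
  average mu (scalar_curvature g).

(* g is a volume-normalized Ricci flow on [0, T[ and mu b is the Riemannian
   measure of g b; the flow equation is the equality of components in every
   chart. *)
Definition normalized_ricci_flow (T : \bar R) (g : R -> tensor2 A)
    (mu : R -> {measure set (borel M) -> \bar R}) : Prop :=
  [/\ smooth_metrics (flow_times T) g,
      forall b, flow_times T b -> riemannian_measure (g b) (mu b) &
      forall b (c : chart A) x i j, flow_times T b -> chart_cod c x ->
        derives_in (flow_times T) (fun s => g s c x i j) b
          (- 2 * ricci (g b c) i j x
           + 2 / 3 * mean_scalar_curvature (g b) (mu b) * g b c x i j)].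

Definition heat_weight (tau : R) : R := (4 * pi * tau) `^ (3 / 2).

Definition G_functional (mu : {measure set (borel M) -> \bar R})
    (varpi : probability (borel M) R) (tau : R) : R :=
  relative_entropy varpi (normalized mu)
  + ln (heat_weight tau / volume mu) + 3 / 2.

Definition W_functional (g : tensor2 A)
    (mu : {measure set (borel M) -> \bar R}) (f : M -> R) (tau : R) : R :=
  (\int[mu]_(p in [set: borel M])
     ((tau * (gradient_sq g f p + scalar_curvature g p) + f p - 3)
      * (expR (- f p) / heat_weight tau)))%R.

End Flow.

(* Main.v *)
(* Since d(varpi)/d(Pi) = Vol (4 pi tau)^(-3/2) e^(-f), the constants cancel and
   G(t) = 3/2 - (4 pi tau)^(-3/2) K(t) with K(t) = int f e^(-f) dmu_t.  Along the
   backward flow (d/dt) dmu = (R - <R>) dmu, so that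
     (d/dt) (f e^(-f) dmu) = ((1 - f) e^(-f) (Lap f - |grad f|^2 + R - 3/(2 tau))
                              + f e^(-f) (R - <R>)) dmu.
   Removing div ((1 - f) e^(-f) grad f), whose integral vanishes, leaves
     K' = int e^(-f) (|grad f|^2 + R - 3/(2 tau) + (3/(2 tau) - <R>) f) dmu,
   and the theorem follows from the equation of tau and int e^(-f) dmu =
   (4 pi tau)^(3/2).  Integrals over the manifold are reduced by a C^1 partition
   of unity to integrals over coordinate cubes, on which the time derivative
   passes under the integral sign and the divergence theorem is Fubini's theorem
   with the fundamental theorem of calculus. *)

Require Import Defs.
From HB Require Import structures.
From mathcomp Require Import all_boot all_order all_algebra.
From mathcomp Require Import all_classical all_reals all_analysis.
From mathcomp Require Import measurable_realfun ring lra.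

Set Implicit Arguments.
Unset Strict Implicit.
Unset Printing Implicit Defensive.

Import Order.TTheory GRing.Theory Num.Theory.
Import numFieldNormedType.Exports.

Local Open Scope classical_set_scope.
Local Open Scope ring_scope.

(** * Derivatives relative to a time interval *)

(** Time derivatives are relative to an interval and may be one-sided, so the calculus in time rests
    on Caratheodory's form of the derivative. The Riemannian measure is known only on Borel sets
    inside chart domains, and functions are differentiated only in charts. The divergence theorem is
    therefore not set up for global vector fields. For a partition function chi_p, the flux of chi_p
    phi(f) grad f vanishes on the faces of its cube; this gives the identity on one piece up to the
    term phi(f) <grad chi_p, grad f>, and these terms cancel in the sum over p because the chi_p add
    up to 1. Only first derivatives of the chi_p occur, hence class C^1 suffices. The choice phi(y)
    = (1 - y) e^(-y) is the derivative of y e^(-y), so phi(f) is exactly the factor of Lap f in the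
    time derivative of f e^(-f). Ric is never differentiated: its continuity and its change of
    charts are read off from the flow equation. Positivity and finiteness of the volume come from
    varpi being a probability measure whose density is bounded below on the compact manifold. *)

Section TimeDerivative.
Context {R : realType}.
Implicit Types (I : set R) (h k : R -> R) (s t l m : R).

(** Caratheodory's form of the derivative: [q] is the difference quotient, completed at [t] by the
    derivative. It replaces division by s - t by an equation and the punctured limit by an ordinary
    one, so that the rules of calculus become algebra on the slopes. *)
Lemma derives_inP I h t l :
  derives_in I h t l <->
  exists q : R -> R, [/\ forall s, I s -> h s - h t = q s * (s - t),
    q t = l & q s @[s --> within I (nbhs t)] --> l].
Proof.
split=> [dh|[q [hq qt cq]]].
  exists (fun s => if s == t then l else (h s - h t) / (s - t)); split.
  - move=> s _; case: eqVneq => [->|st]; first by rewrite !subrr mulr0.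
    by rewrite divfK// subr_eq0.
  - by rewrite eqxx.
  - apply/cvgrPdist_le => e e0.
    move/cvgrPdist_le : dh => /(_ _ e0); rewrite !near_withinE => dh.
    apply: filterS dh => s H Is.
    case: eqVneq => [_|st]; first by rewrite subrr normr0 ltW.
    exact: H.
have {}cq : q s @[s --> within I t^'] --> l.
  apply: cvg_trans cq; apply: cvg_fmap2 => P; rewrite /within/= => HP.
  by rewrite /dnbhs/within /=; apply: filterS HP => s + _.
apply: cvg_trans cq; apply: near_eq_cvg; rewrite near_withinE.
near=> s => Is; rewrite hq// mulfK// subr_eq0.
by near: s; exact: nbhs_dnbhs_neq.
Unshelve. all: by end_near. Qed.

Lemma derives_in_ext I h k t l : I t -> {in I, h =1 k} ->
  derives_in I h t l -> derives_in I k t l.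
Proof.
move=> It hk /derives_inP[q [hq qt cq]]; apply/derives_inP; exists q; split=> //.
by move=> s Is; rewrite -!hk ?inE//; exact: hq.
Qed.

Lemma derives_in_cst I c t : derives_in I (fun=> c) t 0.
Proof.
apply/derives_inP; exists (fun=> 0); split => //; last exact: cvg_cst.
by move=> s _; rewrite subrr mul0r.
Qed.

Lemma derives_inD I h k t l m : derives_in I h t l -> derives_in I k t m ->
  derives_in I (fun s => h s + k s) t (l + m).
Proof.
move=> /derives_inP[q [hq qt cq]] /derives_inP[p [kp pt cp]].
apply/derives_inP; exists (fun s => q s + p s); split => //.
- by move=> s Is; rewrite mulrDl -hq// -kp//; ring.
- by rewrite qt pt.
- exact: cvgD.
Qed.

Lemma derives_in_cvg I h t l : derives_in I h t l ->
  h s @[s --> within I (nbhs t)] --> h t.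
Proof.
move=> /derives_inP[q [hq qt cq]].
have c : h t + q s * (s - t) @[s --> within I (nbhs t)] --> h t + l * (t - t).
  apply: cvgD; first exact: cvg_cst.
  apply: cvgM => //; apply: cvgB; last exact: cvg_cst.
  exact: cvg_within.
rewrite subrr mulr0 addr0 in c.
apply: cvg_trans c; apply: near_eq_cvg; rewrite near_withinE.
by near=> s => Is; rewrite -hq//; ring.
Unshelve. all: by end_near. Qed.

Lemma derives_inM I h k t l m : derives_in I h t l -> derives_in I k t m ->
  derives_in I (fun s => h s * k s) t (l * k t + h t * m).
Proof.
move=> dh /derives_inP[p [kp pt cp]]; have ch := derives_in_cvg dh.
move: dh => /derives_inP[q [hq qt cq]].
apply/derives_inP; exists (fun s => q s * k t + h s * p s); split => //.
- move=> s Is; transitivity ((h s - h t) * k t + h s * (k s - k t)); first ring.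
  by rewrite hq// kp//; ring.
- by rewrite qt pt.
- by apply: cvgD; [apply: cvgM => //; exact: cvg_cst|exact: cvgM].
Qed.

Lemma derives_in_comp I h (phi : R -> R) t l m :
  derives_in I h t l -> is_derive (h t) 1 phi m ->
  derives_in I (fun s => phi (h s)) t (m * l).
Proof.
move=> dh dphi; have ch := derives_in_cvg dh.
move: dh => /derives_inP[q [hq qt cq]].
set a := h t in ch dphi *.
(* [h s] may take the value [h t] at points s other than t, so the slope of [phi] at [a] must also
   have a value at [a]. *)
pose psi y := if y == a then m else (phi y - phi a) / (y - a).
have cpsi : psi y @[y --> a] --> m.
  apply/cvgrPdist_le => e e0.
  case: dphi => + /esym mE; rewrite /derive in mE.
  move=> /cvg_ex[z /[dup] /cvg_lim/=]; rewrite -mE => <-//.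
  move=> /cvgrPdist_le/(_ _ e0)/=; rewrite /dnbhs near_withinE => dphi.
  have : \forall y \near a, y - a != 0 -> `|m - (y-a)^-1 *: (phi ((y - a) *: 1 + a) - phi a)| <= e.
    have sub0 : (y - a) @[y --> a] --> (0 : R).
      by rewrite -[X in _ --> X](subrr a); apply: cvgB; [exact: cvg_id|exact: cvg_cst].
    by move: (sub0 _ dphi); rewrite /nbhs/=.
  apply: filterS => y; rewrite subr_eq0 /psi; case: eqVneq => [_ _|_ /(_ isT)].
    by rewrite subrr normr0 ltW.
  by rewrite [_%:A]mulr1 subrK mulrC.
apply/derives_inP; exists (fun s => psi (h s) * q s); split.
- move=> s Is; rewrite -mulrA -hq// /psi -/a.
  by case: eqVneq => [->|ha]; rewrite ?subrr ?mulr0 ?divfK// subr_eq0.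
- by rewrite /psi -/a eqxx qt.
- apply: cvgM => //; apply: (cvg_comp h psi ch cpsi).
Qed.

Lemma derives_in_sum I (T : Type) (r : seq T) (h : T -> R -> R) (l : T -> R) t :
  (forall i, derives_in I (h i) t (l i)) ->
  derives_in I (fun s => \sum_(i <- r) h i s) t (\sum_(i <- r) l i).
Proof.
move=> dh; elim: r => [|i r IH].
  rewrite big_nil; under eq_fun do rewrite big_nil.
  exact: derives_in_cst.
rewrite big_cons; under eq_fun do rewrite big_cons.
exact: derives_inD.
Qed.

Lemma derives_in_unique I h t l m : ProperFilter (within I t^') ->
  derives_in I h t l -> derives_in I h t m -> l = m.
Proof. by move=> P; exact: cvg_unique. Qed.

Lemma derives_in_derive_in I h t l : ProperFilter (within I t^') ->
  derives_in I h t l -> derive_in I h t = l.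
Proof. by move=> P; exact: cvg_lim. Qed.

Lemma derives_in_sub I J h t l : J `<=` I ->
  derives_in I h t l -> derives_in J h t l.
Proof.
move=> JI /derives_inP[q [hq qt cq]]; apply/derives_inP; exists q; split=> //.
- by move=> s Js; apply: hq; exact: JI.
- apply: cvg_trans cq; apply: cvg_fmap2 => P; rewrite /within/=.
  by apply: filterS => s Ps /JI.
Qed.

Lemma derives_in_reverse I (b : R) h t l : derives_in I h (b - t) l ->
  derives_in [set s | I (b - s)] (fun s => h (b - s)) t (- l).
Proof.
move=> /derives_inP[q [hq qt cq]]; apply/derives_inP.
exists (fun s => - q (b - s)); split.
- by move=> s Is; rewrite hq//; ring.
- by rewrite qt.
- apply: cvgN; move=> P /cq; rewrite /nbhs/=/within/= => HP.
  have c : b - s @[s --> t] --> b - t.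
    by apply: cvgB; [exact: cvg_cst|exact: cvg_id].
  by move: (c _ HP); rewrite /nbhs/=.
Qed.

Lemma derives_in_is_derive (a b : R) h t l : t \in `]a, b[%R ->
  derives_in `[a, b] h t l -> is_derive t 1 h l.
Proof.
move=> tab dh.
have nab : \forall s \near t, `[a, b]%classic s.
  apply: filterS (near_in_itvoo tab) => s; rewrite in_itv/= => /andP[sa sb].
  by rewrite /= in_itv/= !ltW.
have H : (u^-1 *: (h (u *: 1 + t) - h t)) @[u --> 0^'] --> l.
  apply/cvgrPdist_le => e e0.
  move/cvgrPdist_le : dh => /(_ _ e0); rewrite near_withinE {1}/dnbhs near_withinE => dh.
  have sh : (u *: 1 + t) @[u --> (0 : R)] --> t.
    rewrite -[X in _ --> X]add0r; apply: cvgD; last exact: cvg_cst.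
    rewrite -[X in _ --> X](scale0r (1 : R)); apply: cvgZr_tmp; exact: cvg_id.
  rewrite /dnbhs near_withinE.
  have nb : \forall s \near t, (s != t -> `[a, b]%classic s ->
      `|l - (h s - h t) / (s - t)| <= e) /\ `[a, b]%classic s.
    exact: filterI dh nab.
  have /filterS : \forall u \near (0 : R), (u%:A + t != t -> `[a, b]%classic (u%:A + t) ->
      `|l - (h (u%:A + t) - h t) / (u%:A + t - t)| <= e) /\ `[a, b]%classic (u%:A + t).
    exact: (sh _ nb).
  apply => u [] + H u0; rewrite [_%:A]mulr1 in H *.
  by rewrite -subr_eq0 addrK => /(_ u0 H); rewrite mulrC.
by apply: DeriveDef; [apply/cvg_ex; exists l|exact: cvg_lim].
Qed.

End TimeDerivative.

(** * Directional derivatives as derivatives along lines *)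

Section DirectionalDerivative.
Context {R : realType} {V : normedModType R}.
Implicit Types (u : V -> R) (x y v : V).

(** Opens directional derivatives to one-variable results: the chain rule, the mean value theorem
    and, through [derives_in] on [setT], Jacobi's formula. *)
Lemma is_derive_lineP u x v (l : R) :
  is_derive x v u l <-> is_derive (0 : R) (1 : R) (fun h : R => u (h *: v + x)) l.
Proof.
have E : (fun h : R => h^-1 *: (u (h *: v + x) - u x)) =
    (fun h : R => h^-1 *: (u ((h *: (1 : R^o) + 0) *: v + x) - u ((0 : R) *: v + x))).
  by apply/funext => h; rewrite scale0r add0r addr0 [_%:A]mulr1.
have ED : 'D_v u x = derive (fun h : R => u (h *: v + x)) (0 : R) (1 : R).
  by rewrite /derive /= E.
split=> -[d <-].
  by apply: DeriveDef; [exact: (iffLR (derivable1P _ _ _) d)|rewrite ED].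
by apply: DeriveDef; [exact: (iffRL (derivable1P _ _ _) d)|rewrite -ED].
Qed.

End DirectionalDerivative.

Section AlongLines.
Context {R : realType} {V : normedModType R}.
Implicit Types (u : V -> R) (x y v : V).

Lemma is_derive_along_line u y v (s l : R) :
  is_derive (s *: v + y) v u l -> is_derive s (1 : R) (fun s : R => u (s *: v + y)) l.
Proof.
move=> /is_derive_lineP d; apply/is_derive_lineP.
rewrite (_ : (fun _ => _) = (fun h : R => u (h *: v + (s *: v + y))))//.
by apply/funext => h; rewrite [_%:A]mulr1 scalerDl addrA.
Qed.

Lemma is_derive_compR (phi : R -> R) u x v (m l : R) :
  is_derive (u x) (1 : R) phi m -> is_derive x v u l ->
  is_derive x v (fun y => phi (u y)) (m * l).
Proof.
move=> dphi /is_derive_lineP du; apply/is_derive_lineP.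
apply: (@is_derive1_comp _ phi (fun h : R => u (h *: v + x))) => //.
by rewrite scale0r add0r.
Qed.

End AlongLines.

(** * Functions of class C^1 on open subsets of R^3 *)

Section C1.
Context {R : realType}.
Implicit Types (U : set 'rV[R]_3) (u v : 'rV[R]_3 -> R) (x y : 'rV[R]_3).

(** Continuity is meant in the whole space and not within [U], so the condition is local: it may be
    checked at each point on any set containing it. *)
Definition C1_on U u := forall x, U x -> {for x, continuous u} /\
  forall i, derivable u x (delta_mx 0 i) /\ {for x, continuous (partial i u)}.

Lemma near_eq_continuous (T : topologicalType) (S : topologicalType)
  (h k : T -> S) (x : T) : (\forall y \near x, h y = k y) ->
  {for x, continuous h} -> {for x, continuous k}.
Proof.
move=> hk ch; have E : h x = k x by exact: (nbhs_singleton hk).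
move: ch; rewrite /prop_for/continuous_at E => ch.
by apply: cvg_trans ch; apply: near_eq_cvg.
Qed.

Lemma continuous_addf (T : topologicalType) (h k : T -> R) (x : T) :
  {for x, continuous h} -> {for x, continuous k} ->
  {for x, continuous (fun y : T => h y + k y)}.
Proof. exact: continuousD. Qed.

Lemma continuous_mulf (T : topologicalType) (h k : T -> R) (x : T) :
  {for x, continuous h} -> {for x, continuous k} ->
  {for x, continuous (fun y : T => h y * k y)}.
Proof. exact: continuousM. Qed.

Lemma continuous_sumf (T : topologicalType) (I : Type) (r : seq I)
  (h : I -> T -> R) (x : T) : (forall i, {for x, continuous (h i)}) ->
  {for x, continuous (fun y : T => \sum_(i <- r) h i y)}.
Proof.
move=> ch; elim: r => [|i r IH].
  rewrite (_ : (fun y : T => \sum_(i <- [::]) h i y) = cst 0); last first.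
    by apply/funext => y; rewrite big_nil.
  exact: cst_continuous.
rewrite (_ : (fun y : T => \sum_(i <- i :: r) h i y) =
  (fun y : T => h i y + \sum_(i <- r) h i y)); first exact: continuous_addf.
by apply/funext => y; rewrite big_cons.
Qed.

Lemma continuous_compf (T : topologicalType) (h : T -> R) (phi : R -> R) (x : T) :
  {for x, continuous h} -> {for h x, continuous phi} ->
  {for x, continuous (fun y : T => phi (h y))}.
Proof. exact: continuous_comp. Qed.

(** Delivers the regularity together with the formula for the partial derivatives; the closure
    lemmas below keep this shape, one differentiation yielding both. *)
Lemma C1_on_intro U u (d : 'I_3 -> 'rV[R]_3 -> R) : open U ->
  (forall x, U x -> {for x, continuous u}) ->
  (forall x i, U x -> is_derive x (delta_mx 0 i) u (d i x)) ->
  (forall x i, U x -> {for x, continuous (d i)}) ->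
  C1_on U u /\ forall x i, U x -> partial i u x = d i x.
Proof.
move=> oU cu du cd.
have E x i : U x -> partial i u x = d i x by move=> Ux; have [_ <-] := du x i Ux.
split=> // x Ux; split; first exact: cu.
move=> i; split; first by have [] := du x i Ux.
apply: (@near_eq_continuous _ _ (d i)); last exact: cd.
by apply: filterS (open_nbhs_nbhs (conj oU Ux)) => y Uy; rewrite E.
Qed.

Lemma C1_is_derive U u x i : C1_on U u -> U x ->
  is_derive x (delta_mx 0 i) u (partial i u x).
Proof. by move=> cu /cu[_ /(_ i)[du _]]; exact: derivableP. Qed.

Lemma C1_continuous U u x : C1_on U u -> U x -> {for x, continuous u}.
Proof. by move=> cu /cu[]. Qed.

Lemma C1_partial_continuous U u x i : C1_on U u -> U x ->
  {for x, continuous (partial i u)}.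
Proof. by move=> cu /cu[_ /(_ i)[]]. Qed.

Lemma C1_cst U c : open U ->
  C1_on U (fun=> c) /\ forall x i, U x -> partial i (fun=> c) x = 0.
Proof.
move=> oU; apply: (@C1_on_intro U _ (fun _ _ => 0)) => // x *;
  exact: cst_continuous.
Qed.

Lemma C1D U u v : open U -> C1_on U u -> C1_on U v ->
  C1_on U (fun y => u y + v y) /\
  forall x i, U x -> partial i (fun y => u y + v y) x = partial i u x + partial i v x.
Proof.
move=> oU cu cv; apply: (@C1_on_intro U _ (fun i x => partial i u x + partial i v x)) => //.
- by move=> x Ux; apply: continuous_addf; [exact: (C1_continuous cu Ux)|exact: (C1_continuous cv Ux)].
- move=> x i Ux; have du := C1_is_derive i cu Ux; have dv := C1_is_derive i cv Ux.
  exact: (@is_deriveD _ _ _ u v _ _ _ _ du dv).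
- by move=> x i Ux; apply: continuous_addf;
    [exact: (C1_partial_continuous cu Ux)|exact: (C1_partial_continuous cv Ux)].
Qed.

Lemma C1M U u v : open U -> C1_on U u -> C1_on U v ->
  C1_on U (fun y => u y * v y) /\
  forall x i, U x -> partial i (fun y => u y * v y) x = u x * partial i v x + v x * partial i u x.
Proof.
move=> oU cu cv; apply: (@C1_on_intro U _ (fun i x => u x * partial i v x + v x * partial i u x)) => //.
- by move=> x Ux; apply: continuous_mulf; [exact: (C1_continuous cu Ux)|exact: (C1_continuous cv Ux)].
- move=> x i Ux; have du := C1_is_derive i cu Ux; have dv := C1_is_derive i cv Ux.
  exact: (@is_deriveM _ _ u v _ _ _ _ du dv).
- move=> x i Ux; apply: continuous_addf; apply: continuous_mulf.
  + exact: (C1_continuous cu Ux).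
  + exact: (C1_partial_continuous cv Ux).
  + exact: (C1_continuous cv Ux).
  + exact: (C1_partial_continuous cu Ux).
Qed.

Lemma C1_comp U (phi phi' : R -> R) u : open U -> C1_on U u ->
  (forall x, U x -> is_derive (u x) (1 : R) phi (phi' (u x))) ->
  (forall x, U x -> {for u x, continuous phi'}) ->
  C1_on U (fun y => phi (u y)) /\
  forall x i, U x -> partial i (fun y => phi (u y)) x = phi' (u x) * partial i u x.
Proof.
move=> oU cu dphi cphi; apply: (@C1_on_intro U _ (fun i x => phi' (u x) * partial i u x)) => //.
- move=> x Ux; apply: continuous_compf; first exact: (C1_continuous cu Ux).
  have [d _] := dphi x Ux; apply: differentiable_continuous.
  exact/derivable1_diffP.
- move=> x i Ux; have du := C1_is_derive i cu Ux.
  exact: is_derive_compR (dphi x Ux) du.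
- move=> x i Ux; apply: continuous_mulf; last exact: (C1_partial_continuous cu Ux).
  by apply: continuous_compf; [exact: (C1_continuous cu Ux)|exact: cphi].
Qed.

Lemma C1_sum U (T : Type) (r : seq T) (u : T -> 'rV[R]_3 -> R) : open U ->
  (forall k, C1_on U (u k)) ->
  C1_on U (fun y => \sum_(k <- r) u k y) /\
  forall x i, U x -> partial i (fun y => \sum_(k <- r) u k y) x = \sum_(k <- r) partial i (u k) x.
Proof.
move=> oU cu; elim: r => [|k r [IH1 IH2]].
  under eq_fun do rewrite big_nil.
  have [h1 h2] := C1_cst 0 oU; split=> // x i Ux; by rewrite big_nil h2.
under eq_fun do rewrite big_cons.
have [h1 h2] := C1D oU (cu k) IH1; split=> // x i Ux.
by rewrite big_cons h2// IH2.
Qed.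

Lemma C1_near_eq U u v : open U -> (forall x, U x -> u x = v x) ->
  C1_on U u -> C1_on U v /\ forall x i, U x -> partial i v x = partial i u x.
Proof.
move=> oU uv cu.
have nE x : U x -> \forall y \near x, u y = v y.
  by move=> Ux; apply: filterS (open_nbhs_nbhs (conj oU Ux)) => y /uv.
apply: (@C1_on_intro U _ (fun i => partial i u)) => //.
- move=> x Ux; apply: near_eq_continuous (C1_continuous cu Ux); exact: nE.
- move=> x i Ux; apply: near_eq_is_derive (C1_is_derive i cu Ux); exact: nE.
- by move=> x i Ux; exact: C1_partial_continuous Ux.
Qed.

End C1.

(** * Differentiability of C^1 functions and the chain rule *)

Section C1Differentiable.
Context {R : realType}.
Implicit Types (U : set 'rV[R]_3) (u v : 'rV[R]_3 -> R) (x y h : 'rV[R]_3).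

Lemma coord_le_norm h i : `|h 0 i| <= `|h|.
Proof.
rewrite {2}/Num.Def.normr/= mx_normrE.
by apply: le_trans (le_bigmax _ _ (0, i)).
Qed.

Lemma norm_le_coord h (e : R) : 0 <= e -> (forall i, `|h 0 i| <= e) -> `|h| <= e.
Proof.
move=> e0 he; rewrite {1}/Num.Def.normr/= mx_normrE.
by apply: bigmax_le => // -[i j] _; rewrite /= ord1.
Qed.

Lemma coord_le_ball x y (d : R) : 0 < d -> (forall i, `|x 0 i - y 0 i| < d) -> `|x - y| < d.
Proof.
move=> d0 xy; rewrite {1}/Num.Def.normr/= mx_normrE.
by apply: bigmax_lt => // -[i j] _; rewrite /= ord1 !mxE.
Qed.

(** The mean value theorem on a coordinate segment, which stays in the ball around [x] by convexity.
    The bounds min 0 t and max 0 t treat both signs of [t] at once. *)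
Lemma increment_along_coordinate u x y (i : 'I_3) (d e a t : R) :
  (forall z, `|x - z| < d ->
     derivable u z (delta_mx 0 i) /\ `|a - partial i u z| <= e) ->
  `|x - y| < d -> `|x - (t *: delta_mx 0 i + y)| < d ->
  `|u (t *: delta_mx 0 i + y) - u y - a * t| <= e * `|t|.
Proof.
move=> du xy xyt; set ei := delta_mx 0 i.
pose F (s : R) := u (s *: ei + y).
have inB s : s \in `[Num.min 0 t, Num.max 0 t] -> `|x - (s *: ei + y)| < d.
  have [->|t0] := eqVneq t 0.
    by rewrite minxx maxxx in_itv/= => /le_anti <-; rewrite scale0r add0r.
  rewrite in_itv/= => st.
  have r01 : 0 <= s / t <= 1.
    case: (ltgtP t 0) t0 st => // t0 _ /andP[].
    - move=> ts s0.
      by rewrite ler_ndivlMr// mul0r s0 ler_ndivrMr// mul1r.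
    - move=> s0 ts.
      by rewrite ler_pdivrMr// mul1r ts divr_ge0// ltW.
  have -> : x - (s *: ei + y) = (1 - s / t) *: (x - y) + (s / t) *: (x - (t *: ei + y)).
    rewrite !scalerBr !scalerDr scalerA divfK// !scalerBl !scale1r.
    by apply/matrixP => j k; rewrite !mxE; ring.
  apply: (le_lt_trans (ler_normD _ _)).
  rewrite (normrZ (1 - s / t)) (normrZ (s / t)).
  have /andP[r0 r1] := r01.
  rewrite (ger0_norm r0) ger0_norm ?subr_ge0//.
  have [->|rn0] := eqVneq (s / t) 0; first by rewrite subr0 mul0r addr0 mul1r.
  have rp : 0 < s / t by rewrite lt_neqAle eq_sym rn0.
  have : (1 - s / t) * `|x - y| <= (1 - s / t) * d by rewrite ler_wpM2l ?subr_ge0// ltW.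
  have : s / t * `|x - (t *: ei + y)| < s / t * d by rewrite ltr_pM2l.
  lra.
have dF s : s \in `[Num.min 0 t, Num.max 0 t] -> is_derive s (1 : R) F (partial i u (s *: ei + y)).
  move=> /inB /du[d1 _]; apply: is_derive_along_line; exact: derivableP.
have mM : Num.min 0 t <= Num.max 0 t by rewrite le_max ge_min lexx.
have [c cI Fc] : exists2 c : R, c \in `[Num.min 0 t, Num.max 0 t] &
    F (Num.max 0 t) - F (Num.min 0 t) =
    partial i u (c *: ei + y) * (Num.max 0 t - Num.min 0 t).
  have dF' s : s \in `]Num.min 0 t, Num.max 0 t[ ->
      is_derive s (1 : R) F (partial i u (s *: ei + y)).
    by move=> st; apply: dF; apply: subset_itv_oo_cc st.
  have cF : {within `[Num.min 0 t, Num.max 0 t], continuous F}.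
    by apply: derivable_within_continuous => s /dF [].
  exact: (@MVT_segment R F _ _ _ mM dF' cF).
have E : F t - F 0 = partial i u (c *: ei + y) * t.
  case: (leP 0 t) Fc => [t0|t0] Fc; first by rewrite Fc subr0.
  by rewrite -opprB Fc; ring.
have -> : u (t *: ei + y) - u y - a * t = - ((a - partial i u (c *: ei + y)) * t).
  rewrite mulrBl -E /F scale0r add0r; ring.
by rewrite normrN normrM ler_wpM2r//; have [] := du _ (inB _ cI).
Qed.

(** Smoothness is given through iterated partial derivatives, while the chain rule for transition
    maps needs Frechet differentials. The increment is split along a path that moves one coordinate
    at a time, each leg costing at most a third of the error. *)
Lemma C1_differentiable U u x : open U -> C1_on U u -> U x ->
  differentiable u x.
Proof.
move=> oU cu Ux.
pose df h := \sum_(i < 3) h 0 i * partial i u x.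
have dflin : linear df.
  move=> k h1 h2; rewrite /df scaler_sumr -big_split/=; apply: eq_bigr => i _.
  by rewrite !mxE mulrDl; congr (_ + _); rewrite -mulrA.
pose dfM := GRing.isLinear.Build _ _ _ _ _ dflin.
pose dfL : {linear 'rV[R]_3 -> R} := HB.pack df dfM.
have cdf : continuous dfL.
  move=> h; apply: (@continuous_sumf _ _ _ _ (fun i h => h 0 i * partial i u x)) => i.
  apply: continuous_mulf; first exact: coord_continuous.
  exact: cst_continuous.
have E : u \o shift x = cst (u x) + dfL +o_ (0 : 'rV[R]_3) id.
  apply/eqaddoP => e e0.
  have e3 : 0 < e / 3 by lra.
  have Pi i : \forall z \near x, derivable u z (delta_mx 0 i) /\
      `|partial i u x - partial i u z| <= e / 3.
    apply: filterI.
      by apply: filterS (open_nbhs_nbhs (conj oU Ux)) => z /cu[_ /(_ i)[]].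
    by have /cvgrPdist_le := C1_partial_continuous (i := i) cu Ux; exact.
  have P := filter_forall (nbhs_filter x) Pi.
  have [d d0 dP] : exists2 d : R, 0 < d & forall z, `|x - z| < d -> forall i,
     derivable u z (delta_mx 0 i) /\ `|partial i u x - partial i u z| <= e / 3.
    have := iffLR (nbhs_normP _ _) P; rewrite /nbhs_ball_ => -[d /= d0 dP]; exists d => // z zd; exact: dP.
  have : \forall h \near (0 : 'rV[R]_3), `|h| < d by exact: nbhs0_lt.
  apply: filterS => h hd /=.
  pose y0 := x.
  pose y1 := h 0 0 *: delta_mx 0 0 + y0.
  pose y2 := h 0 1 *: delta_mx 0 1 + y1.
  pose y3 := h 0 2%:R *: delta_mx 0 2%:R + y2.
  have y3E : y3 = h + x.
    rewrite /y3 /y2 /y1 /y0; apply/rowP => j; rewrite !mxE !eqxx /=.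
    by case: j => -[|[|[|//]]] ?; rewrite ?mulr1 ?mulr0 ?addr0 ?add0r;
      congr (h 0 _ + x 0 _); exact: val_inj.
  (* The norm is the maximum of the coordinates, so every corner of the path, having each coordinate
     from x or from h + x, is within [d] of x. *)
  have Id (z : 'rV[R]_3) : (forall i, z 0 i = x 0 i \/ z 0 i = h 0 i + x 0 i) -> `|x - z| < d.
    move=> Hz; apply: coord_le_ball => // i.
    case: (Hz i) => ->; first by rewrite subrr normr0.
    rewrite opprD addrCA subrr addr0 normrN.
    exact: le_lt_trans (coord_le_norm _ _) hd.
  have b0 : `|x - y0| < d by apply: Id => i; left.
  have b1 : `|x - y1| < d.
    apply: Id => -[[|[|[|//]]] ?]; rewrite /y1 /y0 !mxE/= ?mulr1 ?mulr0 ?add0r; [right|left|left];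
      by [congr (h 0 _ + x 0 _); exact: val_inj|congr (x 0 _); exact: val_inj].
  have b2 : `|x - y2| < d.
    apply: Id => -[[|[|[|//]]] ?]; rewrite /y2 /y1 /y0 !mxE/= ?mulr1 ?mulr0 ?add0r; [right|right|left];
      by [congr (h 0 _ + x 0 _); exact: val_inj|congr (x 0 _); exact: val_inj].
  have b3 : `|x - y3| < d by apply: Id => i; right; rewrite y3E mxE.
  have I0 := increment_along_coordinate (fun z zd => dP z zd 0) b0 b1.
  have I1 := increment_along_coordinate (fun z zd => dP z zd 1) b1 b2.
  have I2 := increment_along_coordinate (fun z zd => dP z zd 2%:R) b2 b3.
  have cn i : e / 3 * `|h 0 i| <= e / 3 * `|h| by rewrite ler_pM2l ?coord_le_norm.
  rewrite [X in `|X|](_ : _ = (u y1 - u y0 - partial 0 u x * h 0 0) +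
    (u y2 - u y1 - partial 1 u x * h 0 1) + (u y3 - u y2 - partial 2%:R u x * h 0 2%:R)).
    apply: (le_trans (ler_normD _ _)).
    have -> : e * `|h| = (e / 3 * `|h| + e / 3 * `|h|) + e / 3 * `|h| by field.
    apply: lerD; last exact: le_trans I2 (cn _).
    by apply: (le_trans (ler_normD _ _)); apply: lerD;
      [exact: le_trans I0 (cn _)|exact: le_trans I1 (cn _)].
  rewrite -[LHS]/(u (h + x) - (u x + df h)) -y3E /y0 /df !big_ord_recr big_ord0/= add0r.
  rewrite (_ : widen_ord _ (widen_ord _ _) = 0); last exact: val_inj.
  rewrite (_ : widen_ord _ _ = 1); last exact: val_inj.
  rewrite (_ : ord_max = 2%:R); last exact: val_inj.
  move: (u x) (u y1) (u y2) (u y3) (h 0 0) (h 0 1) (h 0 2%:R).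
  by move: (partial 0 u x) (partial 1 u x) (partial 2%:R u x) => *; ring.
apply/diff_locallyP; rewrite (diff_unique cdf E); split => //.
Qed.

Lemma partial_comp U V (phi : 'rV[R]_3 -> 'rV[R]_3) u x i :
  open U -> open V -> U x -> V (phi x) ->
  (forall j, C1_on U (fun y => phi y 0 j)) -> C1_on V u ->
  partial i (fun y => u (phi y)) x =
  \sum_(j < 3) ('J phi x) i j * partial j u (phi x).
Proof.
move=> oU oV Ux Vphi cphi cu.
have dphi : differentiable phi x.
  (* Differentiability of a vector-valued map is reduced to that of its coordinates. *)
  have -> : phi = \sum_(j < 3) (fun y => phi y 0 j *: (delta_mx 0 j : 'rV[R]_3)).
    apply/funext => y; rewrite fct_sumE {1}[phi y]matrix_sum_delta big_ord1.
    by apply: eq_bigr => j _; rewrite ord1.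
  apply: differentiable_sum => j; apply: differentiableZl.
  exact: C1_differentiable (cphi j) Ux.
have du : differentiable u (phi x) by exact: C1_differentiable cu Vphi.
rewrite /partial deriveE; last exact: (@differentiable_comp _ _ _ _ phi u).
rewrite (@diff_comp _ _ _ _ phi u)// -[LHS]/('d u (phi x) ('d phi x (delta_mx 0 i))).
rewrite -(deriveE _ dphi) deriveEjacobian// -rowE.
rewrite [row i _]matrix_sum_delta big_ord1 linear_sum/=; apply: eq_bigr => j _.
by rewrite linearZ/= mxE -deriveE.
Qed.

End C1Differentiable.

(** * Metrics in coordinates *)

Section Algebra3.
Context {R : realType}.
Implicit Types (A B G H J : 'M[R]_3).

Lemma sum3E (F : 'I_3 -> R) : \sum_(i < 3) F i = F 0 + F 1 + F 2%:R.
Proof.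
rewrite !big_ord_recr big_ord0/= add0r.
by congr (F _ + F _ + F _); exact: val_inj.
Qed.

Lemma ord3P (P : 'I_3 -> Prop) : P 0 -> P 1 -> P 2%:R -> forall i, P i.
Proof.
move=> P0 P1 P2; case=> -[|[|[|//]]] lt3.
- by rewrite (_ : Ordinal _ = 0)//; exact: val_inj.
- by rewrite (_ : Ordinal _ = 1)//; exact: val_inj.
- by rewrite (_ : Ordinal _ = 2%:R)//; exact: val_inj.
Qed.

(** Indices are added modulo 3; the cyclic order absorbs the sign (-1)^(i+j). *)
Definition cofactor3 A (i j : 'I_3) : R :=
  A (i + 1) (j + 1) * A (i + 2%:R) (j + 2%:R) - A (i + 1) (j + 2%:R) * A (i + 2%:R) (j + 1).

Let add11 : 1 + 1 = 2%:R :> 'I_3. Proof. exact: val_inj. Qed.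
Let add12 : 1 + 2%:R = 0 :> 'I_3. Proof. exact: val_inj. Qed.
Let add21 : 2%:R + 1 = 0 :> 'I_3. Proof. exact: val_inj. Qed.
Let add22 : 2%:R + 2%:R = 1 :> 'I_3. Proof. exact: val_inj. Qed.
Let add_ord3E := (add12, add21, add22, add11, @add0r 'I_3).

Lemma det3E A : \det A =
  A 0 0 * (A 1 1 * A 2%:R 2%:R - A 1 2%:R * A 2%:R 1)
  - A 0 1 * (A 1 0 * A 2%:R 2%:R - A 1 2%:R * A 2%:R 0)
  + A 0 2%:R * (A 1 0 * A 2%:R 1 - A 1 1 * A 2%:R 0).
Proof.
rewrite (expand_det_row _ 0) sum3E /cofactor.
rewrite !(expand_det_row _ ord0) !big_ord_recr !big_ord0 /= !add0r /cofactor !det_mx11 !mxE /=.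
rewrite !expr0 !expr1.
pose a (m n : nat) := A (inord m) (inord n).
have aE i j : A i j = a i j by rewrite /a !inord_val.
rewrite !aE /= /bump /= !modn_small//= !addn0 !add0n ?addn1 ?sqrrN ?expr1n ?expr1.
by ring.
Qed.

Lemma mul_cofactor3 A : A *m (\matrix_(i, j) cofactor3 A j i) = (\det A)%:M.
Proof.
apply/matrixP; apply: ord3P; apply: ord3P;
  by rewrite !mxE sum3E !mxE det3E /cofactor3 !add_ord3E /= ?mulr1n ?mulr0n; ring.
Qed.

Lemma invmx3E A i j : \det A != 0 -> invmx A i j = (\det A)^-1 * cofactor3 A j i.
Proof.
move=> dA; have uA : A \in unitmx by rewrite unitmxE unitfE.
have E : A *m ((\det A)^-1 *: \matrix_(i, j) cofactor3 A j i) = 1%:M.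
  by rewrite -scalemxAr mul_cofactor3 scale_scalar_mx mulVf.
have -> : invmx A = (\det A)^-1 *: \matrix_(i, j) cofactor3 A j i.
  by rewrite -[LHS]mulmx1 -E mulKmx.
by rewrite !mxE.
Qed.

Lemma invmx_tr_sym A : A^T = A -> (invmx A)^T = invmx A.
Proof. by move=> sA; rewrite trmx_inv sA. Qed.

Definition qform A (v : 'rV[R]_3) : R := (v *m A *m v^T) 0 0.

Lemma qformE A (x y z : R) : qform A (\row_(i < 3) [:: x; y; z]`_i) =
  x * x * A 0 0 + x * y * (A 0 1 + A 1 0) + x * z * (A 0 2%:R + A 2%:R 0)
  + y * y * A 1 1 + y * z * (A 1 2%:R + A 2%:R 1) + z * z * A 2%:R 2%:R.
Proof. by rewrite /qform !mxE !sum3E !mxE !sum3E !mxE /=; ring. Qed.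

(** One direction of Sylvester's criterion with explicit vectors. Each test vector consists of the
    cofactors of the last row of a leading block, so that the form takes there the product of two
    consecutive leading minors. *)
Lemma posdef_det_gt0 A : A^T = A -> (forall v, v != 0 -> 0 < qform A v) ->
  0 < \det A.
Proof.
move=> sA pA.
have s i j : A i j = A j i by rewrite -{1}sA mxE.
have rn0 (x y z : R) : (x != 0) || (y != 0) || (z != 0) ->
    \row_(i < 3) [:: x; y; z]`_i != 0.
  apply: contraTneq => /rowP E.
  by have := (E 0, E 1, E 2%:R); rewrite !mxE /= => -[[-> ->] ->]; rewrite eqxx.
have a0 : 0 < A 0 0.
  by have := pA _ (rn0 1 0 0 _); rewrite qformE oner_eq0 => /(_ isT); lra.
have m0 : 0 < A 0 0 * A 1 1 - A 0 1 * A 0 1.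
  have := pA _ (rn0 (- A 0 1) (A 0 0) 0 _); rewrite qformE (gt_eqF a0) orbT.
  rewrite (s 1 0) => /(_ isT).
  rewrite (_ : _ + _ = A 0 0 * (A 0 0 * A 1 1 - A 0 1 * A 0 1)); last by ring.
  by rewrite pmulr_rgt0.
have := pA _ (rn0 (A 0 1 * A 1 2%:R - A 0 2%:R * A 1 1) (A 0 1 * A 0 2%:R - A 0 0 * A 1 2%:R)
  (A 0 0 * A 1 1 - A 0 1 * A 0 1) _).
rewrite qformE (gt_eqF m0) orbT => /(_ isT).
rewrite (_ : _ + _ = (A 0 0 * A 1 1 - A 0 1 * A 0 1) * \det A); last first.
  by rewrite det3E (s 1 0) (s 2%:R 0) (s 2%:R 1); ring.
by rewrite pmulr_rgt0.
Qed.

Lemma sum_mulmx_tr A B : \sum_(i < 3) \sum_(j < 3) A i j * B i j = \tr (A *m B^T).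
Proof.
by rewrite /mxtrace; apply: eq_bigr => i _; rewrite mxE; apply: eq_bigr => j _; rewrite mxE.
Qed.

(** Contraction with the inverse metric is a trace, and J cancels by cyclicity; J is invertible
    because G is. This is the reason why the gradient product and the scalar curvature do not depend
    on the chart. *)
Lemma trace_invmx_congr G G' H H' J : G \in unitmx ->
  G = J *m G' *m J^T -> H = J *m H' *m J^T ->
  \sum_(i < 3) \sum_(j < 3) invmx G i j * H i j =
  \sum_(i < 3) \sum_(j < 3) invmx G' i j * H' i j.
Proof.
move=> uG GE HE; rewrite !sum_mulmx_tr.
have := uG; rewrite {1}GE !unitmx_mul unitmx_tr => /andP[/andP[uJ uG'] _].
have -> : invmx G = invmx (J^T) *m invmx G' *m invmx J.
  have uJT : J^T \in unitmx by rewrite unitmx_tr.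
  have E : (invmx J^T *m invmx G' *m invmx J) *m G = 1%:M.
    by rewrite GE !mulmxA mulmxKV// -(mulmxA _ (invmx G')) mulVmx// mulmx1 mulVmx.
  by rewrite -[LHS]mul1mx -E mulmxK.
rewrite HE !trmx_mul trmxK !mulmxA mulmxKV// mxtrace_mulC !mulmxA mulmxV ?unitmx_tr//.
by rewrite mul1mx.
Qed.

End Algebra3.

(** * Derivatives of the volume density and of the inverse metric *)

Section MetricCalculus.
Context {R : realType}.
Implicit Types (U : set 'rV[R]_3) (u v : 'rV[R]_3 -> R) (x y : 'rV[R]_3).

Lemma derives_in_det (I : set R) (G : R -> 'M[R]_3) (H : 'M[R]_3) t :
  (forall i j, derives_in I (fun s => G s i j) t (H i j)) ->
  derives_in I (fun s => \det (G s)) t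
    (\sum_(i < 3) \sum_(j < 3) cofactor3 (G t) i j * H i j).
Proof.
move=> dG.
pose K := fun a b c d e f => derives_inM (dG a b) (derives_inD (derives_inM (dG c d) (dG e f))
  (derives_inM (derives_inM (derives_in_cst I (-1) t) (dG c f)) (dG e d))).
have := derives_inD (derives_inD (K 0 0 1 1 2%:R 2%:R) (derives_inM (derives_in_cst I (-1) t) (K 0 1 1 0 2%:R 2%:R)))
   (K 0 2%:R 1 0 2%:R 1).
rewrite (_ : (fun _ => _) = (fun s => \det (G s))); last first.
  by apply/funext => s; rewrite det3E; ring.
rewrite [X in derives_in _ _ _ X -> _](_ : _ =
  \sum_(i < 3) \sum_(j < 3) cofactor3 (G t) i j * H i j)//.
rewrite !sum3E /cofactor3.
rewrite (_ : 1 + 1 = 2%:R :> 'I_3); last exact: val_inj.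
rewrite (_ : 1 + 2%:R = 0 :> 'I_3); last exact: val_inj.
rewrite (_ : 2%:R + 1 = 0 :> 'I_3); last exact: val_inj.
rewrite (_ : 2%:R + 2%:R = 1 :> 'I_3); last exact: val_inj.
by rewrite !add0r; ring.
Qed.

(** Jacobi's formula. Being stated for [derives_in], it serves for the evolution of the volume
    element in time and, with [setT] as the interval along a coordinate line, for space
    derivatives. *)
Lemma derives_in_sqrt_det (I : set R) (G : R -> 'M[R]_3) (H : 'M[R]_3) t :
  (G t)^T = G t -> 0 < \det (G t) ->
  (forall i j, derives_in I (fun s => G s i j) t (H i j)) ->
  derives_in I (fun s => Num.sqrt (\det (G s))) t
    (Num.sqrt (\det (G t)) * (2^-1 * \sum_(i < 3) \sum_(j < 3) invmx (G t) i j * H i j)).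
Proof.
move=> sG dG_gt0 /derives_in_det dG.
have := derives_in_comp dG (is_derive1_sqrt dG_gt0).
have -> : \sum_(i < 3) \sum_(j < 3) cofactor3 (G t) i j * H i j =
    \det (G t) * \sum_(i < 3) \sum_(j < 3) invmx (G t) i j * H i j.
  rewrite mulr_sumr; apply: eq_bigr => i _; rewrite mulr_sumr; apply: eq_bigr => j _.
  have -> : invmx (G t) i j = invmx (G t) j i by rewrite -{1}(invmx_tr_sym sG) mxE.
  by rewrite invmx3E ?gt_eqF// mulrA mulrA mulfV ?gt_eqF// mul1r.
move: (\sum_(i < 3) _) => S.
have q0 : 0 < Num.sqrt (\det (G t)) by rewrite sqrtr_gt0.
rewrite [X in derives_in _ _ _ X -> _](_ : _ = Num.sqrt (\det (G t)) * (2^-1 * S))//.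
rewrite -{2}(sqr_sqrtr (ltW dG_gt0)).
by field; rewrite gt_eqF.
Qed.

Lemma derives_in_setTP (h : R -> R) t (l : R) :
  derives_in setT h t l <-> is_derive t (1 : R) h l.
Proof.
split=> [dh|dh].
  apply: (@derives_in_is_derive _ (t - 1) (t + 1)).
    by rewrite in_itv/= gtrBl ltrDl ltr01.
  exact: derives_in_sub dh.
have di : derives_in setT (fun s : R => s) t 1.
  apply/derives_inP; exists (fun=> 1); split=> //; last exact: cvg_cst.
  by move=> s _; rewrite mul1r.
by have := derives_in_comp di dh; rewrite mulr1.
Qed.

Lemma C1_opp U u : open U -> C1_on U u -> C1_on U (fun y => - u y).
Proof.
move=> oU cu; have [+ _] := C1M oU (C1_cst (-1) oU).1 cu.
by rewrite (_ : (fun y => -1 * u y) = (fun y => - u y))//; apply/funext => y; rewrite mulN1r.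
Qed.

Lemma C1_add U u v : open U -> C1_on U u -> C1_on U v -> C1_on U (fun y => u y + v y).
Proof. by move=> oU cu cv; have [] := C1D oU cu cv. Qed.

Lemma C1_mul U u v : open U -> C1_on U u -> C1_on U v -> C1_on U (fun y => u y * v y).
Proof. by move=> oU cu cv; have [] := C1M oU cu cv. Qed.

Lemma C1_inv U u : open U -> C1_on U u -> (forall x, U x -> u x != 0) ->
  C1_on U (fun y => (u y)^-1).
Proof.
move=> oU cu u0.
have [||c _] := @C1_comp _ U (fun r => r^-1) (fun r => - r ^- 2) u oU cu; last exact: c.
- move=> x Ux; have := is_derive_id (u x) (1 : R) => di.
  have := @is_deriveV _ id (u x) 1 1 (u0 _ Ux) di.
  by rewrite [_ *: _]mulr1.
- move=> x Ux.
  have c1 : {for u x, continuous (fun r : R => r ^+ 2)} by exact: exprn_continuous.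
  have c2 : {for u x, continuous (fun r : R => r ^- 2)}.
    apply: (continuous_compf (phi := fun r => r^-1) c1).
    by apply: inv_continuous; rewrite expf_neq0// u0.
  by apply: (continuous_compf (phi := -%R) c2); exact: opp_continuous.
Qed.

Variables (U : set 'rV[R]_3) (G : 'rV[R]_3 -> 'M[R]_3).
Hypotheses (oU : open U) (cG : forall i j, C1_on U (fun y => G y i j))
  (sG : forall x, U x -> (G x)^T = G x) (pG : forall x, U x -> 0 < \det (G x)).

Lemma C1_cofactor3 i j : C1_on U (fun y => cofactor3 (G y) i j).
Proof.
by apply: (C1_add oU); last apply: (C1_opp oU); apply: (C1_mul oU); exact: cG.
Qed.

Lemma C1_det : C1_on U (fun y => \det (G y)).
Proof.
under eq_fun do rewrite det3E.
have K a b c d e f : C1_on U (fun y => G y a b * (G y c d * G y e f - G y c f * G y e d)).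
  apply: (C1_mul oU (cG _ _)); apply: (C1_add oU); first exact: (C1_mul oU).
  by apply: (C1_opp oU); exact: (C1_mul oU).
apply: (C1_add oU); last exact: K.
by apply: (C1_add oU); [exact: K|apply: (C1_opp oU); exact: K].
Qed.

Lemma C1_invmx i j : C1_on U (fun y => invmx (G y) i j).
Proof.
have [||+ _] := @C1_near_eq _ U (fun y => (\det (G y))^-1 * cofactor3 (G y) j i)
    (fun y => invmx (G y) i j) oU; last exact.
- by move=> x Ux; rewrite invmx3E// gt_eqF// pG.
- apply: (C1_mul oU); last exact: C1_cofactor3.
  by apply: (C1_inv oU); [exact: C1_det|move=> x Ux; rewrite gt_eqF// pG].
Qed.

Lemma derives_in_line u x k : C1_on U u -> U x ->
  derives_in setT (fun h : R => u (h *: delta_mx 0 k + x)) 0 (partial k u x).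
Proof.
move=> cu Ux; apply/derives_in_setTP.
exact: (iffLR (is_derive_lineP u x _ _)) (C1_is_derive k cu Ux).
Qed.

Lemma sqrt_det_C1 : C1_on U (fun y => Num.sqrt (\det (G y))) /\
  forall x k, U x -> partial k (fun y => Num.sqrt (\det (G y))) x =
   Num.sqrt (\det (G x)) *
    (2^-1 * \sum_(i < 3) \sum_(j < 3) invmx (G x) i j * partial k (fun y => G y i j) x).
Proof.
have [c _] : C1_on U (fun y => Num.sqrt (\det (G y))) /\ forall x i, U x ->
    partial i (fun y => Num.sqrt (\det (G y))) x =
    (2 * Num.sqrt (\det (G x)))^-1 * partial i (fun y => \det (G y)) x.
  apply: (@C1_comp _ U Num.sqrt (fun r => (2 * Num.sqrt r)^-1)) => //; first exact: C1_det.
    by move=> x Ux; apply: is_derive1_sqrt; exact: pG.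
  move=> x Ux; have c1 : {for \det (G x), continuous (fun r : R => 2 * Num.sqrt r)}.
    apply: continuous_mulf; first exact: cst_continuous.
    exact: sqrt_continuous.
  apply: (continuous_compf (phi := fun r => r^-1) c1).
  by apply: inv_continuous; rewrite mulf_neq0// gt_eqF// sqrtr_gt0 pG.
split=> // x k Ux.
(* The metric along the coordinate line through x turns a partial derivative into a derivative in
   one variable, to which the formula for families in time applies. *)
pose L (h : R) := G (h *: delta_mx 0 k + x).
have L0 : L 0 = G x by rewrite /L scale0r add0r.
have := @derives_in_sqrt_det setT L (\matrix_(i, j) partial k (fun y => G y i j) x) 0.
rewrite L0 => /(_ (sG Ux) (pG Ux)).
have H i j : derives_in setT (fun s => L s i j) 0 ((\matrix_(i, j) partial k (fun y => G y i j) x) i j).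
  by rewrite mxE; exact: (derives_in_line (cG i j) Ux).
move=> /(_ H) /derives_in_setTP.
move=> /(iffRL (is_derive_lineP (fun y => Num.sqrt (\det (G y))) x _ _))[_ E].
rewrite /partial E; congr (_ * (_ * _)).
by apply: eq_bigr => i _; apply: eq_bigr => j _; rewrite mxE.
Qed.

(** Obtained by differentiating G G^(-1) = 1 entrywise and solving for the derivative of G^(-1). *)
Lemma partial_invmx x k i j : U x ->
  partial k (fun y => invmx (G y) i j) x =
  - \sum_(a < 3) \sum_(b < 3) invmx (G x) i a * partial k (fun y => G y a b) x * invmx (G x) b j.
Proof.
move=> Ux.
pose P := \matrix_(a, b) partial k (fun y => G y a b) x.
pose Q := \matrix_(a, b) partial k (fun y => invmx (G y) a b) x.
have uG y : U y -> G y \in unitmx by move=> Uy; rewrite unitmxE unitfE gt_eqF// pG.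
have E : P *m invmx (G x) + G x *m Q = 0.
  apply/matrixP => a b.
  have cc c : C1_on U (fun y => G y a c * invmx (G y) c b).
    by apply: (C1_mul oU (cG _ _)); exact: C1_invmx.
  have [_ pc] := C1_sum (index_enum 'I_3) oU cc.
  have [_ pid] := @C1_near_eq _ U (fun=> (1%:M : 'M[R]_3) a b)
    (fun y => \sum_c G y a c * invmx (G y) c b) oU
    (fun y Uy => ltac:(by rewrite -(mulmxV (uG y Uy)) mxE)) (C1_cst _ oU).1.
  have [_ p0] := C1_cst ((1%:M : 'M[R]_3) a b) oU.
  have := pc x k Ux; rewrite pid// p0// !mxE => S0; rewrite [RHS]S0.
  rewrite -big_split/=; apply: eq_bigr => c _.
  have [_ ->//] := C1M oU (cG a c) (C1_invmx c b).
  by rewrite !mxE addrC [X in _ + X]mulrC.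
have QE : Q = - (invmx (G x) *m P *m invmx (G x)).
  apply/eqP; rewrite -addr_eq0; apply/eqP.
  rewrite -mulmxA -{1}(mulKmx (uG x Ux) Q) -mulmxDr addrC E.
  exact: mulmx0.
have := QE => /matrixP/(_ i j); rewrite !mxE => ->; congr (- _).
under eq_bigr do rewrite !mxE big_distrl/=.
rewrite exchange_big/=; apply: eq_bigr => a _; apply: eq_bigr => b _.
by rewrite mxE.
Qed.

End MetricCalculus.

(** * The divergence of a weighted gradient in coordinates *)

Section Divergence.
Context {R : realType}.
Implicit Types (U : set 'rV[R]_3) (u v : 'rV[R]_3 -> R) (x y : 'rV[R]_3).

(** The polarization of [grad_sq]: [grad_dot G u u] is convertible to [grad_sq G u], so results on
    [grad_dot] apply to it directly. *)
Definition grad_dot (G : 'rV[R]_3 -> 'M[R]_3) u v x : R :=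
  \sum_(i < 3) \sum_(j < 3) invmx (G x) i j * partial i u x * partial j v x.

(* With h the inverse metric and P i a b = d_i g_ab, this is
   (det g)^(-1/2) d_i ((det g)^(1/2) h^ik) = - h^ij Gamma^k_ij. *)
Lemma contracted_christoffelE (h : 'I_3 -> 'I_3 -> R) (P : 'I_3 -> 'I_3 -> 'I_3 -> R) k :
  (forall i j, h i j = h j i) ->
  \sum_(i < 3) (2^-1 * \sum_(a < 3) \sum_(b < 3) h a b * P i a b) * h i k
  - \sum_(i < 3) \sum_(a < 3) \sum_(b < 3) h i a * P i a b * h b k =
  - \sum_(i < 3) \sum_(j < 3) h i j *
      (2^-1 * \sum_(l < 3) h k l * (P i j l + P j i l - P l i j)).
Proof.
move=> hs; rewrite !sum3E.
rewrite (hs k 0) (hs k 1) (hs k 2%:R) (hs 1 0) (hs 2%:R 0) (hs 2%:R 1).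
move: (h 0 k) (h 1 k) (h 2%:R k) (h 0 0) (h 0 1) (h 0 2%:R) (h 1 1) (h 1 2%:R) (h 2%:R 2%:R).
move=> *; by field.
Qed.

(** The computation with all derivatives replaced by free symbols: [h] is the inverse metric,
    [D i k] is - d_i h^ik, [t i] is the logarithmic derivative of the volume density [s], [f1] and
    [f2] are the derivatives of f, and [p], [p1] are psi and its derivatives. The two sides differ
    by s p times the contraction of the assumed Christoffel relation with [f1]. *)
Let divergence_identity (h D f2 : 'I_3 -> 'I_3 -> R) (t f1 p1 : 'I_3 -> R)
    (Gam : 'I_3 -> 'I_3 -> 'I_3 -> R) (p s : R) :
  (forall k, \sum_(i < 3) t i * h i k - \sum_(i < 3) D i k =
   - \sum_(i < 3) \sum_(j < 3) h i j * Gam k i j) ->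
  \sum_(i < 3) (p * s * (\sum_(j < 3) (h i j * f2 i j - f1 j * D i j))
    + (\sum_(j < 3) h i j * f1 j) * (p * (s * t i) + s * p1 i)) =
  s * (\sum_(i < 3) \sum_(j < 3) h i j * p1 i * f1 j +
  p * (\sum_(i < 3) \sum_(j < 3) h i j * (f2 i j - \sum_(k < 3) Gam k i j * f1 k))).
Proof.
move=> E.
have Z : \sum_(k < 3) f1 k * (\sum_(i < 3) t i * h i k - \sum_(i < 3) D i k
   + \sum_(i < 3) \sum_(j < 3) h i j * Gam k i j) = 0.
  by apply: big1 => k _; rewrite E addNr mulr0.
apply/subr0_eq; rewrite -[RHS](mulr0 (s * p)) -[X in _ = _ * X]Z.
by rewrite !sum3E; ring.
Qed.

Variables (U : set 'rV[R]_3) (G : 'rV[R]_3 -> 'M[R]_3).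
Hypotheses (oU : open U) (cG : forall i j, C1_on U (fun y => G y i j))
  (sG : forall x, U x -> (G x)^T = G x) (pG : forall x, U x -> 0 < \det (G x)).
Variables (f psi : 'rV[R]_3 -> R).
Hypotheses (cf : forall j, C1_on U (partial j f)) (cpsi : C1_on U psi).

(* The flux whose coordinate divergence is sqrt (det G) div (psi grad f). *)
Definition weighted_flux i y : R :=
  psi y * Num.sqrt (\det (G y)) * \sum_(j < 3) invmx (G y) i j * partial j f y.

Lemma C1_weighted_flux i : C1_on U (weighted_flux i).
Proof.
have [cs _] := sqrt_det_C1 oU cG sG pG.
have cij j : C1_on U (fun y => invmx (G y) i j * partial j f y).
  by apply: (C1_mul oU); [exact: (C1_invmx oU cG pG)|exact: cf].
have [c _] := C1_sum (index_enum 'I_3) oU cij.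
exact: (C1_mul oU (C1_mul oU cpsi cs) c).
Qed.

Lemma divergence_weighted_flux x : U x ->
  \sum_(i < 3) partial i (weighted_flux i) x =
  Num.sqrt (\det (G x)) * (grad_dot G psi f x + psi x * laplacian G f x).
Proof.
move=> Ux.
have [cs ps] := sqrt_det_C1 oU cG sG pG.
have ci i j : C1_on U (fun y => invmx (G y) i j) by exact: (C1_invmx oU cG pG).
have cij i j : C1_on U (fun y => invmx (G y) i j * partial j f y).
  exact: (C1_mul oU (ci i j) (cf j)).
have cps := C1_mul oU cpsi cs.
pose h i j := invmx (G x) i j.
pose P i a b := partial i (fun y => G y a b) x.
pose D i k := \sum_(a < 3) \sum_(b < 3) h i a * P i a b * h b k.
pose t i := 2^-1 * \sum_(a < 3) \sum_(b < 3) h a b * P i a b.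
pose s := Num.sqrt (\det (G x)).
have pF i : partial i (weighted_flux i) x =
    psi x * s * (\sum_(j < 3) (h i j * partial i (partial j f) x - partial j f x * D i j))
    + (\sum_(j < 3) h i j * partial j f x) * (psi x * (s * t i) + s * partial i psi x).
  have [cS pS] := C1_sum (index_enum 'I_3) oU (cij i).
  have [_ ->//] := C1M oU cps cS.
  rewrite pS//; have [_ ->//] := C1M oU cpsi cs; rewrite ps//.
  congr (_ * _ + _); apply: eq_bigr => j _.
  have [_ ->//] := C1M oU (ci i j) (cf j).
  by rewrite (partial_invmx oU)// mulrN.
under eq_bigr do rewrite pF.
have hs i j : h i j = h j i by rewrite /h -{1}(invmx_tr_sym (sG Ux)) mxE.
have E k := contracted_christoffelE P k hs.
have {}E k : \sum_(i < 3) t i * h i k - \sum_(i < 3) D i k =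
   - \sum_(i < 3) \sum_(j < 3) h i j * christoffel G k i j x by exact: E.
exact: (@divergence_identity h D (fun i j => partial i (partial j f) x) t
  (fun j => partial j f x) (fun i => partial i psi x) (fun k i j => christoffel G k i j x)).
Qed.

End Divergence.

(** * Integration over cubes *)

Section Cubes.
Context {R : realType}.
Implicit Types (U : set 'rV[R]_3) (u v : 'rV[R]_3 -> R) (x y c : 'rV[R]_3).

Local Notation bR := (g_sigma_algebraType R.-ocitv.-measurable).

(** A closed ball of the sup norm, described by coordinates so that its preimage under [vec3] is a
    product of intervals, as Fubini needs. *)
Definition cube c (r : R) : set 'rV[R]_3 := [set x | forall i, `|x 0 i - c 0 i| <= r].

Lemma vec3E (z : R * R * R) : (vec3 z 0 0 = z.1.1) * (vec3 z 0 1 = z.1.2) *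
  (vec3 z 0 2%:R = z.2).
Proof. by rewrite !mxE. Qed.

Lemma preimage_vec3_box (P : 'I_3 -> set R) :
  vec3 @^-1` [set x | forall i, P i (x 0 i)] = (P 0 `*` P 1) `*` P 2%:R.
Proof.
apply/seteqP; split=> [z /= h|z /= [[h0 h1] h2]].
  by have := (h 0, h 1, h 2%:R); rewrite !vec3E => -[[]].
by apply: ord3P; rewrite !vec3E.
Qed.

Lemma normr_le_itv (a b r : R) : (`|a - b| <= r) = (a \in `[b - r, b + r]).
Proof. by rewrite ler_norml in_itv/=; apply/idP/idP; lra. Qed.

Lemma preimage_vec3_cube c r : vec3 @^-1` (cube c r) =
  (`[c 0 0 - r, c 0 0 + r] `*` `[c 0 1 - r, c 0 1 + r]) `*` `[c 0 2%:R - r, c 0 2%:R + r].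
Proof.
rewrite -(preimage_vec3_box (fun i => `[c 0 i - r, c 0 i + r]%classic)).
by apply/seteqP; split=> z h i; have := h i; rewrite /= normr_le_itv.
Qed.

Lemma measurable_cube c r : measurable (vec3 @^-1` (cube c r) : set (bR * bR * bR)).
Proof.
rewrite preimage_vec3_cube; apply: measurableX; last exact: measurable_itv.
by apply: measurableX; exact: measurable_itv.
Qed.

Lemma compact_cube c r : compact (cube c r).
Proof.
have := @rV_compact R 3 (fun i => `[c 0 i - r, c 0 i + r]%classic)
  (fun i => @segment_compact _ _ _).
by congr (compact _); apply/seteqP; split=> z h i; have := h i; rewrite /= normr_le_itv.
Qed.

Lemma cube_ball c r x : cube c r x -> forall e, r < e -> `|c - x| < e.
Proof.
move=> cx e re; apply: le_lt_trans re; apply: norm_le_coord.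
  by apply: le_trans (cx 0).
by move=> i; rewrite !mxE distrC.
Qed.

Lemma open_cube U x : open U -> U x -> exists2 r : R, 0 < r & cube x r `<=` U.
Proof.
move=> oU Ux; have : nbhs x U by exact: open_nbhs_nbhs.
move=> /nbhs_normP[d /= d0 dU]; exists (d / 2); first by rewrite divr_gt0.
by move=> y /cube_ball h; apply: dU => /=; apply: h; rewrite ltr_pdivrMr// mulr_natr mulr2n ltrDl.
Qed.

(** Links the topology of row vectors with the product sigma-algebra of R * R * R: an open set is a
    countable union of boxes with rational data. *)
Lemma open_measurable_vec3 U : open U -> measurable (vec3 @^-1` U : set (bR * bR * bR)).
Proof.
move=> oU.
pose B (q : rat * rat * rat * rat) : set 'rV[R]_3 :=
  [set x | forall i : 'I_3, `](ratr [:: q.1.1.1; q.1.1.2; q.1.2]`_i - ratr q.2 : R),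
     (ratr [:: q.1.1.1; q.1.1.2; q.1.2]`_i + ratr q.2 : R)[%classic (x 0 i)].
have -> : U = \bigcup_q (if `[< B q `<=` U >] then B q else set0).
  apply/seteqP; split=> [x Ux|x [q _]]; last by case: asboolP => // h /h.
  have [r r0 rU] := open_cube oU Ux.
  (* The centre is chosen within e of x and the box has half-width e, so its points are within 2 e <
     r of x in each coordinate. *)
  have [e] := @rat_in_itvoo R 0 (r / 2) ltac:(by rewrite divr_gt0).
  rewrite in_itv/= => /andP[e0 er].
  have Q i : exists q : rat, ratr q \in `](x 0 i - ratr e : R), (x 0 i + ratr e)[.
    by apply: rat_in_itvoo; lra.
  have [[[q0 h0] [q1 h1]] [q2 h2]] := (Q 0, Q 1, Q 2%:R).
  have Bx : B (q0, q1, q2, e) x.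
    by apply: ord3P; rewrite /= in_itv/=; move: h0 h1 h2; rewrite !in_itv/=; lra.
  suff BU : B (q0, q1, q2, e) `<=` U.
    by apply: (@bigcup_sup _ _ (q0, q1, q2, e)) => //=; case: asboolP.
  move=> y By; apply: rU; apply: ord3P.
  - have := By 0; move: h0; rewrite /= !in_itv/= ler_norml; lra.
  - have := By 1; move: h1; rewrite /= !in_itv/= ler_norml; lra.
  - have := By 2%:R; move: h2; rewrite /= !in_itv/= ler_norml; lra.
rewrite preimage_bigcup; apply: countable_bigcupT_measurable.
  exact: countableP.
move=> q; case: asboolP => _; last by rewrite preimage_set0.
rewrite /B (preimage_vec3_box (fun i : 'I_3 => `](ratr [:: q.1.1.1; q.1.1.2; q.1.2]`_i - ratr q.2 : R),
     (ratr [:: q.1.1.1; q.1.1.2; q.1.2]`_i + ratr q.2 : R)[%classic)).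
apply: measurableX; last exact: measurable_itv.
by apply: measurableX; exact: measurable_itv.
Qed.

Lemma open_preimage_vec3 (T : topologicalType) U (h : 'rV[R]_3 -> T) (O : set T) :
  open U -> (forall x, U x -> {for x, continuous h}) -> open O ->
  measurable (vec3 @^-1` U `&` (h \o vec3) @^-1` O : set (bR * bR * bR)).
Proof.
move=> oU ch oO; rewrite -[X in measurable X]/(vec3 @^-1` (U `&` h @^-1` O)).
apply: open_measurable_vec3; rewrite openE => x [Ux Ohx].
apply: filterI; first exact: open_nbhs_nbhs.
by apply: (ch x Ux); exact: open_nbhs_nbhs.
Qed.

Lemma measurable_continuous_vec3 U u : open U -> (forall x, U x -> {for x, continuous u}) ->
  measurable_fun (vec3 @^-1` U : set (bR * bR * bR)) (u \o vec3).
Proof.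
move=> oU cu; apply: (measurability _ (measurable_realfun.RGenOpens.measurableE R)).
by move=> _ [_ [a [b ->] <-]]; apply: open_preimage_vec3 => //; exact: interval_open.
Qed.

Lemma measurable_continuous_vec3_borel (M : ptopologicalType) U (h : 'rV[R]_3 -> M) :
  open U -> (forall x, U x -> {for x, continuous h}) ->
  measurable_fun (vec3 @^-1` U : set (bR * bR * bR)) (h \o vec3 : bR * bR * bR -> borel M).
Proof.
move=> oU cu; apply: (@measurability _ _ _ (borel M) _ _ (@open M) erefl).
by move=> _ [V oV <-]; exact: open_preimage_vec3.
Qed.

Lemma bounded_on_cube U u c r : open U -> (forall x, U x -> {for x, continuous u}) ->
  cube c r `<=` U -> exists2 C : R, 0 < C & forall x, cube c r x -> `|u x| <= C.
Proof.
move=> oU cu cU.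
have cc : {within cube c r, continuous u}.
  apply: continuous_in_subspaceT => x; rewrite inE => cx; exact/cu/cU.
have /compact_bounded [C [_ HC]] := continuous_compact cc (@compact_cube c r).
exists (`|C| + 1); first by rewrite ltr_wpDl.
move=> x cx; apply: (HC (`|C| + 1)); last by exists x.
by rewrite (le_lt_trans (ler_norm _))// ltrDl.
Qed.

Local Notation lebesgue3 := ((@lebesgue_measure R \x @lebesgue_measure R) \x @lebesgue_measure R)%E.

Lemma lebesgue3_cube_lty c r : (lebesgue3 (vec3 @^-1` (cube c r)) < +oo)%E.
Proof.
have L (a b : R) : (lebesgue_measure (`[a, b]%classic : set R) < +oo)%E.
  by rewrite lebesgue_measure_itv/=; case: ifP => // _; rewrite -EFinB ltry.
rewrite preimage_vec3_cube product_measure1E; last 2 first.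
- by apply: measurableX; exact: measurable_itv.
- exact: measurable_itv.
rewrite [X in (X * _)%E]product_measure1E; [|exact: measurable_itv|exact: measurable_itv].
have F (a b : R) : lebesgue_measure (`[a, b]%classic : set R) \is a fin_num.
  by rewrite ge0_fin_numE.
by rewrite -ge0_fin_numE; [rewrite ?fin_numM ?F|rewrite ?mule_ge0 ?measure_ge0].
Qed.

Lemma integrable_cube U u c r : open U -> (forall x, U x -> {for x, continuous u}) ->
  cube c r `<=` U -> lebesgue3.-integrable (vec3 @^-1` (cube c r)) (EFin \o (u \o vec3)).
Proof.
move=> oU cu cU; apply: measurable_bounded_integrable.
- exact: measurable_cube.
- exact: lebesgue3_cube_lty.
- apply: measurable_funS (measurable_continuous_vec3 oU cu); first exact: open_measurable_vec3.
  by move=> z; exact: cU.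
- have [C C0 HC] := bounded_on_cube oU cu cU.
  exists C; split; first exact: gtr0_real.
  by move=> D CD z cz; apply: (le_trans (HC _ cz)); exact: ltW.
Qed.

End Cubes.

(** * The integral of a partial derivative over a cube *)

Section CubeDivergence.
Context {R : realType}.
Implicit Types (U : set 'rV[R]_3) (u v : 'rV[R]_3 -> R) (x y c : 'rV[R]_3).

Lemma integral_derivative_along_line U u (k : 'I_3) y (a b : R) :
  a < b -> C1_on U u -> (forall t, a <= t <= b -> U (t *: delta_mx 0 k + y)) ->
  (\int[lebesgue_measure]_(t in `[a, b]) (partial k u (t *: delta_mx 0 k + y))%:E =
   (u (b *: delta_mx 0 k + y))%:E - (u (a *: delta_mx 0 k + y))%:E)%E.
Proof.
move=> ab cu HU.
pose L (t : R) := t *: delta_mx 0 k + y.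
have cL t : {for t, continuous L}.
  by apply: cvgD; [apply: cvgZr_tmp; exact: cvg_id|exact: cvg_cst].
have cuL t : a <= t <= b -> {for t, continuous (u \o L)}.
  by move=> /HU ULt; apply: continuous_comp; [exact: cL|exact: (C1_continuous cu ULt)].
have dL t : a <= t <= b -> is_derive t (1 : R) (u \o L) (partial k u (L t)).
  by move=> /HU ULt; apply: is_derive_along_line; exact: (C1_is_derive k cu ULt).
apply: (@continuous_FTC2 R (partial k u \o L) (u \o L)) => //.
- apply: continuous_in_subspaceT => t; rewrite inE/= in_itv/= => /HU ULt.
  apply: continuous_comp; first exact: cL.
  exact: (C1_partial_continuous cu ULt).
- split.
  + by move=> t; rewrite in_itv/= => /andP[/ltW at_ /ltW tb]; have [] := dL t ltac:(by rewrite at_ tb).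
  + by apply: cvg_at_right_filter; apply: cuL; rewrite lexx ltW.
  + by apply: cvg_at_left_filter; apply: cuL; rewrite lexx ltW.
- move=> t; rewrite in_itv/= => /andP[/ltW at_ /ltW tb].
  by rewrite derive1E; have [_ ->] := dL t ltac:(by rewrite at_ tb).
Qed.

Local Notation lebesgue3 := ((@lebesgue_measure R \x @lebesgue_measure R) \x @lebesgue_measure R)%E.

(** Fubini on (R * R) * R uses the plane measure as one factor and asks for its sigma-finiteness;
    the squares of half-width n exhaust the plane. *)
Lemma lebesgue2_sigma_finite : sigma_finite setT (@lebesgue_measure R \x @lebesgue_measure R)%E.
Proof.
exists (fun n : nat => `[- n%:R, n%:R]%classic `*` `[- n%:R, n%:R]%classic).
  apply/seteqP; split => // -[a b] _.
  exists (Num.truncn (Num.max `|a| `|b|)).+1 => //=; rewrite !in_itv/= -!ler_norml.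
  by split; apply: le_trans (ltW (truncnS_gt _)); rewrite le_max lexx ?orbT.
move=> n; split.
  by apply: measurableX; exact: measurable_itv.
have L : lebesgue_measure (`[- n%:R, n%:R]%classic : set R) \is a fin_num.
  by rewrite ge0_fin_numE// lebesgue_measure_itv/=; case: ifP => // _; rewrite -EFinB ltry.
have E := @product_measure1E _ _ _ _ R (@lebesgue_measure R) (@lebesgue_measure R) _ _
      (measurable_itv `[- n%:R, n%:R]) (measurable_itv `[- n%:R, n%:R]).
by rewrite [X in (X < _)%E]E -ge0_fin_numE ?mule_ge0// fin_numM//; exact: L.
Qed.

Let mx := Measure_isSigmaFinite.Build _ _ _ (@lebesgue_measure R \x @lebesgue_measure R)%E lebesgue2_sigma_finite.
Definition lebesgue2 : {sigma_finite_measure set _ -> \bar R} :=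
  HB.pack (@lebesgue_measure R \x @lebesgue_measure R)%E mx.

Section Faces.
Variables (U : set 'rV[R]_3) (u : 'rV[R]_3 -> R) (c : 'rV[R]_3) (r : R) (k : 'I_3).
Hypotheses (oU : open U) (cu : C1_on U u) (cU : cube c r `<=` U) (r0 : 0 < r)
  (u0 : forall x, cube c r x -> `|x 0 k - c 0 k| = r -> u x = 0).

(** Extension by zero lets Fubini run over the whole space, with the slices of the cube handled
    inside [integral_line]. *)
Let H : 'rV[R]_3 -> R := (partial k u) \_ (cube c r).

Let HE : EFin \o (H \o vec3) =
  (EFin \o (partial k u \o vec3)) \_ (vec3 @^-1` (cube c r)) :> (R * R * R -> \bar R).
Proof.
apply/funext => z; rewrite /H /= !patchE.
rewrite (_ : (z \in vec3 @^-1` cube c r) = (vec3 z \in cube c r)); first by case: ifP.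
by apply/idP/idP; rewrite !inE.
Qed.

Let integrableH : lebesgue3.-integrable setT (EFin \o (H \o vec3)).
Proof.
rewrite HE; have [h _] := @integrable_mkcond _ _ _ lebesgue3 _
  (EFin \o (partial k u \o vec3)) (@measurable_cube R c r); apply: h.
by apply: (@integrable_cube _ U (partial k u) c r oU _ cU) => x Ux; exact: (C1_partial_continuous cu Ux).
Qed.

(** A line in direction [k] either misses the cube or meets it from one face to the opposite one. In
    the second case the fundamental theorem leaves two face values, which vanish. *)
Let integral_line y : y 0 k = 0 ->
  (\int[lebesgue_measure]_t (H (t *: delta_mx 0 k + y))%:E = 0)%E.
Proof.
move=> yk.
have Lk (t : R) : (t *: delta_mx 0 k + y) 0 k = t by rewrite !mxE !eqxx mulr1 yk addr0.
have Lj (t : R) j : j != k -> (t *: delta_mx 0 k + y) 0 j = y 0 j.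
  by move=> jk; rewrite !mxE eqxx (negbTE jk) mulr0 add0r.
have [yc|] := pselect (forall j, j != k -> `|y 0 j - c 0 j| <= r); last first.
  move=> yc; rewrite (_ : (fun t => _) = cst 0%E) ?integral0//.
  apply/funext => t; rewrite /H patchE; case: ifPn => //; rewrite inE => ct.
  by exfalso; apply: yc => j jk; rewrite -(Lj t)//; exact: ct.
have cE t : cube c r (t *: delta_mx 0 k + y) <-> t \in `[c 0 k - r, c 0 k + r].
  split=> [/(_ k)|ct j]; first by rewrite Lk normr_le_itv.
  by have [->|jk] := eqVneq j k; [rewrite Lk normr_le_itv|rewrite Lj// yc].
rewrite (_ : (fun t => _) = (fun t => (partial k u (t *: delta_mx 0 k + y))%:E) \_
    `[c 0 k - r, c 0 k + r]%classic); last first.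
  apply/funext => t; rewrite /H !patchE.
  rewrite (_ : (t \in `[c 0 k - r, c 0 k + r]%classic) = (t *: delta_mx 0 k + y \in cube c r)).
    by case: ifP.
  by apply/idP/idP; rewrite !inE => /cE.
rewrite -integral_mkcond (@integral_derivative_along_line U)//.
- rewrite !u0 ?subee//.
  + by apply/cE; rewrite in_itv/= lexx lerD2l ge0_cp ?ltW.
  + by rewrite Lk addrAC subrr add0r normrN gtr0_norm.
  + by apply/cE; rewrite in_itv/= lexx lerD2l ge0_cp ?ltW.
  + by rewrite Lk addrAC subrr add0r gtr0_norm.
- by rewrite ltrD2l gt0_cp.
- by move=> t ct; apply/cU/cE; rewrite in_itv.
Qed.

(** Fubini is arranged so that the variable [k] is integrated first: one exchange suffices for the
    last coordinate, two are used for the others. *)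
Lemma integral_partial_cube :
  (\int[lebesgue3]_(z in vec3 @^-1` (cube c r)) (partial k u (vec3 z))%:E = 0)%E.
Proof.
rewrite integral_mkcond -[X in integral _ _ X]HE.
(* Every horizontal slice is integrable, and not just almost every one, since the extended function
   is bounded and supported in a square. *)
have integrable2 (z : R) : (@lebesgue_measure R \x @lebesgue_measure R)%E.-integrable setT
    (fun p : R * R => (EFin \o (H \o vec3)) (p, z)).
  pose S := `[c 0 0 - r, c 0 0 + r]%classic `*` `[c 0 1 - r, c 0 1 + r]%classic : set (R * R).
  have mS : measurable S by apply: measurableX; exact: measurable_itv.
  have mH : measurable_fun setT (fun p => H (vec3 (p, z))).
    apply: (measurable_fun_pair1 z (f := fun q => H (vec3 q))).
    have mI := measurable_int _ integrableH.
    exact: (iffLR (measurable_EFinP _ _) mI).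
  rewrite (_ : (fun p => _) = (EFin \o (fun p => H (vec3 (p, z)))) \_ S); last first.
    apply/funext => p; rewrite patchE; case: ifPn => //= pS.
    rewrite /H patchE; case: ifPn => //; rewrite inE => ct.
    exfalso; move/negP : pS; apply; rewrite inE.
    by have := (ct 0, ct 1); rewrite !vec3E !normr_le_itv => -[].
  have [h _] := @integrable_mkcond _ _ _ (@lebesgue_measure R \x @lebesgue_measure R)%E _
    (EFin \o (fun p => H (vec3 (p, z)))) mS.
  apply: h; apply: measurable_bounded_integrable => //.
  - have E := @product_measure1E _ _ _ _ R (@lebesgue_measure R) (@lebesgue_measure R) _ _
      (measurable_itv `[c 0 0 - r, c 0 0 + r]) (measurable_itv `[c 0 1 - r, c 0 1 + r]).
    have L (a b : R) : lebesgue_measure (`[a, b]%classic : set R) \is a fin_num.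
      by rewrite ge0_fin_numE// lebesgue_measure_itv/=; case: ifP => // _; rewrite -EFinB ltry.
    by rewrite [X in (X < _)%E]E -ge0_fin_numE ?mule_ge0// fin_numM//; exact: L.
  - exact: measurable_funTS.
  - have [C C0 HC] := @bounded_on_cube _ U (partial k u) c r oU
      (fun x Ux => C1_partial_continuous cu Ux) cU.
    exists C; split; first exact: gtr0_real.
    move=> D CD p _; apply: le_trans (ltW CD); rewrite /H patchE.
    by case: ifPn; [rewrite inE => /HC|rewrite normr0 ltW].
have [k2|[k1|k0]] : k = 2%:R \/ k = 1 \/ k = 0.
  by move: (k); apply: ord3P; auto.
- apply: (etrans (esym (@integral12_prod_meas1 _ _ _ _ R lebesgue2 (@lebesgue_measure R) _ integrableH))).
  apply: integral0_eq => p _; rewrite /fubini_F.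
  rewrite -[RHS](@integral_line (vec3 (p, 0))); last by rewrite k2 vec3E.
  apply: eq_integral => t _; rewrite /=; congr (H _)%:E.
  by rewrite k2; apply/rowP; apply: ord3P; rewrite !mxE/= ?mulr1 ?mulr0 ?addr0 ?add0r.
- apply: (etrans (esym (@integral21_prod_meas1 _ _ _ _ R lebesgue2 (@lebesgue_measure R) _ integrableH))).
  apply: integral0_eq => z _; rewrite /fubini_G.
  apply: (etrans (esym (@integral12_prod_meas1 _ _ _ _ R (@lebesgue_measure R) (@lebesgue_measure R) _ (integrable2 z)))).
  apply: integral0_eq => p _; rewrite /fubini_F.
  rewrite -[RHS](@integral_line (vec3 (p, 0, z))); last by rewrite k1 vec3E.
  apply: eq_integral => t _; rewrite /=; congr (H _)%:E.
  by rewrite k1; apply/rowP; apply: ord3P; rewrite !mxE/= ?mulr1 ?mulr0 ?addr0 ?add0r.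
- apply: (etrans (esym (@integral21_prod_meas1 _ _ _ _ R lebesgue2 (@lebesgue_measure R) _ integrableH))).
  apply: integral0_eq => z _; rewrite /fubini_G.
  apply: (etrans (esym (@integral21_prod_meas1 _ _ _ _ R (@lebesgue_measure R) (@lebesgue_measure R) _ (integrable2 z)))).
  apply: integral0_eq => p _; rewrite /fubini_G.
  rewrite -[RHS](@integral_line (vec3 (0, p, z))); last by rewrite k0 vec3E.
  apply: eq_integral => t _; rewrite /=; congr (H _)%:E.
  by rewrite k0; apply/rowP; apply: ord3P; rewrite !mxE/= ?mulr1 ?mulr0 ?addr0 ?add0r.
Qed.

End Faces.
End CubeDivergence.

(** * Differentiation under the integral sign *)

Section JointContinuity.
Context {R : realType}.
Implicit Types (I : set R) (U : set 'rV[R]_3) (F H : R -> 'rV[R]_3 -> R).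

Definition jointly_continuous I U F :=
  {within I `*` U, continuous (fun q : R * 'rV[R]_3 => F q.1 q.2)}.

Lemma jointly_continuousP I U F : jointly_continuous I U F <->
  forall s x, I s -> U x -> F q.1 q.2 @[q --> within (I `*` U) (nbhs (s, x))] --> F s x.
Proof.
split=> [/subspace_continuousP h s x Is Ux|h].
  exact: (h (s, x)).
by apply/subspace_continuousP => -[s x] [Is Ux]; exact: h.
Qed.

Lemma jointly_continuous_eq I U F H : (forall s x, I s -> U x -> F s x = H s x) ->
  jointly_continuous I U F -> jointly_continuous I U H.
Proof.
move=> FH /jointly_continuousP cF; apply/jointly_continuousP => s x Is Ux.
rewrite -FH//; apply: cvg_trans (cF s x Is Ux); apply: near_eq_cvg.
by rewrite near_withinE; apply: nearW => -[s' x'] [/= Is' Ux']; rewrite FH.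
Qed.

Lemma jointly_continuousD I U F H : jointly_continuous I U F ->
  jointly_continuous I U H -> jointly_continuous I U (fun s x => F s x + H s x).
Proof.
move=> /jointly_continuousP cF /jointly_continuousP cH.
by apply/jointly_continuousP => s x Is Ux; apply: cvgD; [exact: cF|exact: cH].
Qed.

Lemma jointly_continuousM I U F H : jointly_continuous I U F ->
  jointly_continuous I U H -> jointly_continuous I U (fun s x => F s x * H s x).
Proof.
move=> /jointly_continuousP cF /jointly_continuousP cH.
by apply/jointly_continuousP => s x Is Ux; apply: cvgM; [exact: cF|exact: cH].
Qed.

Lemma jointly_continuous_comp I U F (phi : R -> R) : jointly_continuous I U F ->
  (forall s x, I s -> U x -> {for F s x, continuous phi}) ->
  jointly_continuous I U (fun s x => phi (F s x)).
Proof.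
move=> /jointly_continuousP cF cphi.
apply/jointly_continuousP => s x Is Ux.
by apply: (cvg_comp _ _ (cF s x Is Ux)); exact: cphi.
Qed.

Lemma jointly_continuous_space I U (u : 'rV[R]_3 -> R) :
  (forall x, U x -> {for x, continuous u}) -> jointly_continuous I U (fun=> u).
Proof.
move=> cu; apply/jointly_continuousP => s x Is Ux.
have c2 : q.2 @[q --> within (I `*` U) (nbhs (s, x))] --> x.
  by apply: cvg_within_filter; exact: cvg_snd.
exact: (cvg_comp _ _ c2 (cu x Ux)).
Qed.

Lemma jointly_continuous_sum I U (T : Type) (r : seq T) (F : T -> R -> 'rV[R]_3 -> R) :
  (forall i, jointly_continuous I U (F i)) ->
  jointly_continuous I U (fun s x => \sum_(i <- r) F i s x).
Proof.
move=> cF; elim: r => [|i r IH].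
  apply: (@jointly_continuous_eq _ _ (fun=> fun=> 0)).
    by move=> s x _ _; rewrite big_nil.
  by apply: jointly_continuous_space => x _; exact: cst_continuous.
apply: (@jointly_continuous_eq _ _ (fun s x => F i s x + \sum_(j <- r) F j s x)).
  by move=> s x _ _; rewrite big_cons.
exact: jointly_continuousD.
Qed.

Lemma jointly_continuous_slice I U F s x : open U -> jointly_continuous I U F ->
  I s -> U x -> {for x, continuous (F s)}.
Proof.
move=> oU /jointly_continuousP cF Is Ux.
have c : (s, y) @[y --> x] --> within (I `*` U) (nbhs (s, x)).
  have c' : (s, y) @[y --> x] --> (s, x).
    by apply: (@cvg_pair _ _ _ (nbhs x) (nbhs s) (nbhs x)); [exact: cvg_cst|exact: cvg_id].
  move=> P wP.
  have nU : nbhs x U by exact: open_nbhs_nbhs.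
  have := c' _ wP; rewrite /nbhs/=; apply: filterS2 nU => y Uy; apply.
  by split.
exact: (cvg_comp _ _ c (cF s x Is Ux)).
Qed.

(** A tube argument: joint continuity gives a product neighbourhood around each (t, x), and
    compactness of [K] selects a time neighbourhood valid for all x in [K]. *)
Lemma jointly_continuous_uniform I U F (K : set 'rV[R]_3) t (e : R) :
  open U -> compact K -> K `<=` U -> jointly_continuous I U F -> I t -> 0 < e ->
  \forall s \near within I (nbhs t), forall x, K x -> `|F s x - F t x| <= e.
Proof.
move=> oU cK KU /jointly_continuousP cF It e0.
have /compact_near_coveringP cov := cK.
apply: (cov _ (within I (nbhs t)) (fun s x => `|F s x - F t x| <= e)) => x Kx.
have Ux := KU x Kx.
have e2 : 0 < e / 2 by rewrite divr_gt0.
have /cvgrPdist_le/(_ _ e2) := cF t x It Ux.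
rewrite near_withinE => -[[A B] /= [nA nB] AB].
exists (B `&` U, A `&` I) => /=.
  split; first by apply: filterI => //; exact: open_nbhs_nbhs.
  by rewrite /within/=; apply: filterS nA => s.
move=> [x' s] /= [[Bx' Ux'] [As Is]].
have h1 := AB (s, x') (conj As Bx') (conj Is Ux').
have h2 := AB (t, x') (conj (nbhs_singleton nA) Bx') (conj It Ux').
rewrite -(subrKA (F t x)); apply: (le_trans (ler_normD _ _)).
by rewrite [leRHS](splitr e) lerD// distrC.
Qed.

Lemma mean_value_derives_in (a b : R) (h h' : R -> R) : a <= b ->
  (forall w, w \in `[a, b] -> derives_in `[a, b] h w (h' w)) ->
  exists2 w, w \in `[a, b] & h b - h a = h' w * (b - a).
Proof.
move=> ab dh; apply: MVT_segment => //.
  move=> w wab; apply: derives_in_is_derive (wab) _; apply: dh.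
  exact: subset_itv_oo_cc wab.
by apply/subspace_continuousP => w wab; apply: derives_in_cvg; exact: dh.
Qed.

(** Covers both orders of [s] and [t], and keeps the bound |t - w| <= |t - s|, which forces the
    intermediate time to [t] along with [s]. *)
Lemma increment_mean_value (a b : R) (h h' : R -> R) (s t : R) :
  s \in `[a, b] -> t \in `[a, b] ->
  (forall w, w \in `[a, b] -> derives_in `[a, b] h w (h' w)) ->
  exists w, [/\ w \in `[a, b], `|t - w| <= `|t - s| & h s - h t = h' w * (s - t)].
Proof.
rewrite !in_itv/= => sab tab dh.
have sub lo hi : a <= lo -> hi <= b ->
    forall w, w \in `[lo, hi] -> w \in `[a, b] /\ derives_in `[lo, hi] h w (h' w).
  move=> alo hib w whl.
  have wab : w \in `[a, b] by move: whl; rewrite !in_itv/=; lra.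
  split => //; apply: derives_in_sub (dh w wab) => v /=; rewrite !in_itv/=; lra.
have [st|ts] := leP s t.
  have [|w wst E] := @mean_value_derives_in s t h h' st.
    by move=> w /(sub s t)[]//; lra.
  exists w; split; first by move: wst; rewrite !in_itv/=; lra.
    by move: wst; rewrite in_itv/= => /andP[sw wt]; rewrite !ger0_norm; lra.
  by rewrite -opprB E; ring.
have [|w wst E] := @mean_value_derives_in t s h h' (ltW ts).
  by move=> w /(sub t s)[]//; lra.
exists w; split => //; first by move: wst; rewrite !in_itv/=; lra.
by move: wst; rewrite in_itv/= => /andP[sw wt]; rewrite !ler0_norm; lra.
Qed.

Local Notation lebesgue3 := ((@lebesgue_measure R \x @lebesgue_measure R) \x @lebesgue_measure R)%E.

(** The difference quotient at x equals F' at an intermediate time depending on x. Uniformity of F'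
    over the compact cube makes it uniformly close to F' at [t], and the finite volume of the cube
    carries this to the integrals. *)
Lemma derives_in_integral_cube (a b t : R) U c r F F' :
  open U -> cube c r `<=` U -> t \in `[a, b] ->
  jointly_continuous `[a, b] U F -> jointly_continuous `[a, b] U F' ->
  (forall s x, s \in `[a, b] -> U x -> derives_in `[a, b] (F^~ x) s (F' s x)) ->
  derives_in `[a, b] (fun s => \int[lebesgue3]_(z in vec3 @^-1` (cube c r)) F s (vec3 z)) t
    (\int[lebesgue3]_(z in vec3 @^-1` (cube c r)) F' t (vec3 z)).
Proof.
move=> oU cU tab cF cF' dF.
set D := vec3 @^-1` (cube c r).
have mD := @measurable_cube R c r; rewrite -/D in mD.
have intF s : s \in `[a, b] -> lebesgue3.-integrable D (EFin \o (F s \o vec3)).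
  by move=> sab; apply: (integrable_cube oU) => // x Ux; exact: (jointly_continuous_slice oU cF sab Ux).
have intF' : lebesgue3.-integrable D (EFin \o (F' t \o vec3)).
  by apply: (integrable_cube oU) => // x Ux; exact: (jointly_continuous_slice oU cF' tab Ux).
pose V := fine (lebesgue3 D).
have V0 : 0 <= V by exact: fine_ge0.
apply/cvgrPdist_le => e e0.
(* The denominator V + 1 is positive whatever the volume V is. *)
have e1 : 0 < e / (V + 1) by rewrite divr_gt0// ltr_wpDl.
have := jointly_continuous_uniform oU (@compact_cube _ c r) cU cF' tab e1.
rewrite near_withinE => /nbhs_normP[d /= d0 dP].
rewrite near_withinE /dnbhs near_withinE; apply/nbhs_normP; exists d => //= s tsd st sab.
pose G x := F' t x - (s - t)^-1 * (F s x - F t x).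
have GE x : cube c r x -> `|G x| <= e / (V + 1).
  move=> cx; have [w [wab ws]] := increment_mean_value sab tab (fun w wab => dF w x wab (cU x cx)).
  rewrite /G => ->; rewrite mulrCA mulVf ?subr_eq0// mulr1 distrC.
  by apply: dP => //=; exact: le_lt_trans ws tsd.
have intB : lebesgue3.-integrable D (EFin \o ((fun x => F s x - F t x) \o vec3)).
  have := integrableB mD (intF s sab) (intF t tab).
  by apply: eq_integrable => // z _.
have intZ : lebesgue3.-integrable D (EFin \o ((fun x => (s - t)^-1 * (F s x - F t x)) \o vec3)).
  have := integrableZl mD (s - t)^-1 intB.
  by apply: eq_integrable => // z _.
have intG : lebesgue3.-integrable D (EFin \o (G \o vec3)).
  have := integrableB mD intF' intZ.
  by apply: eq_integrable => // z _.
rewrite [X in `|X|](_ : _ = \int[lebesgue3]_(z in D) G (vec3 z)); last first.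
  rewrite [RHS](RintegralB mD intF' intZ) [in RHS](RintegralZl _ mD intB).
  by rewrite (RintegralB mD (intF s sab) (intF t tab)) [in RHS]mulrC.
apply: (le_trans (le_normr_Rintegral mD intG)).
apply: (@le_trans _ _ (\int[lebesgue3]_(z in D) (e / (V + 1)))).
  apply: le_Rintegral => //.
  - have := integrable_abse intG.
    by apply: eq_integrable => // z _.
  - by apply: (@integrable_cube _ U (fun=> e / (V + 1)) c r oU) => // x _; exact: cst_continuous.
  - by move=> z Dz; exact: GE.
rewrite Rintegral_cst// -/V mulrAC ler_pdivrMr ?ltr_wpDl//.
by rewrite ler_pM2l// lerDl.
Qed.

End JointContinuity.

(** * Relative entropy of a density *)

Section DensityPullback.
Context d1 d2 (X : measurableType d1) (Y : measurableType d2) (R : realType).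
Variables (mu : {measure set X -> \bar R}) (nu : {measure set Y -> \bar R}).
Variables (theta : Y -> X) (B : set X) (D : set Y) (rho : Y -> R).
Hypotheses (mB : measurable B) (mD : measurable D) (mtheta : measurable_fun D theta)
  (thetaB : forall y, D y -> B (theta y)) (mrho : measurable_fun D rho)
  (rho0 : forall y, D y -> 0 <= rho y)
  (muE : forall A, measurable A -> A `<=` B ->
     (mu A = \int[nu]_(y in D `&` theta @^-1` A) (rho y)%:E)%E).
Import HBNNSimple.

(** The change of variables is known on sets; simple functions and monotone convergence extend it to
    functions. With [theta] a chart it transports integrals to R^3, and with [theta] the identity it
    is the integration rule for a density, used for the normalized measure and for varpi. *)
Lemma ge0_integral_density_pullback (h : X -> \bar R) :
  measurable_fun B h -> (forall x, B x -> (0 <= h x)%E) ->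
  (\int[mu]_(x in B) h x = \int[nu]_(y in D) (h (theta y) * (rho y)%:E))%E.
Proof.
move=> mh h0; pose h_ := nnsfun_approx mB mh.
have ndh n m x : (n <= m)%N -> h_ n x <= h_ m x.
  by move=> nm; exact/lefP/nd_nnsfun_approx.
have hcvg x : B x -> (h_ n x)%:E @[n --> \oo] --> h x.
  by move=> Bx; exact: cvg_nnsfun_approx.
have mhT n : measurable_fun D (fun y => h_ n (theta y)).
  by apply: measurableT_comp => //; exact: measurable_funP.
transitivity (limn (fun n => \int[mu]_(x in B) (h_ n x)%:E)%E).
  rewrite -monotone_convergence//.
  - by apply: eq_integral => x; rewrite inE => Bx; apply/esym/cvg_lim => //; exact: hcvg.
  - by move=> n; apply/measurable_EFinP/measurable_funTS; exact: measurable_funP.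
  - by move=> n x _; rewrite lee_fin.
  - by move=> x _ m n mn; rewrite lee_fin ndh.
transitivity (limn (fun n => \int[nu]_(y in D) (h_ n (theta y) * rho y)%:E)%E); last first.
  rewrite -monotone_convergence//.
  - apply: eq_integral => y; rewrite inE => Dy; apply/cvg_lim => //.
    under eq_fun do rewrite EFinM.
    by apply: cvgeZr => //; apply: hcvg; exact: thetaB.
  - by move=> n; apply/measurable_EFinP/measurable_funM.
  - by move=> n y Dy; rewrite lee_fin mulr_ge0// rho0.
  - by move=> y Dy m n mn; rewrite lee_fin ler_wpM2r ?rho0// ndh.
congr (limn _); apply/funext => n.
pose A k := h_ n @^-1` [set k].
have mA k : measurable (A k) by exact: measurable_sfunP.
have hE x : h_ n x = \sum_(k \in range (h_ n)) (k * \1_(A k) x) by rewrite fimfunE.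
under eq_integral do rewrite hE -fsumEFin//.
rewrite ge0_integral_fsum//; last 2 first.
- by move=> k; exact/measurable_EFinP/measurable_funM.
- by move=> k x _; rewrite nnfun_muleindic_ge0.
transitivity (\sum_(k \in range (h_ n)) \int[nu]_(y in D) (k * \1_(A k) (theta y) * rho y)%:E)%E.
  apply: eq_fsbigr => k; rewrite inE => -[x0 _ kE].
  have k0 : 0 <= k by rewrite -kE.
  rewrite integralZl_indic_nnsfun// integral_indic// muE; last 2 first.
  - exact: measurableI.
  - by move=> x [].
  under [in RHS]eq_integral do rewrite -mulrA EFinM.
  rewrite ge0_integralZl//; last 2 first.
  - apply/measurable_EFinP/measurable_funM => //.
    by apply: measurableT_comp => //; exact: measurable_indic.
  - by move=> y Dy; rewrite lee_fin mulr_ge0// rho0.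
  congr (_ * _)%E.
  rewrite [RHS](eq_integral (((EFin \o rho) \_ (theta @^-1` (A k `&` B))))).
    by rewrite -integral_mkcondr.
  move=> y; rewrite inE => Dy; rewrite patchE /= indicE.
  have -> : (y \in theta @^-1` (A k `&` B)) = (theta y \in A k).
    apply/idP/idP; rewrite !inE; first by case.
    by move=> Ay; split => //; exact: thetaB.
  by case: ifP; rewrite ?mul1r ?mul0r.
rewrite -ge0_integral_fsum//.
- apply: eq_integral => y _; rewrite hE fsumEFin//.
  by rewrite mulrC mulr_fsumr; congr (_%:E); apply: eq_fsbigr => k _; rewrite mulrC.
- move=> k; apply/measurable_EFinP/measurable_funM => //; apply: measurable_funM => //.
  by apply: measurableT_comp => //; exact: measurable_indic.
- move=> k y Dy; rewrite lee_fin mulr_ge0 ?rho0//.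
  have [k0|k0] := leP 0 k; first by rewrite mulr_ge0.
  (* For negative k the level set of the nonnegative simple function is empty, so the term is zero
     and not negative. *)
  by rewrite /A preimage_nnfun0// indic0 mulr0.
Qed.

(** Since [rho] is nonnegative, multiplication by it commutes with taking positive and negative
    parts, and the two parts correspond separately. *)
Lemma Rintegral_density_pullback (h : X -> R) : measurable_fun B h ->
  \int[mu]_(x in B) h x = \int[nu]_(y in D) (h (theta y) * rho y).
Proof.
move=> mh; congr fine; rewrite integralE [RHS]integralE.
have mEh : measurable_fun B (EFin \o h) by exact/measurable_EFinP.
rewrite !ge0_integral_density_pullback//; [|exact: measurable_funeneg|exact: measurable_funepos].
congr (_ - _)%E; apply: eq_integral => y; rewrite inE => Dy.
- rewrite !funeposE /= -!EFin_max -EFinM; congr _%:E.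
  by rewrite maxr_pMl ?mul0r// rho0.
- rewrite !funenegE /= -!EFin_max -EFinM; congr _%:E.
  by rewrite maxr_pMl ?mul0r ?mulNr// rho0.
Qed.

End DensityPullback.

Section EntropyOfDensity.
Context {R : realType} {M : ptopologicalType}.
Variables (mu : {measure set (borel M) -> \bar R}) (P : probability (borel M) R).
Variables (w : R) (f : M -> R).
Hypotheses (w0 : 0 < w) (muT_gt0 : (0 < mu setT)%E) (muT_fin : mu setT \is a fin_num)
  (mf : measurable_fun [set: borel M] f)
  (densP : has_density P mu (fun p => w * expR (- f p))).

Let V := volume mu.

Let V0 : 0 < V.
Proof. by rewrite /V /volume fine_gt0// muT_gt0 -ge0_fin_numE. Qed.

Let mdens : measurable_fun [set: borel M] (fun p => w * expR (- f p)).
Proof.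
by apply: measurable_funM => //; apply: measurableT_comp => //; exact: measurableT_comp.
Qed.

Lemma normalizedE A : normalized mu A = (mu A * (V^-1)%:E)%E.
Proof.
rewrite /normalized /mnormalize/=; rewrite /normalized /mnormalize/= gt_eqF//= (_ : (mu setT == +oo%E) = false)//.
by apply/negbTE; move: muT_fin; rewrite fin_numE => /andP[].
Qed.

Lemma ge0_integral_normalized (B : set (borel M)) (h : borel M -> \bar R) :
  measurable B -> measurable_fun B h -> (forall x, B x -> (0 <= h x)%E) ->
  (\int[normalized mu]_(x in B) h x = \int[mu]_(x in B) (h x * (V^-1)%:E))%E.
Proof.
move=> mB mh h0.
have H := @ge0_integral_density_pullback _ _ (borel M) (borel M) R (normalized mu) mu id B B
  (fun=> V^-1) mB mB.
apply: H => //; [by move=> y _; rewrite invr_ge0 ltW|].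
move=> A mA AB; apply: etrans (normalizedE A) _.
by rewrite preimage_id setIidr// (integral_cst _ mA) muleC.
Qed.

Lemma Rintegral_has_density (h : M -> R) : measurable_fun [set: borel M] h ->
  \int[P]_(p in [set: borel M]) h p =
  \int[mu]_(p in [set: borel M]) (h p * (w * expR (- f p))).
Proof.
move=> mh.
apply: (@Rintegral_density_pullback _ _ (borel M) (borel M) R P mu id setT setT) => //.
- by move=> y _; rewrite mulr_ge0 ?ltW// expR_gt0.
- by move=> A mA _; apply: etrans (densP mA) _; rewrite setTI preimage_id.
Qed.

Lemma density_normalized (B : set (borel M)) : measurable B ->
  (P B = \int[normalized mu]_(p in B) (V * (w * expR (- f p)))%:E)%E.
Proof.
move=> mB; apply: etrans (densP mB) _; rewrite ge0_integral_normalized//.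
- apply: eq_integral => p _; rewrite -EFinM; congr _%:E.
  by field; rewrite gt_eqF.
- by apply/measurable_EFinP/measurable_funTS/measurable_funM.
- by move=> p _; rewrite lee_fin !mulr_ge0 ?ltW// expR_gt0.
Qed.

Lemma dominated_normalized : charge_of_finite_measure P `<< normalized mu.
Proof.
apply/null_content_dominatesP => A mA nA; rewrite /charge_of_finite_measure/=.
apply: etrans (density_normalized mA) _; apply: null_set_integral => //.
by apply/measurable_EFinP/measurable_funTS/measurable_funM.
Qed.

(** The Radon-Nikodym derivative is determined only almost everywhere. It is identified with V w
    e^(-f) by comparing integrals over all measurable sets; then the logarithm splits, and the bound
    on f gives integrability. *)
Lemma relative_entropy_density :
  (exists C : R, forall p, `|f p| <= C) ->
  relative_entropy P (normalized mu) =
  ln V + ln w - \int[mu]_(p in [set: borel M]) (f p * (w * expR (- f p))).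
Proof.
move=> [C fC].
have mVd : measurable_fun [set: borel M] (fun p => (V * (w * expR (- f p)))%:E).
  by apply/measurable_EFinP/measurable_funM.
set rn := Radon_Nikodym (charge_of_finite_measure P) (normalized mu).
have irn : (normalized mu).-integrable setT rn := Radon_Nikodym_integrable dominated_normalized.
have mrn : measurable_fun setT rn := measurable_int _ irn.
have E : ae_eq (normalized mu) setT rn (fun p => (V * (w * expR (- f p)))%:E).
  apply: integral_ae_eq => // A _ mA.
  by apply: etrans (esym (Radon_Nikodym_integral dominated_normalized mA)) _; exact: density_normalized.
(* Equality is known almost everywhere for the normalized measure; domination passes it on to P,
   against which the logarithm is integrated. *)
have EP : ae_eq P setT (fun p => (ln (fine (rn p)))%:E) (fun p => (ln V + ln w - f p)%:E).
  have [N [mN N0 subN]] := E; exists N; split => //.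
    have /null_content_dominatesP := dominated_normalized; exact.
  move=> p /= ne; apply: subN => /= eq; apply: ne => _.
  rewrite (eq I)/=; congr _%:E.
  by rewrite !lnM ?posrE ?mulr_gt0 ?expR_gt0// expRK addrA.
have mfin : measurable_fun [set: borel M] (fun p => fine (rn p)).
  exact: (measurableT_comp (@fine_measurable R setT measurableT) mrn).
rewrite /relative_entropy -/rn /Rintegral.
rewrite (ae_eq_integral (fun p : borel M => (ln V + ln w - f p)%:E)
  (fun p : borel M => (ln (fine (rn p)))%:E) _ _ _ EP)//; last 2 first.
- by apply/measurable_EFinP; exact: (measurableT_comp (@measurable_ln R)).
- by apply/measurable_EFinP; apply: measurable_funB.
have intf : P.-integrable setT (EFin \o f).
  apply: measurable_bounded_integrable => //.
    by rewrite -ge0_fin_numE// fin_num_measure.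
  exists C; split; first by rewrite num_real.
  by move=> D CD p _; exact: le_trans (fC p) (ltW CD).
have intc : P.-integrable setT (EFin \o (fun=> ln V + ln w)).
  exact: finite_measure_integrable_cst.
rewrite -/(Rintegral P setT (fun p => ln V + ln w - f p)) (RintegralB _ intc intf)//.
rewrite Rintegral_cst// Rintegral_has_density//; congr (_ - _).
by rewrite -[RHS]mulr1; congr (_ * _); exact: (congr1 fine (probability_setT P)).
Qed.

End EntropyOfDensity.

Section GFunctional.
Context {R : realType} {M : ptopologicalType}.

Lemma G_functional_density (mu : {measure set (borel M) -> \bar R})
  (P : probability (borel M) R) (tau : R) (f : M -> R) :
  0 < tau -> (0 < mu setT)%E -> mu setT \is a fin_num ->
  measurable_fun [set: borel M] f -> (exists C : R, forall p, `|f p| <= C) ->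
  has_density P mu (fun p => (4 * pi * tau) `^ (- (3 / 2)) * expR (- f p)) ->
  G_functional mu P tau =
  3 / 2 - (heat_weight tau)^-1 * \int[mu]_(p in [set: borel M]) (f p * expR (- f p)).
Proof.
move=> tau0 m0 mfin mf bf.
have hw0 : 0 < heat_weight tau by rewrite powR_gt0// !mulr_gt0// pi_gt0.
rewrite powRN -/(heat_weight tau) => dens.
have w0 : 0 < (heat_weight tau)^-1 by rewrite invr_gt0.
rewrite /G_functional (relative_entropy_density w0 m0 mfin mf dens bf).
have V0 : 0 < volume mu by rewrite /volume fine_gt0// m0 -ge0_fin_numE.
rewrite lnM ?posrE ?invr_gt0// !lnV ?posrE//.
rewrite (_ : \int[mu]_(p in [set: borel M]) (f p * ((heat_weight tau)^-1 * expR (- f p))) =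
   (heat_weight tau)^-1 * \int[mu]_(p in [set: borel M]) (f p * expR (- f p))); first by ring.
rewrite -RintegralZl//.
  by apply: eq_Rintegral => p _; ring.
case: bf => C fC.
apply: measurable_bounded_integrable => //.
- by rewrite -ge0_fin_numE.
- by apply: measurable_funM => //; apply: measurableT_comp => //; exact: measurableT_comp.
exists (C * expR C); split; first by rewrite num_real.
move=> D CD p _; apply: le_trans (ltW CD); rewrite normrM ler_pM// (gtr0_norm (expR_gt0 _)) ler_expR.
by rewrite (le_trans (ler_norm _))// normrN.
Qed.

End GFunctional.

(** * First-order consequences of smoothness *)

Section SmoothFamilies.
Context {R : realType}.
Implicit Types (I : set R) (U : set 'rV[R]_3) (F : R -> 'rV[R]_3 -> R).

Lemma smooth_family_partial I U F i : smooth_family I U F ->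
  smooth_family I U (fun s => partial i (F s)).
Proof. by move=> sF k; have [_ [_ _ _]] := sF k.+1; exact. Qed.

Lemma smooth_family_continuous I U F : smooth_family I U F -> jointly_continuous I U F.
Proof. by move=> sF; have [] := sF 0. Qed.

Lemma smooth_family_derive_continuous I U F : smooth_family I U F ->
  jointly_continuous I U (fun s x => derive_in I (F^~ x) s).
Proof. by move=> sF; have [_ [_ []]] := sF 1. Qed.

Lemma smooth_family_derives_in I U F s x : smooth_family I U F -> I s -> U x ->
  derives_in I (F^~ x) s (derive_in I (F^~ x) s).
Proof. by move=> sF Is Ux; have [_ [+ _ _ _]] := sF 1; exact. Qed.

Lemma smooth_family_C1 I U F s : open U -> I s -> smooth_family I U F -> C1_on U (F s).
Proof.
move=> oU Is sF x Ux; split.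
  exact: (jointly_continuous_slice oU (smooth_family_continuous sF) Is Ux).
move=> i; split; first by have [_ [_ _ + _]] := sF 1; exact.
have sFi := smooth_family_partial i sF.
exact: (jointly_continuous_slice oU (smooth_family_continuous sFi) Is Ux).
Qed.

Lemma smooth_on_C1 U (u : 'rV[R]_3 -> R) : open U -> smooth_on U u -> C1_on U u.
Proof. by move=> oU; exact: (@smooth_family_C1 setT U (fun=> u) 0). Qed.

End SmoothFamilies.

(** * Functions and integrals on the manifold *)

Section Charts.
Context {R : realType} {M : ptopologicalType} (A : smooth_atlas R M).
Implicit Types (c : chart A) (p : M) (u v : M -> R).

Lemma chart_cod_open c : open (chart_cod c).
Proof. exact: cod_open. Qed.

Lemma chart_cod_to_coord c p : chart_dom c p -> chart_cod c (to_coord c p).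
Proof. by move=> cp; exists p. Qed.

Lemma of_coordK c x : chart_cod c x -> chart_dom c (of_coord c x) /\ to_coord c (of_coord c x) = x.
Proof. by move=> [p cp <-]; rewrite to_coordK. Qed.

Lemma near_chart_dom c p : chart_dom c p -> \forall q \near p, chart_dom c q.
Proof. by move=> cp; apply: open_nbhs_nbhs; split => //; exact: dom_open. Qed.

Lemma near_chart_cod c x : chart_cod c x -> \forall y \near x, chart_cod c y.
Proof. by move=> cx; apply: open_nbhs_nbhs; split => //; exact: chart_cod_open. Qed.

Lemma to_coord_cont c p : chart_dom c p -> {for p, continuous (to_coord c)}.
Proof.
move=> cp; have := @to_coord_continuous _ _ A c.
by rewrite continuous_open_subspace; [apply; rewrite inE|exact: dom_open].
Qed.

Lemma of_coord_cont c x : chart_cod c x -> {for x, continuous (of_coord c)}.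
Proof.
move=> cx; have := @of_coord_continuous _ _ A c.
by rewrite continuous_open_subspace; [apply; rewrite inE|exact: cod_open].
Qed.

Lemma continuous_from_chart (T : topologicalType) c p (h : M -> T) : chart_dom c p ->
  {for to_coord c p, continuous (h \o of_coord c)} -> {for p, continuous h}.
Proof.
move=> cp ch; apply: (@near_eq_continuous _ _ ((h \o of_coord c) \o to_coord c)).
  by apply: filterS (near_chart_dom cp) => q cq /=; rewrite to_coordK.
by apply: continuous_comp => //; exact: to_coord_cont.
Qed.

Lemma continuous_in_chart (T : topologicalType) c x (h : M -> T) : chart_cod c x ->
  {for of_coord c x, continuous h} -> {for x, continuous (h \o of_coord c)}.
Proof. by move=> cx ch; apply: continuous_comp => //; exact: of_coord_cont. Qed.

Definition overlap c c' : set 'rV[R]_3 := to_coord c @` (chart_dom c `&` chart_dom c').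

Lemma overlapP c c' x : overlap c c' x <-> chart_cod c x /\ chart_dom c' (of_coord c x).
Proof.
split=> [[p [cp c'p] <-]|[cx c'x]].
  by split; [exists p|rewrite to_coordK].
by have [dx xE] := of_coordK cx; exists (of_coord c x).
Qed.

Lemma overlap_open c c' : open (overlap c c').
Proof.
rewrite openE => x /overlapP[cx c'x]; rewrite /interior.
have n1 := near_chart_cod cx.
have n2 := of_coord_cont cx (near_chart_dom c'x).
by apply: filterS2 n1 n2 => y cy c'y; apply/overlapP.
Qed.

Lemma transition_C1 c c' j :
  C1_on (overlap c c') (fun y => to_coord c' (of_coord c y) 0 j).
Proof. by apply: smooth_on_C1; [exact: overlap_open|exact: transition_smooth]. Qed.

Definition C1_function u := forall c, C1_on (chart_cod c) (u \o of_coord c).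

Lemma C1_function_continuous u : C1_function u -> continuous u.
Proof.
move=> cu p; have cp := dom_chart_at A p; apply: (continuous_from_chart cp).
exact: (C1_continuous (cu _) (chart_cod_to_coord cp)).
Qed.

(** Near the point, u read in [c] is u read in [c'] composed with the transition map; the equality
    holds only on the overlap, which is open and therefore enough for derivatives. *)
Lemma partial_chart_change u c c' p i : C1_function u ->
  chart_dom c p -> chart_dom c' p ->
  partial i (u \o of_coord c) (to_coord c p) =
  \sum_(j < 3) ('J (to_coord c' \o of_coord c) (to_coord c p)) i j *
    partial j (u \o of_coord c') (to_coord c' p).
Proof.
move=> cu cp c'p; set x := to_coord c p.
have Ox : overlap c c' x by exists p.
have phix : (to_coord c' \o of_coord c) x = to_coord c' p by rewrite /= to_coordK.
rewrite -phix -(@partial_comp _ (overlap c c') (chart_cod c')) //.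
- have nO : \forall y \near x, overlap c c' y.
    by apply: open_nbhs_nbhs; split => //; exact: overlap_open.
  apply: near_eq_derive; apply: filterS nO.
  by move=> y /overlapP[_ c'y]; rewrite /= to_coordK.
- exact: overlap_open.
- exact: chart_cod_open.
- by rewrite phix; exists p.
- by move=> j; exact: transition_C1.
Qed.

Lemma riemannian_sym (g : tensor2 A) c x : riemannian g -> chart_cod c x -> (g c x)^T = g c x.
Proof. by move=> [+ _ _]; exact. Qed.

Lemma riemannian_det_gt0 (g : tensor2 A) c x : riemannian g -> chart_cod c x -> 0 < \det (g c x).
Proof.
move=> rg cx; apply: posdef_det_gt0; first exact: riemannian_sym.
by move=> v v0; have [_ + _] := rg; exact.
Qed.

Lemma riemannian_unit (g : tensor2 A) c x : riemannian g -> chart_cod c x -> g c x \in unitmx.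
Proof. by move=> rg cx; rewrite unitmxE unitfE gt_eqF// riemannian_det_gt0. Qed.

(** The products of partial derivatives form a matrix that transforms with the same J as the metric,
    so its contraction with the inverse metric is invariant. *)
Lemma grad_dot_chart_change (g : tensor2 A) u v c c' p : riemannian g ->
  C1_function u -> C1_function v -> chart_dom c p -> chart_dom c' p ->
  grad_dot (g c) (u \o of_coord c) (v \o of_coord c) (to_coord c p) =
  grad_dot (g c') (u \o of_coord c') (v \o of_coord c') (to_coord c' p).
Proof.
move=> rg cu cv cp c'p; have [_ _ /(_ c c' p cp c'p) /= gE] := rg.
pose H c := \matrix_(i, j) (partial i (u \o of_coord c) (to_coord c p) *
   partial j (v \o of_coord c) (to_coord c p)) : 'M[R]_3.
have HE : H c = 'J (to_coord c' \o of_coord c) (to_coord c p) *m H c' *m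
    ('J (to_coord c' \o of_coord c) (to_coord c p))^T.
  apply/matrixP => i j; rewrite !mxE (partial_chart_change i cu cp c'p)
    (partial_chart_change j cv cp c'p) big_distrr/=; apply: eq_bigr => k _.
  rewrite !mxE big_distrl big_distrl/=; apply: eq_bigr => l _; rewrite !mxE.
  by ring.
have E := trace_invmx_congr (riemannian_unit rg (chart_cod_to_coord cp)) gE HE.
transitivity (\sum_(i < 3) \sum_(j < 3) invmx (g c (to_coord c p)) i j * H c i j).
  by apply: eq_bigr => i _; apply: eq_bigr => j _; rewrite mxE mulrA.
rewrite E; apply: eq_bigr => i _; apply: eq_bigr => j _; by rewrite mxE mulrA.
Qed.

End Charts.

(** * Bump functions and the partition of unity *)

Section Bumps.
Context {R : realType}.
Implicit Types (t r : R) (x c : 'rV[R]_3) (U : set 'rV[R]_3).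

(** The square of the positive part is C^1, with derivative 2 max(0, t), which is all the regularity
    that the partition of unity requires. *)
Definition sqpos t : R := Num.max 0 t ^+ 2.

Lemma sqpos_gt0 t : (0 < sqpos t) = (0 < t).
Proof.
rewrite /sqpos; case: (ltrP 0 t) => t0; first by rewrite exprn_gt0.
by rewrite expr0n ltxx.
Qed.

Lemma sqpos_ge0 t : 0 <= sqpos t.
Proof. exact: sqr_ge0. Qed.

Lemma is_derive_sqpos t : is_derive t (1 : R) sqpos (2 * Num.max 0 t).
Proof.
case: (ltrgtP 0 t) => [t0|t0|<-].
- have n : \forall s \near t, (id * id) s = sqpos s :> R.
    near=> s; rewrite /sqpos max_r ?expr2// ltW//; near: s; exact: lt_nbhsr.
  apply: near_eq_is_derive n _.
  have di := is_derive_id t (1 : R).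
  have := is_deriveM di di.
  by rewrite -scalerDl [_ *: _]mulr1 -mulr2n mulr_natl.
- have n : \forall s \near t, (fun=> 0) s = sqpos s.
    near=> s; rewrite /sqpos max_l ?expr0n//.
    by rewrite ltW//; near: s; exact: lt_nbhsl.
  by rewrite mulr0; apply: near_eq_is_derive n _; exact: is_derive_cst.
(* At 0 the Caratheodory slope of [sqpos] is max(0, s), because max(0, s)^2 = max(0, s) s. *)
- rewrite mulr0; apply/derives_in_setTP/derives_inP; exists (Num.max 0); split.
  + move=> s _; rewrite /sqpos maxxx expr0n/= !subr0.
    by case: (leP 0 s) => s0; rewrite ?mul0r ?expr0n// expr2.
  + by rewrite maxxx.
  + have c : {for (0 : R), continuous (Num.max (0 : R))}.
      by apply: continuous_max; [exact: cst_continuous|exact: cvg_id].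
    by apply: cvg_within_filter; move: c; rewrite /prop_for/continuous_at maxxx.
Unshelve. all: by end_near. Qed.

(** A product over the coordinates is positive exactly inside a box, so the bump vanishes on the
    faces of the cube over which it is integrated. *)
Definition box_bump c r x : R :=
  sqpos (r ^+ 2 - (x 0 0 - c 0 0) ^+ 2) * sqpos (r ^+ 2 - (x 0 1 - c 0 1) ^+ 2)
  * sqpos (r ^+ 2 - (x 0 2%:R - c 0 2%:R) ^+ 2).

Lemma box_bump_ge0 c r x : 0 <= box_bump c r x.
Proof. by apply: mulr_ge0; [apply: mulr_ge0|]; exact: sqpos_ge0. Qed.

Lemma box_bump_center c r : 0 < r -> 0 < box_bump c r c.
Proof.
move=> r0; rewrite /box_bump !subrr expr0n subr0.
have h : 0 < sqpos (r ^+ 2) by rewrite sqpos_gt0 exprn_gt0.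
by apply: mulr_gt0 => //; exact: mulr_gt0.
Qed.

Lemma box_bump_neq0 c r x : 0 < r -> box_bump c r x != 0 ->
  forall i, `|x 0 i - c 0 i| < r.
Proof.
move=> r0.
have H (t : R) : sqpos (r ^+ 2 - t ^+ 2) != 0 -> `|t| < r.
  move=> h; have : 0 < sqpos (r ^+ 2 - t ^+ 2) by rewrite lt_neqAle eq_sym h sqpos_ge0.
  rewrite sqpos_gt0 subr_gt0 -(real_normK (num_real t)) ltr_pXn2r ?nnegrE//.
  exact: ltW.
move=> h; apply: ord3P; apply: H; apply: contraNneq h; rewrite /box_bump => ->.
- by rewrite !mul0r.
- by rewrite mulr0 mul0r.
- by rewrite mulr0.
Qed.

Lemma C1_box_bump U (phi : 'rV[R]_3 -> 'rV[R]_3) c r : open U ->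
  (forall j, C1_on U (fun y => phi y 0 j)) -> C1_on U (fun y => box_bump c r (phi y)).
Proof.
move=> oU cphi.
have K j : C1_on U (fun y => sqpos (r ^+ 2 - (phi y 0 j - c 0 j) ^+ 2)).
  have c1 : C1_on U (fun y => phi y 0 j - c 0 j).
    by apply: (C1_add oU) => //; exact: (C1_cst _ oU).1.
  have c2 := C1_opp oU (C1_mul oU c1 c1).
  have c3 := C1_add oU (C1_cst (r ^+ 2) oU).1 c2.
  have [] // := @C1_comp _ U sqpos (fun t => 2 * Num.max 0 t) _ oU c3.
    by move=> x _; exact: is_derive_sqpos.
  move=> x _; apply: continuous_mulf; first exact: cst_continuous.
  by apply: continuous_max; [exact: cst_continuous|exact: cvg_id].
exact: (C1_mul oU (C1_mul oU (K 0) (K 1)) (K 2%:R)).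
Qed.

End Bumps.

Section PartitionOfUnity.
Context {R : realType} {M : ptopologicalType} (A : smooth_atlas R M).
Hypotheses (compactM : compact [set: M]) (hausdorffM : hausdorff_space M).

Lemma C1_on_local U (u : 'rV[R]_3 -> R) :
  (forall x, U x -> exists V, V x /\ C1_on V u) -> C1_on U u.
Proof. by move=> H x /H[V [Vx cu]]; exact: cu. Qed.

Let c0 p := to_coord (chart_at A p) p.

Definition chart_bump (r : R) (p q : M) : R :=
  if `[< chart_dom (chart_at A p) q >]
  then box_bump (c0 p) r (to_coord (chart_at A p) q) else 0.

Lemma chart_bump_ge0 r p q : 0 <= chart_bump r p q.
Proof. by rewrite /chart_bump; case: ifP => // _; exact: box_bump_ge0. Qed.

Lemma chart_bump_neq0 r p q : 0 < r -> chart_bump r p q != 0 ->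
  chart_dom (chart_at A p) q /\ forall i, `|to_coord (chart_at A p) q 0 i - c0 p 0 i| < r.
Proof.
move=> r0; rewrite /chart_bump; case: asboolP; last by rewrite eqxx.
by move=> cq /(box_bump_neq0 r0).
Qed.

(** Two open sets cover the manifold: the chart domain, where the bump is explicit, and the
    complement of the image K of the closed cube, where it is zero. K is compact, and the Hausdorff
    property makes it closed. *)
Lemma C1_chart_bump r p : 0 < r -> cube (c0 p) r `<=` chart_cod (chart_at A p) ->
  C1_function A (chart_bump r p).
Proof.
move=> r0 rcod c; apply: C1_on_local => x cx.
set cp := chart_at A p.
have [qp|qp] := pselect (chart_dom cp (of_coord c x)).
  have Ox : overlap c cp x by apply/overlapP.
  exists (overlap c cp); split => //.
  have oO := @overlap_open _ _ A c cp.
  have cb := C1_box_bump (c0 p) r oO (@transition_C1 _ _ A c cp).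
  have [//|+ _] := C1_near_eq oO _ cb (v := chart_bump r p \o of_coord c); last exact.
  by move=> y /overlapP[_ cy]; rewrite /chart_bump /=; case: asboolP.
pose K := of_coord cp @` cube (c0 p) r.
have cK : closed K.
  apply: compact_closed => //; apply: continuous_compact; last exact: compact_cube.
  apply: continuous_in_subspaceT => y; rewrite inE => /rcod; exact: of_coord_cont.
have nK : ~ K (of_coord c x) by move=> [y /rcod/of_coordK[+ _] yx]; rewrite yx.
have oV : open (chart_cod c `&` of_coord c @^-1` (~` K)).
  rewrite openE => y [cy nKy]; apply: filterI; first exact: near_chart_cod.
  apply: (of_coord_cont cy); apply: open_nbhs_nbhs; split => //.
  exact: closed_openC.
exists (chart_cod c `&` of_coord c @^-1` (~` K)); split => //.
have [//|+ _] := C1_near_eq oV _ (C1_cst 0 oV).1 (v := chart_bump r p \o of_coord c); last exact.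
move=> y [cy nKy] /=; apply/eqP; rewrite eq_sym; apply/negP => /negP /(chart_bump_neq0 r0)[dq dr].
apply: nKy; exists (to_coord cp (of_coord c y)); last by rewrite to_coordK.
by move=> i; exact/ltW/dr.
Qed.

(** Each bump is positive at its own centre, so finitely many of them have a positive sum S, by
    which all are divided. Radii and functions are defined for every p, and the list [s] merely
    selects the finite subcover. *)
Lemma partition_of_unity : exists (s : seq M) (r : M -> R) (chi : M -> M -> R),
  [/\ forall p, 0 < r p /\ cube (to_coord (chart_at A p) p) (r p) `<=` chart_cod (chart_at A p),
      forall p, C1_function A (chi p),
      forall p q, chi p q != 0 -> chart_dom (chart_at A p) q /\
        forall i, `|to_coord (chart_at A p) q 0 i - to_coord (chart_at A p) p 0 i| < r p &
      forall q, \sum_(p <- s) chi p q = 1].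
Proof.
have Hr p : exists2 r : R, 0 < r & cube (c0 p) r `<=` chart_cod (chart_at A p).
  apply: open_cube; first exact: chart_cod_open.
  by apply: chart_cod_to_coord; exact: dom_chart_at.
pose r p := s2val (cid2 (Hr p)).
have r0 p : 0 < r p by rewrite /r; case: cid2.
have rc p : cube (c0 p) (r p) `<=` chart_cod (chart_at A p) by rewrite /r; case: cid2.
pose b p := chart_bump (r p) p.
have Cb p : C1_function A (b p) by exact: C1_chart_bump.
have bpp p : 0 < b p p.
  rewrite /b /chart_bump; case: asboolP => [_|[]]; last exact: dom_chart_at.
  exact: box_bump_center.
have ob p : open [set q | 0 < b p q].
  rewrite -[X in open X]/(b p @^-1` [set t | 0 < t]); apply: open_comp; last exact: open_gt.
  by move=> q _; exact: (C1_function_continuous (Cb p)).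
have := compactM; rewrite compact_cover => /(_ M setT (fun p => [set q | 0 < b p q])).
case=> [p _|q _|D _ DM]; [exact: ob|exact: (@bigcup_sup _ _ q setT (fun p => [set q | 0 < b p q]) I q (bpp q))|].
pose s := finmap.enum_fset D.
pose S q := \sum_(p <- s) b p q.
have S0 q : 0 < S q.
  have [p pD bpq] := DM q I.
  have ps : p \in s by exact: pD.
  rewrite /S (big_rem p ps)/=; apply: ltr_wpDr; last exact: bpq.
  by apply: sumr_ge0 => p' _; exact: chart_bump_ge0.
have CS : C1_function A S.
  move=> c; have [+ _] := C1_sum s (@chart_cod_open _ _ A c) (fun p => Cb p c); exact.
exists s, r, (fun p q => b p q * (S q)^-1); split.
- by move=> p; split; [exact: r0|exact: rc].
- move=> p c; apply: (C1_mul (@chart_cod_open _ _ A c) (Cb p c)).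
  apply: (C1_inv (@chart_cod_open _ _ A c) (CS c)) => x _; exact: lt0r_neq0 (S0 _).
- by move=> p q; rewrite mulf_eq0 negb_or => /andP[/(chart_bump_neq0 (r0 p))].
- by move=> q; rewrite -mulr_suml; exact: mulfV (lt0r_neq0 (S0 q)).
Qed.

End PartitionOfUnity.

(** * Integrals on the manifold as sums of integrals over cubes *)

Section IntegralOnManifold.
Context {R : realType} {M : ptopologicalType} (A : smooth_atlas R M).
Hypotheses (compactM : compact [set: M]) (hausdorffM : hausdorff_space M).
Variables (mu : {measure set (borel M) -> \bar R}).
Local Notation lebesgue3 := ((@lebesgue_measure R \x @lebesgue_measure R) \x @lebesgue_measure R)%E.

Lemma open_measurable_borel (B : set M) : open B -> measurable (B : set (borel M)).
Proof. by move=> oB; exact: sub_sigma_algebra. Qed.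

Lemma closed_measurable_borel (B : set M) : closed B -> measurable (B : set (borel M)).
Proof.
move=> cB; rewrite -(setCK B); apply: measurableC; apply: open_measurable_borel.
exact: closed_openC.
Qed.

Lemma continuous_measurable_borel (h : M -> R) : continuous h ->
  measurable_fun [set: borel M] h.
Proof.
move=> ch; apply: (measurability _ (RGenOpens.measurableE R)).
move=> _ [_ [a [b ->] <-]]; rewrite setTI; apply: open_measurable_borel.
by apply: open_comp; [move=> x _; exact: ch|exact: interval_open].
Qed.

Lemma continuous_bounded (h : M -> R) : continuous h -> exists C : R, forall p, `|h p| <= C.
Proof.
move=> ch; have ch' : {within [set: M], continuous h} by exact: continuous_subspaceT.
have /compact_bounded [C [_ HC]] := continuous_compact ch' compactM.
exists (`|C| + 1) => p; apply: (HC (`|C| + 1)); last by exists p.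
by rewrite (le_lt_trans (ler_norm _))// ltrDl.
Qed.

Lemma integrable_continuous (h : M -> R) : mu setT \is a fin_num -> continuous h ->
  mu.-integrable setT (EFin \o h).
Proof.
move=> mfin ch; apply: measurable_bounded_integrable => //.
- by rewrite -ge0_fin_numE.
- exact: continuous_measurable_borel.
- have [C HC] := continuous_bounded ch.
  exists C; split; first by rewrite num_real.
  by move=> D CD p _; exact: le_trans (HC p) (ltW CD).
Qed.

Lemma Rintegral_sum_continuous (T : Type) (s : seq T) (h : T -> M -> R) :
  mu setT \is a fin_num -> (forall i, continuous (h i)) ->
  \int[mu]_(p in [set: borel M]) (\sum_(i <- s) h i p) =
  \sum_(i <- s) \int[mu]_(p in [set: borel M]) h i p.
Proof.
move=> mfin ch; elim: s => [|i s IH].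
  rewrite big_nil; under eq_Rintegral do rewrite big_nil.
  by rewrite Rintegral_cst// mul0r.
rewrite big_cons -IH -RintegralD//; last 2 first.
- exact: integrable_continuous.
- by apply: integrable_continuous => // p; exact: continuous_sumf (fun i => ch i p).
by apply: eq_Rintegral => p _; rewrite big_cons.
Qed.

Variable (g : tensor2 A).
Hypotheses (rg : riemannian g) (rmu : riemannian_measure g mu)
  (cg : forall c i j, C1_on (chart_cod c) (fun x => g c x i j)).

(** The integrand vanishes off the image K of the cube, a closed and hence Borel set inside the
    chart domain. There the defining property of the Riemannian measure applies, and integrals pull
    back along [of_coord c]. *)
Lemma Rintegral_chart_cube (c : chart A) x0 r (h : M -> R) :
  cube x0 r `<=` chart_cod c -> continuous h ->
  (forall q, h q != 0 -> chart_dom c q /\ cube x0 r (to_coord c q)) ->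
  \int[mu]_(p in [set: borel M]) h p =
  \int[lebesgue3]_(z in vec3 @^-1` (cube x0 r))
    (h (of_coord c (vec3 z)) * Num.sqrt (\det (g c (vec3 z)))).
Proof.
move=> cc ch hK.
pose K := of_coord c @` cube x0 r.
have cK : closed K.
  apply: compact_closed => //; apply: continuous_compact; last exact: compact_cube.
  apply: continuous_in_subspaceT => y; rewrite inE => /cc; exact: of_coord_cont.
have mK : measurable (K : set (borel M)) by exact: closed_measurable_borel.
have KE q : K q -> chart_dom c q /\ cube x0 r (to_coord c q).
  by move=> [y cy <-]; have [d ->] := of_coordK (cc _ cy).
have -> : \int[mu]_(p in [set: borel M]) h p = \int[mu]_(p in (K : set (borel M))) h p.
  rewrite [RHS]Rintegral_mkcond; apply: eq_Rintegral => p _; rewrite patchE.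
  case: ifPn => // /negP pK; apply/eqP; apply: contrapT => /negP /hK[dp cp].
  by apply: pK; rewrite inE; exists (to_coord c p) => //; rewrite to_coordK.
have mD := @measurable_cube R x0 r.
have oU := @chart_cod_open _ _ A c.
have mU := open_measurable_vec3 oU.
have [cs _] := sqrt_det_C1 oU (@cg c) (fun x cx => riemannian_sym rg cx)
  (fun x cx => riemannian_det_gt0 rg cx).
have H := @Rintegral_density_pullback _ _ (borel M) _ R mu lebesgue3
  (of_coord c \o vec3) K _ (fun z => Num.sqrt (\det (g c (vec3 z)))) mK mD.
apply: H => //.
- have := @measurable_continuous_vec3_borel R M _ (of_coord c) oU (fun x cx => of_coord_cont cx).
  by apply: measurable_funS => //; move=> z; exact: cc.
- by move=> z cz; exists (vec3 z).
- have := measurable_continuous_vec3 oU (fun x cx => C1_continuous cs cx).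
  by apply: measurable_funS => //; move=> z; exact: cc.
(* The definition of the Riemannian measure uses the image of B under [to_coord c], the pullback
   uses the preimage under [of_coord c]; for B inside K they agree. *)
- move=> B mB BK; rewrite (@rmu c B mB (fun q Bq => (KE q (BK q Bq)).1)).
  congr (integral _ _ _); apply/seteqP; split=> z /=.
    move=> [q Bq qz]; have [dq cq] := KE q (BK q Bq).
    by rewrite -qz to_coordK.
  move=> [cz Bz]; have [_ E] := of_coordK (cc _ cz).
  by exists (of_coord c (vec3 z)).
- apply: measurable_funTS; exact: continuous_measurable_borel.
Qed.

Lemma Rintegral_partition (s : seq M) (r : M -> R) (chi : M -> M -> R) (h : M -> R) :
  (forall p, 0 < r p /\ cube (to_coord (chart_at A p) p) (r p) `<=` chart_cod (chart_at A p)) ->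
  (forall p, C1_function A (chi p)) ->
  (forall p q, chi p q != 0 -> chart_dom (chart_at A p) q /\
     forall i, `|to_coord (chart_at A p) q 0 i - to_coord (chart_at A p) p 0 i| < r p) ->
  (forall q, \sum_(p <- s) chi p q = 1) ->
  mu setT \is a fin_num -> continuous h ->
  \int[mu]_(p in [set: borel M]) h p =
  \sum_(p <- s) \int[lebesgue3]_(z in vec3 @^-1` (cube (to_coord (chart_at A p) p) (r p)))
    (chi p (of_coord (chart_at A p) (vec3 z)) * h (of_coord (chart_at A p) (vec3 z))
     * Num.sqrt (\det (g (chart_at A p) (vec3 z)))).
Proof.
move=> Hr Hc Hs H1 mfin ch.
have cc p : continuous (fun q => chi p q * h q).
  by move=> q; apply: continuous_mulf; [exact: (C1_function_continuous (Hc p))|exact: ch].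
transitivity (\int[mu]_(p in [set: borel M]) (\sum_(i <- s) chi i p * h p)).
  by apply: eq_Rintegral => p _; rewrite -mulr_suml H1 mul1r.
rewrite (@Rintegral_sum_continuous _ s (fun i p => chi i p * h p))//.
apply: eq_bigr => p _; apply: (@Rintegral_chart_cube _ _ _ (fun q => chi p q * h q)).
- by have [] := Hr p.
- exact: cc.
- move=> q; rewrite mulf_eq0 negb_or => /andP[/Hs[dq cq] _]; split => // i.
  exact: ltW.
Qed.

End IntegralOnManifold.

(** * The Ricci flow *)

Section ProperFilters.
Context {R : realType}.
Implicit Types (I : set R) (t c : R).

Lemma within_dnbhs_proper_right I t c : t < c -> (forall s, t < s < c -> I s) ->
  ProperFilter (within I t^').
Proof.
move=> tc Ic; split; last exact: within_filter.
rewrite /within/= => n0.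
have : \forall s \near t^'+, False.
  have n1 : \forall s \near t^'+, s < c by exact: nbhs_right_lt.
  have n2 : \forall s \near t^'+, t < s by exact: nbhs_right_gt.
  have n3 : \forall s \near t^'+, s != t -> I s -> False.
    by apply: cvg_within; exact: n0.
  near=> s; have ts : t < s by near: s.
  have H : s != t -> I s -> False by near: s.
  by apply: H; [rewrite gt_eqF|apply: Ic; rewrite ts/=; near: s].
by move=> /filter_ex[].
Unshelve. all: by end_near. Qed.

Lemma within_dnbhs_proper_left I t c : c < t -> (forall s, c < s < t -> I s) ->
  ProperFilter (within I t^').
Proof.
move=> ct Ic; split; last exact: within_filter.
rewrite /within/= => n0.
have : \forall s \near t^'-, False.
  have n1 : \forall s \near t^'-, c < s by exact: nbhs_left_gt.
  have n2 : \forall s \near t^'-, s < t by exact: nbhs_left_lt.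
  have n3 : \forall s \near t^'-, s != t -> I s -> False.
    by apply: cvg_within; exact: n0.
  near=> s; have st : s < t by near: s.
  have H : s != t -> I s -> False by near: s.
  by apply: H; [rewrite lt_eqF|apply: Ic; rewrite st andbT; near: s].
by move=> /filter_ex[].
Unshelve. all: by end_near. Qed.

(** Every flow time, 0 included, is followed by later ones, so derivatives relative to the flow
    times are unique. *)
Lemma flow_times_proper (T : \bar R) b : flow_times T b ->
  ProperFilter (within (flow_times T) b^').
Proof.
move=> [b0 bT].
have [c bc cT] : exists2 c : R, b < c & (c%:E <= T)%E.
  case: T bT => [T| |]//; first by rewrite lte_fin => bT; exists T.
  by move=> _; exists (b + 1); rewrite ?ltrDl// leey.
apply: (within_dnbhs_proper_right bc) => s /andP[bs sc]; split.
  exact: le_trans b0 (ltW bs).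
by apply: lt_le_trans cT; rewrite lte_fin.
Qed.

(** Points below [b] are approached from the right and [b] from the left. Through this lemma the
    assumption 0 < bstar makes the time derivative of f unique. *)
Lemma itvcc_proper (a b t : R) : a < b -> t \in `[a, b] ->
  ProperFilter (within `[a, b] t^').
Proof.
move=> ab; rewrite in_itv/= => /andP[at_ tb].
have [tb'|bt] := ltP t b.
  apply: (within_dnbhs_proper_right tb') => s /andP[ts sb] /=.
  by rewrite in_itv/= (ltW sb) (le_trans at_ (ltW ts)).
have a_t : a < t by exact: lt_le_trans ab bt.
apply: (within_dnbhs_proper_left a_t) => s /andP[as_ st] /=.
by rewrite in_itv/= (ltW as_) (le_trans (ltW st) tb).
Qed.

End ProperFilters.

(** * Joint continuity of metric quantities and time reversal *)

Section JointlyContinuousMatrices.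
Context {R : realType}.
Implicit Types (I : set R) (U : set 'rV[R]_3).
Variables (I : set R) (U : set 'rV[R]_3) (G : R -> 'rV[R]_3 -> 'M[R]_3).
Hypothesis cG : forall i j, jointly_continuous I U (fun s x => G s x i j).

Lemma jointly_continuousN F : jointly_continuous I U F ->
  jointly_continuous I U (fun s x => - F s x).
Proof.
move=> cF; apply: (jointly_continuous_comp (phi := -%R) cF) => s x _ _.
exact: opp_continuous.
Qed.

Lemma jointly_continuous_cofactor3 i j :
  jointly_continuous I U (fun s x => cofactor3 (G s x) i j).
Proof.
apply: jointly_continuousD; first exact: jointly_continuousM.
by apply: jointly_continuousN; exact: jointly_continuousM.
Qed.

Lemma jointly_continuous_det : jointly_continuous I U (fun s x => \det (G s x)).
Proof.
have K a b c d e f : jointly_continuous I U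
    (fun s x => G s x a b * (G s x c d * G s x e f - G s x c f * G s x e d)).
  apply: jointly_continuousM => //; apply: jointly_continuousD; first exact: jointly_continuousM.
  by apply: jointly_continuousN; exact: jointly_continuousM.
have := jointly_continuousD (jointly_continuousD (K 0 0 1 1 2%:R 2%:R)
  (jointly_continuousN (K 0 1 1 0 2%:R 2%:R))) (K 0 2%:R 1 0 2%:R 1).
by apply: jointly_continuous_eq => s x _ _; rewrite det3E.
Qed.

Hypothesis pG : forall s x, I s -> U x -> 0 < \det (G s x).

Lemma jointly_continuous_sqrt_det :
  jointly_continuous I U (fun s x => Num.sqrt (\det (G s x))).
Proof.
apply: (jointly_continuous_comp (phi := Num.sqrt) jointly_continuous_det) => s x _ _.
exact: sqrt_continuous.
Qed.

Lemma jointly_continuous_invmx i j : jointly_continuous I U (fun s x => invmx (G s x) i j).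
Proof.
have c : jointly_continuous I U (fun s x => (\det (G s x))^-1 * cofactor3 (G s x) j i).
  apply: jointly_continuousM; last exact: jointly_continuous_cofactor3.
  apply: (jointly_continuous_comp (phi := fun r => r^-1) jointly_continuous_det) => s x Is Ux.
  by apply: inv_continuous; rewrite gt_eqF// pG.
by apply: jointly_continuous_eq c => s x Is Ux; rewrite invmx3E// gt_eqF// pG.
Qed.

End JointlyContinuousMatrices.

Lemma jointly_continuous_reverse {R : realType} (I J : set R) (U : set 'rV[R]_3)
  (b : R) (F : R -> 'rV[R]_3 -> R) : (forall s, J s -> I (b - s)) ->
  jointly_continuous I U F -> jointly_continuous J U (fun s => F (b - s)).
Proof.
move=> JI /jointly_continuousP cF; apply/jointly_continuousP => s x Js Ux.
have c : (b - q.1, q.2) @[q --> within (J `*` U) (nbhs (s, x))] -->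
    within (I `*` U) (nbhs (b - s, x)).
  have c' : (b - q.1, q.2) @[q --> (s, x)] --> (b - s, x).
    apply: (@cvg_pair _ _ _ (nbhs (s, x)) (nbhs (b - s)) (nbhs x)); last exact: cvg_snd.
    by apply: cvgB; [exact: cvg_cst|exact: cvg_fst].
  move=> P wP; have := c' _ wP; rewrite /within /nbhs/=; apply: filterS => q H [Jq Uq].
  by apply: H; split => //=; exact: JI.
exact: (cvg_comp _ _ c (cF _ _ (JI s Js) Ux)).
Qed.

(** * Curvature along the flow *)

Section RicciFlow.
Context {R : realType} {M : ptopologicalType} (A : smooth_atlas R M).
Variables (T : \bar R) (g : R -> tensor2 A) (mu : R -> {measure set (borel M) -> \bar R}).
Hypothesis flow : normalized_ricci_flow T g mu.

Let m b := mean_scalar_curvature (g b) (mu b).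

Lemma flow_riemannian b : flow_times T b -> riemannian (g b).
Proof. by have [[+ _] _ _] := flow; exact. Qed.

Lemma flow_smooth c i j : smooth_family (flow_times T) (chart_cod c) (fun s x => g s c x i j).
Proof. by have [[_ +] _ _] := flow; exact. Qed.

Lemma flow_ricciE b c x i j : flow_times T b -> chart_cod c x ->
  ricci (g b c) i j x = - 2^-1 * (derive_in (flow_times T) (fun s => g s c x i j) b
    - 2 / 3 * m b * g b c x i j).
Proof.
move=> Tb cx; have [_ _ /(_ b c x i j Tb cx) d] := flow.
have Pr := flow_times_proper Tb.
rewrite (derives_in_derive_in Pr d) -/(m b); by field.
Qed.

(* By the flow equation Ric is a combination of the metric and of its time
   derivative, which transform as tensors and are continuous; so neither the
   tensoriality nor the continuity of Ric needs third derivatives of transition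
   maps. *)
Lemma ricci_chart_change b c c' p : flow_times T b -> chart_dom c p -> chart_dom c' p ->
  let J := 'J (to_coord c' \o of_coord c) (to_coord c p) in
  \matrix_(i, j) ricci (g b c) i j (to_coord c p) =
  J *m (\matrix_(i, j) ricci (g b c') i j (to_coord c' p)) *m J^T.
Proof.
move=> Tb cp c'p J.
have cx := chart_cod_to_coord cp; have c'x := chart_cod_to_coord c'p.
have gE s : flow_times T s -> g s c (to_coord c p) = J *m g s c' (to_coord c' p) *m J^T.
  by move=> /flow_riemannian[_ _]; apply.
pose D c x : 'M[R]_3 := \matrix_(i, j) (- 2 * ricci (g b c) i j x + 2 / 3 * m b * g b c x i j).
(* J does not depend on time and the transformation law of g holds at all flow times; both sides are
   thus derivatives of one function and agree by uniqueness. *)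
have DE : D c (to_coord c p) = J *m D c' (to_coord c' p) *m J^T.
  apply/matrixP => i j; apply: (derives_in_unique (flow_times_proper Tb)).
    by have [_ _ /(_ b c _ i j Tb cx) d] := flow; rewrite mxE; exact: d.
  have E : {in flow_times T, (fun s => \sum_(l < 3) (\sum_(k < 3) J i k * g s c' (to_coord c' p) k l) * J j l)
      =1 (fun s => g s c (to_coord c p) i j)}.
    move=> s; rewrite inE => Ts; rewrite gE// [RHS]mxE; apply: eq_bigr => l _.
    by rewrite !mxE.
  apply: (derives_in_ext Tb E).
  rewrite [X in derives_in _ _ _ X](_ : _ = \sum_(l < 3)
     ((\sum_(k < 3) (0 * g b c' (to_coord c' p) k l + J i k * D c' (to_coord c' p) k l)) * J j l
      + (\sum_(k < 3) J i k * g b c' (to_coord c' p) k l) * 0)); last first.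
    rewrite mxE; apply: eq_bigr => l _; rewrite mulr0 addr0 mxE [J^T _ _]mxE.
    by congr (_ * _); apply: eq_bigr => k _; rewrite mul0r add0r.
  apply: derives_in_sum => l; apply: derives_inM; last exact: derives_in_cst.
  apply: derives_in_sum => k; apply: derives_inM; first exact: derives_in_cst.
  by have [_ _ /(_ b c' _ k l Tb c'x) d] := flow; rewrite mxE; exact: d.
have RE c0 x : \matrix_(i, j) ricci (g b c0) i j x =
    (- 2^-1) *: D c0 x + (3^-1 * m b) *: g b c0 x.
  by apply/matrixP => i j; rewrite !mxE; field.
by rewrite !RE DE gE// mulmxDr mulmxDl -!scalemxAr -!scalemxAl.
Qed.

Lemma scal_chart_change b c c' p : flow_times T b -> chart_dom c p -> chart_dom c' p ->
  scal (g b c) (to_coord c p) = scal (g b c') (to_coord c' p).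
Proof.
move=> Tb cp c'p.
have [_ _ /(_ c c' p cp c'p) /= gE] := flow_riemannian Tb.
have E := trace_invmx_congr (riemannian_unit (flow_riemannian Tb) (chart_cod_to_coord cp)) gE
  (ricci_chart_change Tb cp c'p).
rewrite /scal; transitivity (\sum_(i < 3) \sum_(j < 3) invmx (g b c (to_coord c p)) i j *
    (\matrix_(i, j) ricci (g b c) i j (to_coord c p)) i j).
  by apply: eq_bigr => i _; apply: eq_bigr => j _; rewrite mxE.
by rewrite E; apply: eq_bigr => i _; apply: eq_bigr => j _; rewrite mxE.
Qed.

Lemma flow_C1 b c i j : flow_times T b -> C1_on (chart_cod c) (fun x => g b c x i j).
Proof.
by move=> Tb; exact: (smooth_family_C1 (@chart_cod_open _ _ A c) Tb (flow_smooth c i j)).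
Qed.

Lemma continuous_scal b c x : flow_times T b -> chart_cod c x -> {for x, continuous (scal (g b c))}.
Proof.
move=> Tb cx.
have oU := @chart_cod_open _ _ A c.
apply: (@continuous_sumf _ _ _ _ (fun i y => \sum_(j < 3) invmx (g b c y) i j * ricci (g b c) i j y)) => i.
apply: (@continuous_sumf _ _ _ _ (fun j y => invmx (g b c y) i j * ricci (g b c) i j y)) => j.
apply: continuous_mulf.
  have := @C1_invmx R (chart_cod c) (g b c) oU (fun i j => @flow_C1 b c i j Tb)
    (fun x cx => riemannian_det_gt0 (flow_riemannian Tb) cx) i j.
  by move=> /(C1_continuous) /(_ cx).
pose h y := - 2^-1 * (derive_in (flow_times T) (fun s => g s c y i j) b - 2 / 3 * m b * g b c y i j).
apply: (@near_eq_continuous _ _ h).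
  by apply: filterS (near_chart_cod cx) => y cy; rewrite /h (flow_ricciE _ _ Tb cy).
apply: continuous_mulf; first exact: cst_continuous.
apply: continuous_addf.
  exact: (jointly_continuous_slice oU (smooth_family_derive_continuous (flow_smooth c i j)) Tb cx).
apply: (@continuous_compf _ _ _ -%R); last exact: opp_continuous.
apply: continuous_mulf; first exact: cst_continuous.
exact: (C1_continuous (@flow_C1 b c i j Tb) cx).
Qed.

Lemma continuous_scalar_curvature b : flow_times T b -> continuous (scalar_curvature (g b)).
Proof.
move=> Tb p; have cp := dom_chart_at A p.
apply: (continuous_from_chart cp).
have cx := chart_cod_to_coord cp.
apply: near_eq_continuous (continuous_scal Tb cx).
apply: filterS (near_chart_cod cx) => y cy.
have [dy yE] := of_coordK cy.
rewrite /scalar_curvature /= -{1}yE; apply: scal_chart_change => //.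
exact: dom_chart_at.
Qed.

Lemma scalar_curvatureE b c p : flow_times T b -> chart_dom c p ->
  scalar_curvature (g b) p = scal (g b c) (to_coord c p).
Proof. by move=> Tb cp; apply: scal_chart_change => //; exact: dom_chart_at. Qed.

End RicciFlow.

(** * The divergence theorem *)

Section DivergenceTheorem.
Context {R : realType} {M : ptopologicalType} (A : smooth_atlas R M).
Hypotheses (compactM : compact [set: M]) (hausdorffM : hausdorff_space M).
Variables (mu : {measure set (borel M) -> \bar R}) (g : tensor2 A).
Hypotheses (mu_fin : mu setT \is a fin_num) (rg : riemannian g)
  (rmu : riemannian_measure g mu)
  (cg : forall c i j, C1_on (chart_cod c) (fun x => g c x i j)).
Local Notation lebesgue3 := ((@lebesgue_measure R \x @lebesgue_measure R) \x @lebesgue_measure R)%E.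

Definition gradient_dot (u v : M -> R) (p : M) : R :=
  let c := chart_at A p in grad_dot (g c) (u \o of_coord c) (v \o of_coord c) (to_coord c p).

Lemma gradient_dotE u v c x : C1_function A u -> C1_function A v -> chart_cod c x ->
  gradient_dot u v (of_coord c x) = grad_dot (g c) (u \o of_coord c) (v \o of_coord c) x.
Proof.
move=> cu cv cx; have [dx xE] := of_coordK cx.
rewrite -[in RHS]xE; apply: grad_dot_chart_change => //; exact: dom_chart_at.
Qed.

Lemma continuous_grad_dot u v c x : C1_function A u -> C1_function A v -> chart_cod c x ->
  {for x, continuous (grad_dot (g c) (u \o of_coord c) (v \o of_coord c))}.
Proof.
move=> cu cv cx; have oU := @chart_cod_open _ _ A c.
have ci i j := @C1_invmx R (chart_cod c) (g c) oU (@cg c)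
    (fun x cx => riemannian_det_gt0 rg cx) i j.
apply: (@continuous_sumf _ _ _ _ (fun i y => \sum_(j < 3) invmx (g c y) i j *
  partial i (u \o of_coord c) y * partial j (v \o of_coord c) y)) => i.
apply: (@continuous_sumf _ _ _ _ (fun j y => invmx (g c y) i j *
  partial i (u \o of_coord c) y * partial j (v \o of_coord c) y)) => j.
apply: continuous_mulf; last exact: (C1_partial_continuous (cv c) cx).
apply: continuous_mulf; last exact: (C1_partial_continuous (cu c) cx).
exact: (C1_continuous (ci i j) cx).
Qed.

Lemma continuous_gradient_dot u v : C1_function A u -> C1_function A v ->
  continuous (gradient_dot u v).
Proof.
move=> cu cv p; have cp := dom_chart_at A p.
apply: (continuous_from_chart cp); have cx := chart_cod_to_coord cp.
apply: near_eq_continuous (continuous_grad_dot cu cv cx).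
by apply: filterS (near_chart_cod cx) => y cy; rewrite -gradient_dotE.
Qed.

Variables (s : seq M) (r : M -> R) (chi : M -> M -> R).
Hypotheses
  (r_cube : forall p, 0 < r p /\ cube (to_coord (chart_at A p) p) (r p) `<=` chart_cod (chart_at A p))
  (chi_C1 : forall p, C1_function A (chi p))
  (chi_supp : forall p q, chi p q != 0 -> chart_dom (chart_at A p) q /\
     forall i, `|to_coord (chart_at A p) q 0 i - to_coord (chart_at A p) p 0 i| < r p)
  (chi_sum1 : forall q, \sum_(p <- s) chi p q = 1).
Variables (f : M -> R) (phi phi' : R -> R).
Hypotheses (f_C1 : C1_function A f)
  (df_C1 : forall (c : chart A) j, C1_on (chart_cod c) (partial j (f \o of_coord c)))
  (dphi : forall y, is_derive y (1 : R) phi (phi' y)) (cphi' : continuous phi').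

Local Notation piece p := (vec3 @^-1` (cube (to_coord (chart_at A p) p) (r p))).

Lemma continuous_phi_f : continuous (fun q => phi (f q)).
Proof.
move=> q; apply: continuous_compf; first exact: (C1_function_continuous f_C1).
have [d _] := dphi (f q); apply: differentiable_continuous.
exact/derivable1_diffP.
Qed.

(** A gradient vanishes where the function is zero on a neighbourhood. Since K is closed, [chi p] is
    zero near every point outside K, and the derivatives are taken in the chart at that point. *)
Lemma gradient_dot_supp p q : gradient_dot (chi p) f q != 0 ->
  chart_dom (chart_at A p) q /\ cube (to_coord (chart_at A p) p) (r p) (to_coord (chart_at A p) q).
Proof.
move=> ne; set c := chart_at A p; set K := of_coord c @` cube (to_coord c p) (r p).
have [_ rc] := r_cube p.
have cK : closed K.
  apply: compact_closed => //; apply: continuous_compact; last exact: compact_cube.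
  apply: continuous_in_subspaceT => y; rewrite inE => /rc; exact: of_coord_cont.
have [[y cy <-]|nK] := pselect (K q).
  by have [d ->] := of_coordK (rc _ cy).
exfalso; move/negP : ne; apply; apply/eqP.
have cq := dom_chart_at A q; have cx := chart_cod_to_coord cq.
have n0 : \forall x \near to_coord (chart_at A q) q, (fun=> 0) x = (chi p \o of_coord (chart_at A q)) x.
  have nq : nbhs (of_coord (chart_at A q) (to_coord (chart_at A q) q)) (~` K).
    rewrite to_coordK//; apply: open_nbhs_nbhs; split => //; exact: closed_openC.
  have nn : \forall x \near to_coord (chart_at A q) q, (~` K) (of_coord (chart_at A q) x).
    exact: (of_coord_cont cx nq).
  apply: filterS nn => x nKx /=; apply/eqP; rewrite eq_sym.
  apply/negP => /negP /chi_supp[dx rx]; apply: nKx.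
  exists (to_coord c (of_coord (chart_at A q) x)); last by rewrite to_coordK.
  by move=> i; exact/ltW/rx.
rewrite /gradient_dot /grad_dot; apply: big1 => i _; apply: big1 => j _.
rewrite /partial -(near_eq_derive _ n0).
have -> : 'D_(delta_mx 0 i) (fun=> 0) (to_coord (chart_at A q) q) = 0 :> R by exact: derive_cst.
by rewrite mulr0 mul0r.
Qed.

(** The product is linear in its first argument, and the sum of the partition functions is
    constant. *)
Lemma gradient_dot_partition q : \sum_(p <- s) gradient_dot (chi p) f q = 0.
Proof.
set c := chart_at A q; set x := to_coord c q.
have cx : chart_cod c x by exact/chart_cod_to_coord/dom_chart_at.
rewrite /gradient_dot -/c -/x /grad_dot exchange_big/=; apply: big1 => i _.
rewrite exchange_big/=; apply: big1 => j _.
rewrite -mulr_suml -mulr_sumr.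
have oU := @chart_cod_open _ _ A c.
have [_ <-//] := C1_sum s oU (fun p => @chi_C1 p c).
rewrite (_ : (fun y => \sum_(p <- s) (chi p \o of_coord c) y) = (fun=> 1)).
  by have [_ ->//] := C1_cst 1 oU; rewrite mulr0 mul0r.
by apply/funext => y; rewrite -[RHS](chi_sum1 (of_coord c y)).
Qed.

(** Apply the coordinate divergence to psi = chi_p phi(f): the total integral is zero, as chi_p
    vanishes on the faces, and div (psi grad f) is the left integrand, taken against the volume
    density, plus phi(f) <grad chi_p, grad f>. That last term is supported in the cube and is
    rewritten as an integral over the manifold, where the pieces can be added. *)
Lemma integral_piece_divergence p : let c := chart_at A p in
  \int[lebesgue3]_(z in piece p)
    (chi p (of_coord c (vec3 z)) *
     (phi' (f (of_coord c (vec3 z))) * grad_sq (g c) (f \o of_coord c) (vec3 z)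
      + phi (f (of_coord c (vec3 z))) * laplacian (g c) (f \o of_coord c) (vec3 z))
     * Num.sqrt (\det (g c (vec3 z)))) =
  - \int[mu]_(q in [set: borel M]) (phi (f q) * gradient_dot (chi p) f q).
Proof.
move=> c; have [r0 rc] := r_cube p.
have oU := @chart_cod_open _ _ A c.
have sg x : chart_cod c x -> (g c x)^T = g c x by move=> cx; exact: riemannian_sym.
have pg x : chart_cod c x -> 0 < \det (g c x) by move=> cx; exact: riemannian_det_gt0.
have [cs _] := sqrt_det_C1 oU (@cg c) sg pg.
have [cpf dpf] : C1_on (chart_cod c) (fun x => phi ((f \o of_coord c) x)) /\
    forall x i, chart_cod c x -> partial i (fun x => phi ((f \o of_coord c) x)) x =
      phi' ((f \o of_coord c) x) * partial i (f \o of_coord c) x.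
  by apply: (C1_comp oU (@f_C1 c)) => x _; exact: cphi'.
have [cpsi dpsi] := C1M oU (@chi_C1 p c) cpf.
set psi := (fun y => _) in cpsi dpsi.
pose flux := weighted_flux (g c) (f \o of_coord c) psi.
have cflux i : C1_on (chart_cod c) (flux i).
  exact: (C1_weighted_flux oU (@cg c) sg pg (@df_C1 c) cpsi).
pose G1 x := phi (f (of_coord c x)) * grad_dot (g c) (chi p \o of_coord c) (f \o of_coord c) x
  * Num.sqrt (\det (g c x)).
have cG1 x : chart_cod c x -> {for x, continuous G1}.
  move=> cx; apply: continuous_mulf; last exact: (C1_continuous cs cx).
  apply: continuous_mulf; first exact: (C1_continuous cpf cx).
  exact: continuous_grad_dot.
have mD := @measurable_cube R (to_coord c p) (r p).
have iG1 : lebesgue3.-integrable (piece p) (EFin \o (G1 \o vec3)) by exact: integrable_cube rc.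
have iF i : lebesgue3.-integrable (piece p) (EFin \o (partial i (flux i) \o vec3)).
  apply: (integrable_cube oU _ rc) => x cx; exact: (C1_partial_continuous (cflux i) cx).
have F0 i : \int[lebesgue3]_(z in piece p) partial i (flux i) (vec3 z) = 0.
  have face x : cube (to_coord (chart_at A p) p) (r p) x ->
      `|x 0 i - to_coord (chart_at A p) p 0 i| = r p -> flux i x = 0.
    move=> cubex xi; rewrite /flux /weighted_flux /psi.
    have -> : (chi p \o of_coord c) x = 0.
      apply/eqP; apply: contrapT => /negP /chi_supp[_ /(_ i)].
      (* The support condition is a strict inequality, so it excludes points on a face, where the
         distance equals the radius. *)
      by rewrite (of_coordK (rc _ cubex)).2 xi ltxx.
    by rewrite !mul0r.
  by rewrite /Rintegral (integral_partial_cube oU (cflux i) rc r0 face).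
rewrite [X in - X](Rintegral_chart_cube hausdorffM rg rmu cg rc); last 2 first.
- move=> q; apply: continuous_mulf; first exact: continuous_phi_f.
  exact: continuous_gradient_dot.
- by move=> q; rewrite mulf_eq0 negb_or => /andP[_ /gradient_dot_supp].
rewrite (_ : \int[lebesgue3]_(z in _) (phi (f _) * _ * _) = \int[lebesgue3]_(z in piece p) G1 (vec3 z)); last first.
  apply: eq_Rintegral => z; rewrite inE => Dz; rewrite /G1 gradient_dotE//.
  exact: rc.
transitivity (\int[lebesgue3]_(z in piece p)
   ((partial 0 (flux 0) (vec3 z) + (partial 1 (flux 1) (vec3 z) + partial 2%:R (flux 2%:R) (vec3 z)))
    - G1 (vec3 z))).
  apply: eq_Rintegral => z; rewrite inE => Dz; have cz := rc _ Dz.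
  have := divergence_weighted_flux oU (@cg c) sg pg (@df_C1 c) cpsi cz.
  rewrite sum3E addrA => ->; rewrite /G1.
  have -> : grad_dot (g c) psi (f \o of_coord c) (vec3 z) =
     phi (f (of_coord c (vec3 z))) * grad_dot (g c) (chi p \o of_coord c) (f \o of_coord c) (vec3 z)
     + chi p (of_coord c (vec3 z)) * phi' (f (of_coord c (vec3 z))) * grad_sq (g c) (f \o of_coord c) (vec3 z).
    rewrite /grad_dot /grad_sq !big_distrr/= -big_split/=; apply: eq_bigr => i _.
    rewrite !big_distrr/= -big_split/=; apply: eq_bigr => j _.
    rewrite dpsi// dpf//=; ring.
  by rewrite /psi /=; ring.
have iF12 := integrableD mD (iF 1) (iF 2%:R).
have iF012 := integrableD mD (iF 0) iF12.
rewrite (RintegralB mD iF012 iG1) (RintegralD mD (iF 0) iF12) (RintegralD mD (iF 1) (iF 2%:R)).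
by rewrite !F0 !addr0 sub0r.
Qed.

(** The integral of div (phi(f) grad f), kept as a sum over the pieces because the Laplacian appears
    only in coordinates. The remainders of the pieces share one measure and cancel under the
    integral by [gradient_dot_partition]. *)
Lemma integral_divergence :
  \sum_(p <- s) \int[lebesgue3]_(z in piece p)
    (chi p (of_coord (chart_at A p) (vec3 z)) *
     (phi' (f (of_coord (chart_at A p) (vec3 z))) *
        grad_sq (g (chart_at A p)) (f \o of_coord (chart_at A p)) (vec3 z)
      + phi (f (of_coord (chart_at A p) (vec3 z))) *
        laplacian (g (chart_at A p)) (f \o of_coord (chart_at A p)) (vec3 z))
     * Num.sqrt (\det (g (chart_at A p) (vec3 z)))) = 0.
Proof.
under eq_bigr do rewrite integral_piece_divergence.
rewrite sumrN -(@Rintegral_sum_continuous R M compactM mu _ s (fun p q => phi (f q) * gradient_dot (chi p) f q) mu_fin).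
  rewrite (@eq_Rintegral _ _ _ _ _ (fun=> 0)) ?Rintegral_cst ?mul0r ?oppr0//.
  by move=> q _; rewrite -mulr_sumr gradient_dot_partition mulr0.
move=> p q; apply: continuous_mulf; first exact: continuous_phi_f.
exact: continuous_gradient_dot.
Qed.

End DivergenceTheorem.

(** * The entropy along the backward flow *)

Section EntropyDensity.
Context {R : realType}.

Lemma is_derive_expRN (y : R) : is_derive y (1 : R) (fun y => expR (- y)) (- expR (- y)).
Proof.
have d1 : is_derive y (1 : R) -%R (-1) by exact: (is_deriveN (is_derive_id _ _)).
have := @is_derive1_comp _ expR -%R y _ _ (is_derive_expR _) d1.
by rewrite mulrN1.
Qed.

Lemma is_derive_mul_expRN (y : R) :
  is_derive y (1 : R) (fun y => y * expR (- y)) ((1 - y) * expR (- y)).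
Proof.
have := @is_deriveM _ _ id (fun y => expR (- y)) y (1 : R) _ _ (is_derive_id _ _) (is_derive_expRN y).
rewrite [X in is_derive _ _ _ X -> _](_ : _ = (1 - y) * expR (- y))//.
by rewrite /GRing.scale/=; ring.
Qed.

Lemma is_derive_onem_mul_expRN (y : R) :
  is_derive y (1 : R) (fun y => (1 - y) * expR (- y)) ((y - 2) * expR (- y)).
Proof.
have d1 : is_derive y (1 : R) (fun y => 1 - y) (-1).
  have := is_deriveB (is_derive_cst (1 : R) y (1 : R)) (is_derive_id y (1 : R)).
  by rewrite sub0r.
have := @is_deriveM _ _ (fun y : R => 1 - y) (fun y : R => expR (- y)) y (1 : R) _ _ d1 (is_derive_expRN y).
rewrite [X in is_derive _ _ _ X -> _](_ : _ = (y - 2) * expR (- y))//.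
by rewrite /GRing.scale/=; ring.
Qed.

Lemma is_derive_continuous (h : R -> R) (l y : R) : is_derive y (1 : R) h l -> {for y, continuous h}.
Proof. by move=> [d _]; apply: differentiable_continuous; exact/derivable1_diffP. Qed.

Lemma continuous_expRN : continuous (fun y : R => expR (- y)).
Proof. by move=> y; exact: is_derive_continuous (is_derive_expRN y). Qed.

Lemma continuous_subr_mul_expRN : continuous (fun y : R => (y - 2) * expR (- y)).
Proof.
move=> y; apply: (@continuous_mulf R R (fun y => y - 2) (fun y => expR (- y)) y).
  by apply: (@continuous_addf R R id (fun=> - 2) y); [exact: cvg_id|exact: cst_continuous].
exact: continuous_expRN.
Qed.

Lemma sum_invmx_self (G : 'M[R]_3) : G^T = G -> G \in unitmx ->
  \sum_(i < 3) \sum_(j < 3) invmx G i j * G i j = 3.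
Proof. by move=> sG uG; rewrite sum_mulmx_tr sG mulVmx// mxtrace1. Qed.

End EntropyDensity.

(** * The time derivative of the integral of f e^(-f) *)

Section BackwardFlow.
Context {R : realType} {M : ptopologicalType} (A : smooth_atlas R M).
Hypotheses (compactM : compact [set: M]) (hausdorffM : hausdorff_space M).
Variables (T : \bar R) (g : R -> tensor2 A) (mu : R -> {measure set (borel M) -> \bar R}).
Hypothesis flow : normalized_ricci_flow T g mu.
Variables (bstar : R) (f : R -> M -> R) (tau : R -> R) (varpi : R -> probability (borel M) R).
Hypotheses (bstarT : flow_times T bstar) (bstar_gt0 : 0 < bstar)
  (f_smooth : smooth_functions A `[0, bstar] f)
  (tau_gt0 : forall t : R, `[0, bstar]%classic t -> 0 < tau t)
  (f_eq : forall (t : R) (c : chart A) (p : M),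
     `[0, bstar]%classic t -> chart_dom c p ->
     let gc := g (bstar - t) c in
     let u := f t \o of_coord c in
     let x := to_coord c p in
     derives_in `[0, bstar] (f^~ p) t
       (laplacian gc u x - grad_sq gc u x + scal gc x - 3 / 2 * (tau t)^-1))
  (varpi_density : forall t : R, `[0, bstar]%classic t ->
     has_density (varpi t) (mu (bstar - t))
       (fun p => (4 * pi * tau t) `^ (- (3 / 2)) * expR (- f t p))).

Let FT := flow_times T.
Let I : set R := `[0, bstar]%classic.

Lemma backward_time s : I s -> FT (bstar - s).
Proof.
rewrite /I /= in_itv/= => /andP[s0 sb]; have [b0 bT] := bstarT; split.
  by rewrite subr_ge0.
by apply: le_lt_trans bT; rewrite lee_fin gerBl.
Qed.

Lemma f_C1 t : I t -> C1_function A (f t).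
Proof. by move=> It c; exact: (smooth_family_C1 (@chart_cod_open _ _ A c) It (f_smooth c)). Qed.

Lemma partial_f_C1 t (c : chart A) j : I t -> C1_on (chart_cod c) (partial j (f t \o of_coord c)).
Proof.
move=> It; have sp := smooth_family_partial j (f_smooth c).
exact: (smooth_family_C1 (@chart_cod_open _ _ A c) It sp).
Qed.

Lemma f_continuous t : I t -> continuous (f t).
Proof. by move=> It; exact: C1_function_continuous (f_C1 It). Qed.

Lemma continuous_expRN_f t : I t -> continuous (fun p => expR (- f t p)).
Proof.
move=> It p; apply: (continuous_compf (phi := fun y => expR (- y))).
  exact: f_continuous.
exact: continuous_expRN.
Qed.

(** A zero volume would make the total mass of varpi zero. On the compact manifold f is at most some
    C, so w e^(-C) times the volume is at most 1, which makes the volume finite. *)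
Lemma mu_gt0_fin t : I t ->
  (0 < mu (bstar - t)%R setT)%E /\ mu (bstar - t) setT \is a fin_num.
Proof.
move=> It; set m := mu _; set w := (4 * pi * tau t) `^ (- (3 / 2)).
have w0 : 0 < w by rewrite powR_gt0// !mulr_gt0// ?pi_gt0// tau_gt0.
have dens := varpi_density It; rewrite -/m -/w in dens.
have mf := continuous_measurable_borel (f_continuous It).
have mw : measurable_fun [set: borel M] (fun p => (w * expR (- f t p))%:E).
  apply/measurable_EFinP; apply: measurable_funM => //.
  by apply: measurableT_comp => //; exact: measurableT_comp.
have E : (1 = \int[m]_(p in [set: borel M]) (w * expR (- f t p))%:E)%E.
  by rewrite -(dens setT measurableT); exact/esym/probability_setT.
split.
  rewrite lt_neqAle measure_ge0 andbT; apply/negP => /eqP m0.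
  by move: E; rewrite null_set_integral// => /eqP; rewrite onee_eq0.
have [C HC] := continuous_bounded compactM (f_continuous It).
have d0 : 0 < w * expR (- C) by rewrite mulr_gt0// expR_gt0.
have : ((w * expR (- C))%:E * m setT <= 1)%E.
  rewrite E -(integral_cst m measurableT); apply: ge0_le_integral => //.
  - by move=> p _; rewrite lee_fin ltW.
  - move=> p _; rewrite lee_fin ler_pM2l// ler_expR lerN2.
    exact: le_trans (ler_norm _) (HC p).
rewrite ge0_fin_numE// => h; rewrite ltey; apply/eqP => moo.
by move: h; rewrite moo gt0_muley ?lte_fin// leye_eq.
Qed.

Lemma flow_measure b : FT b -> riemannian_measure (g b) (mu b).
Proof. by have [_ + _] := flow; exact. Qed.

Lemma integral_expRN t : I t ->
  \int[mu (bstar - t)]_(p in [set: borel M]) expR (- f t p) = heat_weight (tau t).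
Proof.
move=> It; have [m0 mfin] := mu_gt0_fin It.
have hw0 : 0 < heat_weight (tau t) by rewrite powR_gt0// !mulr_gt0// ?pi_gt0// tau_gt0.
have := varpi_density It measurableT; rewrite powRN -/(heat_weight (tau t)).
move=> /(congr1 fine); rewrite (probability_setT (varpi t)) -/(Rintegral _ _ _).
rewrite RintegralZl//; last first.
  by apply: (integrable_continuous compactM mfin); exact: continuous_expRN_f.
by move=> /= /(congr1 (fun r => heat_weight (tau t) * r)); rewrite mulr1 mulrA mulfV ?gt_eqF// mul1r.
Qed.

Let m t := mean_scalar_curvature (g (bstar - t)) (mu (bstar - t)).

(* The time derivative of f e^(-f) dmu up to the divergence
   div ((1 - f) e^(-f) grad f) dmu. *)
Definition entropy_integrand (t : R) (p : M) : R :=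
  expR (- f t p) * (gradient_sq (g (bstar - t)) (f t) p
    + scalar_curvature (g (bstar - t)) p - 3 / 2 * (tau t)^-1
    + (3 / 2 * (tau t)^-1 - m t) * f t p).

Lemma continuous_gradient_sq t : I t -> continuous (gradient_sq (g (bstar - t)) (f t)).
Proof.
move=> It; have rg := flow_riemannian flow (backward_time It).
exact: (continuous_gradient_dot rg (fun c i j => @flow_C1 _ _ _ _ _ _ flow _ c i j (backward_time It))
  (f_C1 It) (f_C1 It)).
Qed.

Lemma continuous_entropy_integrand t : I t -> continuous (entropy_integrand t).
Proof.
move=> It.
have cG := continuous_gradient_sq It.
have cS := continuous_scalar_curvature flow (backward_time It).
have cf := f_continuous It; have ce := continuous_expRN_f It.
move=> p; apply: (continuous_mulf (ce p)).
apply: (@continuous_addf _ M); last first.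
  by apply: (@continuous_mulf _ M); [exact: cst_continuous|exact: cf].
apply: (@continuous_addf _ M); last exact: cst_continuous.
by apply: (@continuous_addf _ M); [exact: cG|exact: cS].
Qed.

(** The rate of f e^(-f) sqrt(det g) divided by sqrt(det g), with the time derivatives left
    unevaluated. Smoothness gives their joint continuity in (s, x) directly; substituting the
    equations would bring in the mean scalar curvature, whose continuity in time would need an
    argument of its own. The minus sign comes from the backward time. *)
Definition chart_rate (s : R) (c : chart A) (x : 'rV[R]_3) : R :=
  (1 - f s (of_coord c x)) * expR (- f s (of_coord c x)) *
    derive_in I (fun u => f u (of_coord c x)) s
  + f s (of_coord c x) * expR (- f s (of_coord c x)) *
    (2^-1 * \sum_(i < 3) \sum_(j < 3) invmx (g (bstar - s) c x) i j *
      - derive_in FT (fun b => g b c x i j) (bstar - s)).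

Lemma jointly_continuous_f (c : chart A) : jointly_continuous I (chart_cod c) (fun s x => f s (of_coord c x)).
Proof. exact: (smooth_family_continuous (f_smooth c)). Qed.

Lemma jointly_continuous_flow (c : chart A) i j :
  jointly_continuous I (chart_cod c) (fun s x => g (bstar - s) c x i j).
Proof.
exact: (jointly_continuous_reverse backward_time (smooth_family_continuous (flow_smooth flow c i j))).
Qed.

Lemma flow_det_gt0 (c : chart A) s x : I s -> chart_cod c x -> 0 < \det (g (bstar - s) c x).
Proof. by move=> Is; exact: (riemannian_det_gt0 (flow_riemannian flow (backward_time Is))). Qed.

Lemma jointly_continuous_volume (c : chart A) :
  jointly_continuous I (chart_cod c) (fun s x => Num.sqrt (\det (g (bstar - s) c x))).
Proof.
exact: (jointly_continuous_sqrt_det (G := fun s => g (bstar - s) c) (@jointly_continuous_flow c)).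
Qed.

Lemma jointly_continuous_chart_rate (c : chart A) :
  jointly_continuous I (chart_cod c) (fun s x => chart_rate s c x).
Proof.
have ce : jointly_continuous I (chart_cod c) (fun s x => expR (- f s (of_coord c x))).
  exact: (jointly_continuous_comp (phi := fun y => expR (- y)) (@jointly_continuous_f c)
    (fun s x _ _ => @continuous_expRN R _)).
apply: jointly_continuousD.
  apply: jointly_continuousM.
    apply: jointly_continuousM => //; apply: jointly_continuousD.
      by apply: jointly_continuous_space => x _; exact: cst_continuous.
    exact: (jointly_continuousN (@jointly_continuous_f c)).
  exact: (smooth_family_derive_continuous (f_smooth c)).
apply: jointly_continuousM.
  by apply: jointly_continuousM => //; exact: jointly_continuous_f.
apply: jointly_continuousM.
  by apply: jointly_continuous_space => x _; exact: cst_continuous.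
apply: jointly_continuous_sum => i; apply: jointly_continuous_sum => j.
apply: jointly_continuousM.
  exact: (jointly_continuous_invmx (G := fun s => g (bstar - s) c) (@jointly_continuous_flow c) (@flow_det_gt0 c)).
apply: jointly_continuousN.
exact: (jointly_continuous_reverse backward_time
  (smooth_family_derive_continuous (flow_smooth flow c i j))).
Qed.

Lemma derives_in_chart_density (c : chart A) s x : I s -> chart_cod c x ->
  derives_in I (fun s => f s (of_coord c x) * expR (- f s (of_coord c x))
                         * Num.sqrt (\det (g (bstar - s) c x))) s
    (chart_rate s c x * Num.sqrt (\det (g (bstar - s) c x))).
Proof.
move=> Is Ux.
have df := smooth_family_derives_in (f_smooth c) Is Ux.
have dk := derives_in_comp df (is_derive_mul_expRN _).
have dG i j : derives_in I (fun s => g (bstar - s) c x i j) s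
    ((\matrix_(i, j) - derive_in FT (fun b => g b c x i j) (bstar - s)) i j).
  rewrite mxE; apply: (derives_in_sub backward_time).
  exact: (derives_in_reverse (smooth_family_derives_in (flow_smooth flow c i j) (backward_time Is) Ux)).
have dq := derives_in_sqrt_det (riemannian_sym (flow_riemannian flow (backward_time Is)) Ux)
  (flow_det_gt0 Is Ux) dG.
have := derives_inM dk dq.
rewrite [X in derives_in _ _ _ X -> _](_ : _ =
  chart_rate s c x * Num.sqrt (\det (g (bstar - s) c x)))//.
rewrite /chart_rate [RHS]mulrDl /=; congr (_ + _); rewrite -!mulrA; congr (_ * _); congr (_ * _).
rewrite mulrCA; congr (_ * _); rewrite mulrC; congr (_ * _).
by apply: eq_bigr => i _; apply: eq_bigr => j _; rewrite mxE.
Qed.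

Lemma chart_rateE (c : chart A) t x : I t -> chart_cod c x ->
  chart_rate t c x =
  (f t (of_coord c x) - 2) * expR (- f t (of_coord c x)) *
     grad_sq (g (bstar - t) c) (f t \o of_coord c) x
  + (1 - f t (of_coord c x)) * expR (- f t (of_coord c x)) *
     laplacian (g (bstar - t) c) (f t \o of_coord c) x
  + entropy_integrand t (of_coord c x).
Proof.
move=> It Ux; have Ft := backward_time It; have [domx xK] := of_coordK Ux.
have rg := flow_riemannian flow Ft.
have fE := derives_in_derive_in (itvcc_proper bstar_gt0 It) (f_eq It domx).
rewrite /= xK in fE.
have scE := scalar_curvatureE flow Ft domx; rewrite xK in scE.
have gE : gradient_sq (g (bstar - t)) (f t) (of_coord c x) =
    grad_sq (g (bstar - t) c) (f t \o of_coord c) x.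
  exact: (gradient_dotE rg (f_C1 It) (f_C1 It) Ux).
(* The trace of minus the flow equation: -2 Ric gives 2 R, and since the metric has trace 3 the
   normalizing term gives -2 m. *)
have HE : \sum_(i < 3) \sum_(j < 3) invmx (g (bstar - t) c x) i j *
      - derive_in FT (fun b => g b c x i j) (bstar - t) =
    2 * scal (g (bstar - t) c) x - 2 * m t.
  have -> : 2 * m t = 2 / 3 * m t *
      \sum_(i < 3) \sum_(j < 3) invmx (g (bstar - t) c x) i j * g (bstar - t) c x i j.
    by rewrite (sum_invmx_self (riemannian_sym rg Ux) (riemannian_unit rg Ux)); field.
  rewrite /scal !mulr_sumr -sumrB; apply: eq_bigr => i _.
  rewrite !mulr_sumr -sumrB; apply: eq_bigr => j _.
  by rewrite (flow_ricciE flow _ _ Ft Ux) /m /FT; field.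
rewrite /chart_rate fE HE /entropy_integrand gE scE; field.
by rewrite gt_eqF// tau_gt0.
Qed.

Local Notation lebesgue3 := ((@lebesgue_measure R \x @lebesgue_measure R) \x @lebesgue_measure R)%E.

(** The partition does not depend on time, so each piece is differentiated separately over a fixed
    cube. The derivative of one piece is not the corresponding piece of the claimed integral: the
    difference is chi_p times a divergence, and it disappears only in the sum over p. *)
Lemma derives_in_entropy_integral t : I t ->
  derives_in I (fun s => \int[mu (bstar - s)]_(p in [set: borel M]) (f s p * expR (- f s p))) t
    (\int[mu (bstar - t)]_(p in [set: borel M]) entropy_integrand t p).
Proof.
move=> It.
have [s [r [chi [r_cube chi_C1 chi_supp chi_sum1]]]] := @partition_of_unity R M A compactM hausdorffM.
pose sq u c x := Num.sqrt (\det (g (bstar - u) c x)).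
pose piece p := vec3 @^-1` (cube (to_coord (chart_at A p) p) (r p)).
pose F p u x := chi p (of_coord (chart_at A p) x) *
  (f u (of_coord (chart_at A p) x) * expR (- f u (of_coord (chart_at A p) x)) * sq u (chart_at A p) x).
pose F' p u x := chi p (of_coord (chart_at A p) x) *
  (chart_rate u (chart_at A p) x * sq u (chart_at A p) x).
pose B p x := chi p (of_coord (chart_at A p) x) * entropy_integrand t (of_coord (chart_at A p) x)
  * sq t (chart_at A p) x.
have part u h : I u -> continuous h ->
    \int[mu (bstar - u)]_(p in [set: borel M]) h p =
    \sum_(p <- s) \int[lebesgue3]_(z in piece p)
      (chi p (of_coord (chart_at A p) (vec3 z)) * h (of_coord (chart_at A p) (vec3 z))
       * sq u (chart_at A p) (vec3 z)).
  move=> Iu ch; have Fu := backward_time Iu; have [_ mfin] := mu_gt0_fin Iu.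
  exact: (Rintegral_partition compactM hausdorffM (flow_riemannian flow Fu) (flow_measure Fu)
    (fun c i j => @flow_C1 _ _ _ _ _ _ flow _ c i j Fu) r_cube chi_C1 chi_supp chi_sum1 mfin ch).
have chi_jc p : jointly_continuous I (chart_cod (chart_at A p))
    (fun _ x => chi p (of_coord (chart_at A p) x)).
  by apply: jointly_continuous_space => x Ux; exact: (C1_continuous (@chi_C1 p _) Ux).
have ck u : I u -> continuous (fun p => f u p * expR (- f u p)).
  by move=> Iu p; exact: (continuous_mulf (@f_continuous u Iu p) (@continuous_expRN_f u Iu p)).
have F'jc p : jointly_continuous I (chart_cod (chart_at A p)) (F' p).
  apply: jointly_continuousM => //.
  apply: jointly_continuousM; last exact: jointly_continuous_volume.
  exact: jointly_continuous_chart_rate.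
have Fjc p : jointly_continuous I (chart_cod (chart_at A p)) (F p).
  apply: jointly_continuousM => //.
  apply: jointly_continuousM; last exact: jointly_continuous_volume.
  apply: jointly_continuousM; first exact: jointly_continuous_f.
  exact: (jointly_continuous_comp (phi := fun y => expR (- y)) (@jointly_continuous_f _)
    (fun s x _ _ => @continuous_expRN R _)).
have oU p := @chart_cod_open _ _ A (chart_at A p).
have iF' p : lebesgue3.-integrable (piece p) (EFin \o (F' p t \o vec3)).
  apply: (integrable_cube (oU p) _ (r_cube p).2) => x Ux.
  exact: jointly_continuous_slice (oU p) (F'jc p) It Ux.
have iB p : lebesgue3.-integrable (piece p) (EFin \o (B p \o vec3)).
  apply: (integrable_cube (oU p) _ (r_cube p).2) => x Ux.
  apply: continuous_mulf; last first.
    exact: jointly_continuous_slice (oU p) (@jointly_continuous_volume _) It Ux.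
  apply: continuous_mulf; first exact: (C1_continuous (@chi_C1 p _) Ux).
  by apply: (continuous_in_chart Ux); exact: continuous_entropy_integrand.
have IE : \int[mu (bstar - t)]_(p in [set: borel M]) entropy_integrand t p =
    \sum_(p <- s) \int[lebesgue3]_(z in piece p) F' p t (vec3 z).
  rewrite (part _ _ It (continuous_entropy_integrand It)).
  apply/esym/eqP; rewrite -subr_eq0 -sumrB; apply/eqP.
  have Ft := backward_time It; have [_ mfin] := mu_gt0_fin It.
  (* With phi(y) = (1 - y) e^(-y) and phi'(y) = (y - 2) e^(-y), the integrand is exactly the
     difference exhibited by [chart_rateE]. *)
  have := @integral_divergence R M A compactM hausdorffM _ _ mfin (flow_riemannian flow Ft)
    (flow_measure Ft) (fun c i j => @flow_C1 _ _ _ _ _ _ flow _ c i j Ft) s r chi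
    r_cube chi_C1 chi_supp chi_sum1 (f t) (fun y => (1 - y) * expR (- y))
    (fun y => (y - 2) * expR (- y)) (f_C1 It) (fun c j => @partial_f_C1 t c j It)
    (@is_derive_onem_mul_expRN R) _.
  move=> div0; rewrite -[RHS](div0 (@continuous_subr_mul_expRN R)).
  apply: eq_bigr => p _; rewrite -RintegralB//; last exact: measurable_cube.
  apply: eq_Rintegral => z /set_mem pz; have Ux := (r_cube p).2 _ pz.
  rewrite /F' (chart_rateE It Ux) /sq; ring.
rewrite IE.
apply: (@derives_in_ext _ _ (fun u => \sum_(p <- s) \int[lebesgue3]_(z in piece p) F p u (vec3 z))) => //.
  move=> u /set_mem Iu; rewrite (part _ _ Iu (ck u Iu)); apply: eq_bigr => p _.
  by apply: eq_Rintegral => z _; rewrite /F mulrA.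
apply: derives_in_sum => p.
apply: (derives_in_integral_cube (oU p) (r_cube p).2 It (Fjc p) (F'jc p)) => u x Iu Ux.
have := derives_inM (derives_in_cst I (chi p (of_coord (chart_at A p) x)) u)
  (derives_in_chart_density Iu Ux).
by rewrite mul0r add0r.
Qed.

End BackwardFlow.

(** * The evolution of tau times the entropy *)

Section EntropyIntegrals.
Context {R : realType} {M : ptopologicalType} (A : smooth_atlas R M).
Hypotheses (compactM : compact [set: M]).
Variables (mu : {measure set (borel M) -> \bar R}).
Hypothesis mu_fin : mu setT \is a fin_num.

Lemma Rintegral_lin3 (a b c : R) (h k l : M -> R) : continuous h -> continuous k -> continuous l ->
  \int[mu]_(p in [set: borel M]) (a * h p + b * k p + c * l p) =
  a * \int[mu]_(p in [set: borel M]) h p + b * \int[mu]_(p in [set: borel M]) k p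
  + c * \int[mu]_(p in [set: borel M]) l p.
Proof.
move=> ch ck cl.
have cZ (z : R) (u : M -> R) : continuous u -> continuous (fun p => z * u p).
  by move=> cu p; apply: (@continuous_mulf R M (fun=> z) u p); [exact: cst_continuous|exact: cu].
have iC (u : M -> R) : continuous u -> mu.-integrable [set: borel M] (EFin \o u).
  exact: (integrable_continuous compactM mu_fin).
have cD : continuous (fun p => a * h p + b * k p).
  by move=> p; exact: (@continuous_addf R M _ _ p (cZ a h ch p) (cZ b k ck p)).
rewrite (@RintegralD _ _ _ mu setT (fun p => a * h p + b * k p) (fun p => c * l p)) //;
  [|exact: iC|by apply: iC; exact: cZ].
rewrite (@RintegralD _ _ _ mu setT (fun p => a * h p) (fun p => b * k p)) //;
  [|by apply: iC; exact: cZ|by apply: iC; exact: cZ].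
by rewrite !RintegralZl//; exact: iC.
Qed.

End EntropyIntegrals.

Theorem mainTheorem5 (R : realType) (M : ptopologicalType)
  (A : smooth_atlas R M)
  (compactM : compact [set: M]) (hausdorffM : hausdorff_space M)
  (T : \bar R) (g : R -> tensor2 A)
  (mu : R -> {measure set (borel M) -> \bar R})
  (flow : normalized_ricci_flow T g mu)
  (bstar : R) (bstarT : flow_times T bstar)
  (f : R -> M -> R) (tau : R -> R)
  (varpi : R -> probability (borel M) R)
  (f_smooth : smooth_functions A `[0, bstar] f)
  (tau_gt0 : forall t : R, `[0, bstar]%classic t -> 0 < tau t)
  (f_eq : forall (t : R) (c : chart A) (p : M),
     `[0, bstar]%classic t -> chart_dom c p ->
     let gc := g (bstar - t) c in
     let u := f t \o of_coord c in
     let x := to_coord c p in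
     derives_in `[0, bstar] (f^~ p) t
       (laplacian gc u x - grad_sq gc u x + scal gc x - 3 / 2 * (tau t)^-1))
  (tau_eq : forall t : R, `[0, bstar]%classic t ->
     derives_in `[0, bstar] tau t
       (1 - 2 / 3
            * mean_scalar_curvature (g (bstar - t)) (mu (bstar - t))
            * tau t))
  (varpi_density : forall t : R, `[0, bstar]%classic t ->
     has_density (varpi t) (mu (bstar - t))
       (fun p => (4 * pi * tau t) `^ (- (3 / 2)) * expR (- f t p))) :
  forall t : R, `[0, bstar]%classic t ->
  let calG s := G_functional (mu (bstar - s)) (varpi s) (tau s) in
  derives_in `[0, bstar] (fun s => tau s * calG s) t
    (- W_functional (g (bstar - t)) (mu (bstar - t)) (f t) (tau t)
     - 2 / 3 * mean_scalar_curvature (g (bstar - t)) (mu (bstar - t))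
       * tau t * calG t).
Proof.
(* If bstar = 0 the time interval is a point and every number is a derivative. *)
have [bstar0|] := leP bstar 0.
  have I0 s : `[0, bstar]%classic s -> s = 0.
    rewrite /= in_itv/= => /andP[s0 sb]; apply/eqP; rewrite eq_le s0 andbT.
    exact: le_trans sb bstar0.
  move=> t It calG; apply/derives_inP; exists (fun=> - W_functional (g (bstar - t)) (mu (bstar - t)) (f t) (tau t)
    - 2 / 3 * mean_scalar_curvature (g (bstar - t)) (mu (bstar - t)) * tau t * calG t).
  split=> //; last exact: cvg_cst.
  by move=> s Is; rewrite (I0 s Is) (I0 t It) !subrr mulr0.
move=> bstar_gt0 t It calG.
pose m := mean_scalar_curvature (g (bstar - t)) (mu (bstar - t)).
(* The factor (4 pi tau)^(-3/2) written as an exponential of a logarithm, to which the chain rule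
   applies; it is the inverse of [heat_weight] where tau is positive. *)
pose w s := expR (- (3 / 2) * ln (4 * pi * tau s)).
pose K s := \int[mu (bstar - s)]_(p in [set: borel M]) (f s p * expR (- f s p)).
have lE s : `[0, bstar]%classic s -> 0 < 4 * pi * tau s.
  by move=> Is; rewrite !mulr_gt0 ?pi_gt0// tau_gt0.
have wE s : `[0, bstar]%classic s -> w s = (heat_weight (tau s))^-1.
  by move=> Is; rewrite /w /heat_weight -powRN /powR gt_eqF ?lE.
have fin s Is := @mu_gt0_fin R M A compactM mu bstar f tau varpi f_smooth tau_gt0 varpi_density s Is.
have GE s : `[0, bstar]%classic s -> calG s = 3 / 2 - w s * K s.
  move=> Is; have [m0 mf] := fin s Is.
  have cf := @f_continuous R M A bstar f f_smooth s Is.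
  rewrite wE // /K.
  exact: (G_functional_density (tau_gt0 s Is) m0 mf (continuous_measurable_borel cf)
    (continuous_bounded compactM cf) (varpi_density s Is)).
have dK := @derives_in_entropy_integral R M A compactM hausdorffM T g mu flow bstar f tau varpi
  bstarT bstar_gt0 f_smooth tau_gt0 f_eq varpi_density t It.
have dtau := tau_eq t It; rewrite -/m in dtau.
have tau0 := tau_gt0 t It.
have dw : derives_in `[0, bstar] w t (w t * (- (3 / 2) * ((1 - 2 / 3 * m * tau t) / tau t))).
  have d1 : is_derive (tau t) (1 : R) (fun y => expR (- (3 / 2) * ln (4 * pi * y)))
     (w t * (- (3 / 2) / tau t)).
    have d0 : is_derive (tau t) (1 : R) (fun y : R => 4 * pi * y) (4 * pi).
      have := @is_deriveM _ _ (fun=> 4 * pi : R) id (tau t) (1 : R) _ _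
        (is_derive_cst _ _ _) (is_derive_id _ _).
      by rewrite /GRing.scale/= mulr1 mulr0 addr0.
    have d2 := @is_derive1_comp _ (@ln R) _ _ _ _ (is_derive1_ln (lE t It)) d0.
    have d3 := @is_deriveM _ _ (fun=> - (3 / 2) : R) _ (tau t) (1 : R) _ _ (is_derive_cst _ _ _) d2.
    have := @is_derive1_comp _ expR _ _ _ _ (is_derive_expR _) d3.
    rewrite [X in is_derive _ _ _ X -> _](_ : _ = w t * (- (3 / 2) / tau t))//.
    rewrite /w /GRing.scale/=; have := pi_gt0 R; move: pi => q q0; field.
    by rewrite !gt_eqF.
  have := derives_in_comp dtau d1.
  by rewrite -!mulrA [X in _ * (_ * X)]mulrC.
have [m0 mfin] := fin t It.
have cf := @f_continuous R M A bstar f f_smooth t It.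
have ce := @continuous_expRN_f R M A bstar f f_smooth t It.
have cG := @continuous_gradient_sq R M A T g mu flow bstar f bstarT f_smooth t It.
have cS := continuous_scalar_curvature flow (@backward_time R T bstar bstarT t It).
have cfe p : {for p, continuous (fun p => f t p * expR (- f t p))}.
  exact: (continuous_mulf (cf p) (ce p)).
(* The derivative of K and the functional W are both combinations of three integrals: those of Q, of
   e^(-f), which is the heat weight, and of f e^(-f). What remains is an identity between
   numbers. *)
pose Q p := expR (- f t p) * (gradient_sq (g (bstar - t)) (f t) p + scalar_curvature (g (bstar - t)) p).
have cQ p : {for p, continuous Q}.
  exact: (continuous_mulf (ce p) (continuous_addf (cG p) (cS p))).
set a := \int[mu (bstar - t)]_(p in [set: borel M]) Q p.
have hwE := @integral_expRN R M A compactM mu bstar f tau varpi f_smooth tau_gt0 varpi_density t It.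
have dKE : \int[mu (bstar - t)]_(p in [set: borel M]) entropy_integrand g mu bstar f tau t p =
    1 * a + - (3 / 2 * (tau t)^-1) * heat_weight (tau t) + (3 / 2 * (tau t)^-1 - m) * K t.
  rewrite -hwE -(Rintegral_lin3 compactM mfin 1 _ _ cQ ce cfe).
  by apply: eq_Rintegral => p _; rewrite /entropy_integrand /Q -/m; ring.
have hw0 : 0 < heat_weight (tau t) by rewrite powR_gt0 ?lE.
have WE : W_functional (g (bstar - t)) (mu (bstar - t)) (f t) (tau t) =
    tau t / heat_weight (tau t) * a + - 3 / heat_weight (tau t) * heat_weight (tau t)
    + (heat_weight (tau t))^-1 * K t.
  have := Rintegral_lin3 compactM mfin (tau t / heat_weight (tau t)) (- 3 / heat_weight (tau t))
    (heat_weight (tau t))^-1 cQ ce cfe.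
  rewrite hwE => <-.
  by apply: eq_Rintegral => p _; rewrite /Q; field; rewrite gt_eqF.
(* The terms in [K t] coming from the derivatives of w and of K cancel, so the derivative of [calG]
   is 3 / (2 tau) - a / heat_weight. The term [K t] of W comes back through the derivative of tau,
   whose constant 1 multiplies [calG t]. *)
have dG := derives_inM dtau (derives_inD (derives_in_cst `[0, bstar]%classic (3 / 2) t)
  (derives_inM (derives_in_cst `[0, bstar]%classic (-1) t) (derives_inM dw dK))).
rewrite dKE in dG.
apply: (derives_in_ext It _ _); last first.
  move: dG.
  rewrite [X in derives_in _ _ _ X -> _](_ : _ =
    - W_functional (g (bstar - t)) (mu (bstar - t)) (f t) (tau t)
     - 2 / 3 * mean_scalar_curvature (g (bstar - t)) (mu (bstar - t))
       * tau t * calG t); first exact.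
  rewrite WE GE// -/m wE // -/(K t); field; rewrite !gt_eqF//.
by move=> s /set_mem Is; rewrite GE// mulN1r.
Qed.
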